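(* Let $A_i=\begin{pmatrix}a_i&b_i\\c_i&d_i\end{pmatrix}\in\mathbb{R}^{2\times2}$ with $\det A_i=1$ and $b_i>0$ ($i=1,2$). Let $f\in L^1(\mathbb{R}^2,\mathbb{H})$ and $(x_0,y_0)\in\mathbb{R}^2$. Suppose that in a cross-neighborhood of $(x_0,y_0)$ the function $f$ is a quaternion bounded variation function (QBVF) and the function $(s,t)\mapsto e^{\mathbf{i}\frac{a_1}{2b_1}s^2}f(s,t)e^{\mathbf{j}\frac{a_2}{2b_2}t^2}$ belongs to $\mathbf{LC}$. Let $\mathcal{L}_T^{\mathbf{i},\mathbf{j}}(f)(u,v)=\int_{\mathbb{R}^2}K_{A_1}^{\mathbf{i}}(s,u)f(s,t)K_{A_2}^{\mathbf{j}}(t,v)\,ds\,dt$ be the two-sided quaternion linear canonical transform of $f$. Then $$f(x_0,y_0)=\lim_{N\to\infty,\,M\to\infty}\int_{-N}^{N}\int_{-M}^{M}K_{A_1^{-1}}^{\mathbf{i}}(u,x_0)\,\mathcal{L}_T^{\mathbf{i},\mathbf{j}}(f)(u,v)\,K_{A_2^{-1}}^{\mathbf{j}}(v,y_0)\,du\,dv,$$ where $f(x_0,y_0)$ is understood as $$f(x_0,y_0)=\frac{f(x_0+0,y_0+0)+f(x_0+0,y_0-0)+f(x_0-0,y_0+0)+f(x_0-0,y_0-0)}{4}.$$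
   Context: $\mathbb{H}$ is the algebra of quaternions $q=q_0+\mathbf{i}q_1+\mathbf{j}q_2+\mathbf{k}q_3$ ($q_n\in\mathbb{R}$) with $\mathbf{i}^2=\mathbf{j}^2=\mathbf{k}^2=-1$, $\mathbf{i}\mathbf{j}=-\mathbf{j}\mathbf{i}=\mathbf{k}$, $\mathbf{j}\mathbf{k}=-\mathbf{k}\mathbf{j}=\mathbf{i}$, $\mathbf{k}\mathbf{i}=-\mathbf{i}\mathbf{k}=\mathbf{j}$, and modulus $|q|=(q_0^2+q_1^2+q_2^2+q_3^2)^{1/2}$; $e^{\mathbf{i}\theta}=\cos\theta+\mathbf{i}\sin\theta$ and likewise for $\mathbf{j}$. $L^1(\mathbb{R}^2,\mathbb{H})$ is the space of $f:\mathbb{R}^2\to\mathbb{H}$ with $\int_{\mathbb{R}^2}|f|\,ds\,dt<\infty$; integrals are taken componentwise. One-sided limits: $f(x_0\pm0,y_0\pm0)=\lim_{h\to0^+,k\to0^+}f(x_0\pm h,y_0\pm k)$ (all four sign combinations, double limits). In the double integral $u\in[-M,M]$, $v\in[-N,N]$, and $M,N\to\infty$ independently. Kernels: for a real matrix $A=\begin{pmatrix}a&b\\c&d\end{pmatrix}$ with $\det A=1$, $b\neq0$, and $\mu\in\{\mathbf{i},\mathbf{j}\}$, $K_A^{\mu}(x,y)=\frac{1}{\sqrt{\mu2\pi b}}e^{\mu(\frac{a}{2b}x^2-\frac1bxy+\frac{d}{2b}y^2)}$, where $\sqrt{\mu2\pi b}=\sqrt{2\pi|b|}\,e^{\mu\,\mathrm{sgn}(b)\pi/4}$.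 Since $A^{-1}=\begin{pmatrix}d&-b\\-c&a\end{pmatrix}$, for $b>0$ one has $K_{A^{-1}}^{\mu}(y,x)=\frac{1}{\sqrt{-\mu2\pi b}}e^{\mu(-\frac{d}{2b}y^2+\frac1bxy-\frac{a}{2b}x^2)}$ with $\sqrt{-\mu2\pi b}=\sqrt{2\pi b}\,e^{-\mu\pi/4}$. Bounded variation: a real function $f$ on a rectangle $[a_1,b_1]\times[a_2,b_2]$ is a bounded variation function (BVF) if (i) the sums $\sum_{i=0}^{m-1}\sum_{j=0}^{n-1}|f(s_{i+1},t_{j+1})-f(s_{i+1},t_j)-f(s_i,t_{j+1})+f(s_i,t_j)|$ are bounded over all nets $a_1=s_0<\dots<s_m=b_1$, $a_2=t_0<\dots<t_n=b_2$; (ii) for at least one $\tilde s\in[a_1,b_1]$, $f(\tilde s,\cdot)$ is of (one-dimensional) bounded variation on $[a_2,b_2]$; (iii) for at least one $\tilde t\in[a_2,b_2]$, $f(\cdot,\tilde t)$ is of bounded variation on $[a_1,b_1]$. (Here $a_i,b_i$ are rectangle endpoints, not matrix entries.) A quaternionic function $f=f_0+\mathbf{i}f_1+\mathbf{j}f_2+\mathbf{k}f_3$ ($f_n$ real) is a QBVF if and only if each component $f_n$, $n=0,1,2,3$, is a BVF. Cross-neighborhood: for $\varepsilon_1,\varepsilon_2>0$, the set of points $(s,t)$ with $|s-x_0|\le\varepsilon_1$ or $|t-y_0|\le\varepsilon_2$ (or both). A function is a BVF (QBVF) in this set if its restriction to each closed bounded rectangle contained in it is. Class $\mathbf{LC}$: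 for a function $g$ on $\mathbb{R}^2$ put $\tilde g(s,t)=g(x_0-s,y_0-t)+g(x_0+s,y_0+t)+g(x_0-s,y_0+t)+g(x_0+s,y_0-t)$, $\mathbb{A}=\{s\in\mathbb{R}:\int_{\mathbb{R}}|\tilde g(s,t)|dt<\infty\}$, $\mathbb{B}=\{t\in\mathbb{R}:\int_{\mathbb{R}}|\tilde g(s,t)|ds<\infty\}$. Then $g$ belongs to $\mathbf{LC}$ in the cross-neighborhood of $(x_0,y_0)$ with parameters $\varepsilon_1,\varepsilon_2$ if for some $a\in\mathbb{A}$, $b\in\mathbb{B}$ $$\int_{\varepsilon_2}^{\infty}\int_0^{\varepsilon_1}\left|\frac{\tilde g(s,t)-\tilde g(a,t)}{s}\right|ds\,dt<\infty,\qquad \int_{\varepsilon_1}^{\infty}\int_0^{\varepsilon_2}\left|\frac{\tilde g(s,t)-\tilde g(s,b)}{t}\right|dt\,ds<\infty.$$ *)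

(* Defs.v *)
From HB Require Import structures.
From mathcomp Require Import all_boot all_order all_algebra.
From mathcomp Require Import ring lra.
From mathcomp Require Import all_classical all_reals all_analysis.

Set Implicit Arguments.
Unset Strict Implicit.
Unset Printing Implicit Defensive.

Import Order.TTheory GRing.Theory Num.Theory.
Import numFieldNormedType.Exports.

Local Open Scope classical_set_scope.
Local Open Scope ring_scope.

Record quat (R : Type) := Quat { qr : R ; qi : R ; qj : R ; qk : R }.

(* [q0; q1; q2; q3] are the coordinates of q0 + i q1 + j q2 + k q3. *)
Section QuatStructure.
Variable R : realType.
Implicit Types p q : quat R.

Definition tuple_of_quat q := (qr q, qi q, qj q, qk q).
Definition quat_of_tuple (t : R * R * R * R) :=
  let: (a, b, c, d) := t in Quat a b c d.

Lemma tuple_of_quatK : cancel tuple_of_quat quat_of_tuple.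
Proof. by case. Qed.

HB.instance Definition _ := Choice.copy (quat R) (can_type tuple_of_quatK).

Definition addq p q := Quat (qr p + qr q) (qi p + qi q) (qj p + qj q) (qk p + qk q).
Definition oppq p := Quat (- qr p) (- qi p) (- qj p) (- qk p).
Definition mulq p q := Quat
  (qr p * qr q - qi p * qi q - qj p * qj q - qk p * qk q)
  (qr p * qi q + qi p * qr q + qj p * qk q - qk p * qj q)
  (qr p * qj q - qi p * qk q + qj p * qr q + qk p * qi q)
  (qr p * qk q + qi p * qj q - qj p * qi q + qk p * qr q).
Definition scaleq (a : R) q := Quat (a * qr q) (a * qi q) (a * qj q) (a * qk q).
Definition sqr_qnorm q := qr q ^+ 2 + qi q ^+ 2 + qj q ^+ 2 + qk q ^+ 2.
Definition conjq q := Quat (qr q) (- qi q) (- qj q) (- qk q).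

Lemma addqA : associative addq.
Proof. by move=> [? ? ? ?] [? ? ? ?] [? ? ? ?]; congr Quat; rewrite /= addrA. Qed.
Lemma addqC : commutative addq.
Proof. by move=> [? ? ? ?] [? ? ? ?]; congr Quat; rewrite /= addrC. Qed.
Lemma add0q : left_id (Quat 0 0 0 0) addq.
Proof. by move=> [? ? ? ?]; congr Quat; rewrite /= add0r. Qed.
Lemma addNq : left_inverse (Quat 0 0 0 0) oppq addq.
Proof. by move=> [? ? ? ?]; congr Quat; rewrite /= addNr. Qed.

HB.instance Definition _ := GRing.isZmodule.Build (quat R) addqA addqC add0q addNq.

Lemma mulqA : associative mulq.
Proof. by move=> [? ? ? ?] [? ? ? ?] [? ? ? ?]; congr Quat => /=; ring. Qed.
Lemma mul1q : left_id (Quat 1 0 0 0) mulq.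
Proof. by move=> [? ? ? ?]; congr Quat => /=; ring. Qed.
Lemma mulq1 : right_id (Quat 1 0 0 0) mulq.
Proof. by move=> [? ? ? ?]; congr Quat => /=; ring. Qed.
Lemma mulqDl : left_distributive mulq addq.
Proof. by move=> [? ? ? ?] [? ? ? ?] [? ? ? ?]; congr Quat => /=; ring. Qed.
Lemma mulqDr : right_distributive mulq addq.
Proof. by move=> [? ? ? ?] [? ? ? ?] [? ? ? ?]; congr Quat => /=; ring. Qed.
Lemma oneq_neq0 : Quat 1 0 0 0 != 0 :> quat R.
Proof. by apply/eqP => -[/eqP]; rewrite oner_eq0. Qed.

HB.instance Definition _ := GRing.Zmodule_isNzRing.Build (quat R)
  mulqA mul1q mulq1 mulqDl mulqDr oneq_neq0.

Lemma scaleqA a b q : scaleq a (scaleq b q) = scaleq (a * b) q.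
Proof. by congr Quat; rewrite /= mulrA. Qed.
Lemma scale1q : left_id 1 scaleq.
Proof. by move=> [? ? ? ?]; congr Quat; rewrite /= mul1r. Qed.
Lemma scaleqDr : right_distributive scaleq +%R.
Proof. by move=> ? [? ? ? ?] [? ? ? ?]; congr Quat; rewrite /= mulrDr. Qed.
Lemma scaleqDl q : {morph scaleq^~ q : a b / a + b}.
Proof. by move=> a b; congr Quat; rewrite /= mulrDl. Qed.

HB.instance Definition _ := GRing.Zmodule_isLmodule.Build R (quat R)
  scaleqA scale1q scaleqDr scaleqDl.

Definition invq q := if q == 0 then q else (sqr_qnorm q)^-1 *: conjq q.

Lemma sqr_qnorm_eq0 q : (sqr_qnorm q == 0) = (q == 0).
Proof.
case: q => a b c d; rewrite /sqr_qnorm /=.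
rewrite !paddr_eq0 ?addr_ge0 ?sqr_ge0// !sqrf_eq0.
apply/idP/eqP => [/andP[/andP[/andP[/eqP-> /eqP->] /eqP->] /eqP->]//|].
by case=> -> -> -> ->; rewrite eqxx.
Qed.

Lemma mulVq : {in [pred q : quat R | q != 0], left_inverse 1 invq *%R}.
Proof.
move=> q; rewrite inE => q0; rewrite /invq (negbTE q0).
move: q0; rewrite -sqr_qnorm_eq0; case: q => a b c d n0.
by congr Quat; move: n0; rewrite /sqr_qnorm /= => n0; field.
Qed.
Lemma mulqV : {in [pred q : quat R | q != 0], right_inverse 1 invq *%R}.
Proof.
move=> q; rewrite inE => q0; rewrite /invq (negbTE q0).
move: q0; rewrite -sqr_qnorm_eq0; case: q => a b c d n0.
by congr Quat; move: n0; rewrite /sqr_qnorm /= => n0; field.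
Qed.
Lemma unitqP p q : q * p = 1 /\ p * q = 1 -> p != 0.
Proof.
by move=> [_ pq]; apply: contra_eq_neq pq => ->; rewrite mul0r eq_sym oner_neq0.
Qed.
Lemma invq_out : {in [predC [pred q : quat R | q != 0]], invq =1 id}.
Proof. by move=> q; rewrite !inE negbK /invq => ->. Qed.

HB.instance Definition _ := GRing.NzRing_hasMulInverse.Build (quat R)
  mulVq mulqV unitqP invq_out.

Definition qnorm q : R := Num.sqrt (sqr_qnorm q).

End QuatStructure.

Definition iq {R : realType} : quat R := Quat 0 1 0 0.
Definition jq {R : realType} : quat R := Quat 0 0 1 0.
Definition kq {R : realType} : quat R := Quat 0 0 0 1.

Lemma quat_mulE (R : realType) :
  [/\ iq * iq = -1 :> quat R, jq * jq = -1 :> quat R, kq * kq = -1 :> quat R &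
   [/\ iq * jq = kq :> quat R, jq * kq = iq :> quat R, kq * iq = jq :> quat R &
   [/\ jq * iq = - kq :> quat R, kq * jq = - iq :> quat R &
       iq * kq = - jq :> quat R]]].
Proof. by do ![split]; congr Quat => /=; ring. Qed.

Section Defs.
Variable R : realType.

(* e^(mu theta), meaningful when mu * mu = -1. *)
Definition qexp (mu : quat R) (theta : R) : quat R :=
  cos theta *: (1 : quat R) + sin theta *: mu.

(* F tends to l along the filter, for the modulus on H. *)
Definition qcvg (T : Type) (F : set_system T) (g : T -> quat R) (l : quat R) :=
  qnorm (g x - l) @[x --> F] --> (0 : R).

(* The measurable sets of R and R * R are the Borel sets; a function is
   Lebesgue measurable iff it agrees with a Borel function off a null set.
   Library integrals of such a function agree with those of the Borel one. *)
Definition ae_measurable d (T : measurableType d)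
    (m : {measure set T -> \bar R}) (g : T -> R) :=
  exists2 h : T -> R, measurable_fun setT h & g = h %[ae m].

Definition qae_measurable d (T : measurableType d)
    (m : {measure set T -> \bar R}) (g : T -> quat R) :=
  [/\ ae_measurable m (fun x => qr (g x)), ae_measurable m (fun x => qi (g x)),
      ae_measurable m (fun x => qj (g x)) & ae_measurable m (fun x => qk (g x))].

Definition qL1 d (T : measurableType d)
    (m : {measure set T -> \bar R}) (g : T -> quat R) :=
  qae_measurable m g /\ (\int[m]_x (qnorm (g x))%:E < +oo)%E.

Definition qintegral d (T : measurableType d)
    (m : {measure set T -> \bar R}) (D : set T) (g : T -> quat R) : quat R :=
  Quat (\int[m]_(x in D) qr (g x)) (\int[m]_(x in D) qi (g x))
       (\int[m]_(x in D) qj (g x)) (\int[m]_(x in D) qk (g x)).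

Notation leb := (@lebesgue_measure R).
Definition leb2 : {measure set (measurableTypeR R * measurableTypeR R) -> \bar R} := (leb \x leb)%E.

(* The branch sqrt (2 pi |b|) e^(mu sgn(b) pi / 4) of the square root of mu 2 pi b. *)
Definition qsqrt2pi (mu : quat R) (b : R) : quat R :=
  Num.sqrt (2 * pi * `|b|) *: qexp mu (Num.sg b * pi / 4).

Definition lct_kernel (mu : quat R) (A : 'M[R]_2) (x y : R) : quat R :=
  let a := A 0 0 in let b := A 0 1 in let d := A 1 1 in
  (qsqrt2pi mu b)^-1 *
  qexp mu (a / (2 * b) * x ^+ 2 - b^-1 * (x * y) + d / (2 * b) * y ^+ 2).

Definition qlct (A1 A2 : 'M[R]_2) (f : R * R -> quat R) (u v : R) : quat R :=
  qintegral leb2 setT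
    (fun p => lct_kernel iq A1 p.1 u * f p * lct_kernel jq A2 p.2 v).

(* The integral of the inversion formula over u in [-M, M], v in [-N, N]. *)
Definition inv_qlct_partial (A1 A2 : 'M[R]_2) (f : R * R -> quat R)
    (x0 y0 M N : R) : quat R :=
  qintegral leb `[- N, N] (fun v =>
    qintegral leb `[- M, M] (fun u =>
      lct_kernel iq (invmx A1) u x0 * qlct A1 A2 f u v *
      lct_kernel jq (invmx A2) v y0)).

(* As for the one-dimensional [variation], a net is the head a1 (resp. a2)
   followed by a strictly increasing sequence ending at b1 (resp. b2). *)
Definition variation2 (a1 b1 a2 b2 : R) (g : R * R -> R) (s t : seq R) : R :=
  let S := nth b1 (a1 :: s) in let T := nth b2 (a2 :: t) in
  \sum_(0 <= i < size s) \sum_(0 <= j < size t)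
    `|g (S i.+1, T j.+1) - g (S i.+1, T j) - g (S i, T j.+1) + g (S i, T j)|.

Definition BVF (a1 b1 a2 b2 : R) (g : R * R -> R) :=
  [/\ exists C : R, forall s t, itv_partition a1 b1 s -> itv_partition a2 b2 t ->
        variation2 a1 b1 a2 b2 g s t <= C,
      exists2 s, s \in `[a1, b1] & bounded_variation a2 b2 (fun t => g (s, t)) &
      exists2 t, t \in `[a2, b2] & bounded_variation a1 b1 (fun s => g (s, t))].

Definition QBVF (a1 b1 a2 b2 : R) (g : R * R -> quat R) :=
  [/\ BVF a1 b1 a2 b2 (fun p => qr (g p)), BVF a1 b1 a2 b2 (fun p => qi (g p)),
      BVF a1 b1 a2 b2 (fun p => qj (g p)) & BVF a1 b1 a2 b2 (fun p => qk (g p))].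

Definition cross (x0 y0 e1 e2 : R) : set (R * R) :=
  [set p | `|p.1 - x0| <= e1 \/ `|p.2 - y0| <= e2].

Definition QBVF_on (E : set (R * R)) (g : R * R -> quat R) :=
  forall a1 b1 a2 b2 : R, a1 < b1 -> a2 < b2 ->
    `[a1, b1] `*` `[a2, b2] `<=` E -> QBVF a1 b1 a2 b2 g.

Definition symm (x0 y0 : R) (g : R * R -> quat R) (s t : R) : quat R :=
  g (x0 - s, y0 - t) + g (x0 + s, y0 + t) +
  g (x0 - s, y0 + t) + g (x0 + s, y0 - t).

Definition LC (x0 y0 e1 e2 : R) (g : R * R -> quat R) :=
  let gt := symm x0 y0 g in
  exists a b : R,
    [/\ qL1 leb (fun t => gt a t),
        qL1 leb (fun s => gt s b),
        (\int[leb]_(t in `[e2, +oo[) \int[leb]_(s in `[0%R, e1])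
           (qnorm (s^-1 *: (gt s t - gt a t)))%:E < +oo)%E &
        (\int[leb]_(s in `[e1, +oo[) \int[leb]_(t in `[0%R, e2])
           (qnorm (t^-1 *: (gt s t - gt s b)))%:E < +oo)%E].

Definition chirped (A1 A2 : 'M[R]_2) (f : R * R -> quat R) (p : R * R) : quat R :=
  qexp iq (A1 0 0 / (2 * A1 0 1) * p.1 ^+ 2) * f p *
  qexp jq (A2 0 0 / (2 * A2 0 1) * p.2 ^+ 2).

End Defs.

(* Main.v *)
From HB Require Import structures.
Require Import Defs.
From mathcomp Require Import all_boot all_order all_algebra.
From mathcomp Require Import ring lra.
From mathcomp Require Import all_classical all_reals all_analysis.
From mathcomp Require Import measurable_realfun.
Set Implicit Arguments.
Unset Strict Implicit.
Unset Printing Implicit Defensive.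
Import Order.TTheory GRing.Theory Num.Theory.
Import numFieldNormedType.Exports.
Local Open Scope classical_set_scope.
Local Open Scope ring_scope.

(** Idea of the proof. The kernels are exponentials, so the factors of the
    inverse transform recombine with those of the direct one:
    K_{A1^-1}(u, x0) K_{A1}(s, u) is a constant times
    exp(i u (x0 - s) / b1) exp(i alpha (s^2 - x0^2)), with alpha = a1 / (2 b1),
    and similarly on the right with j, which stays on its own side of f
    ([lct_kernel_inv]). The function under study thus becomes
    g(s, t) = exp(i alpha (s^2 - x0^2)) f(s, t) exp(j beta (t^2 - y0^2))
    ([rephased]), which has the same one-sided limits as f at (x0, y0); it differs
    from the chirped function of the condition LC by constant factors of modulus 1.
    For the truncated integral, Fubini's theorem lets the integrals over u and v act
    first; the sines integrate to 0 and the cosines give Dirichlet kernels, so that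
    every coordinate of the partial inversion integral is
      pi^-2 int g_n(s, t) D_{M/b1}(s - x0) D_{N/b2}(t - y0) ds dt,
    where D_M(s) = sin (M s) / s ([inv_qlct_partialE]).

    Everything is now real. Folding the plane onto the quadrant s, t > 0 at
    (x0, y0) replaces g_n by the sum H of its four reflections ([fold_plane]), and
    the limit is found on four regions of the quadrant ([quadrant_lim2]). Far
    from both axes 1 / (s t) is bounded and the integral tends to 0 by the
    Riemann-Lebesgue lemma. On a strip close to one axis, the condition LC says
    that (H(s, t) - P(t)) / s is integrable for a function P of t only; the
    Riemann-Lebesgue lemma disposes of that part, and P(t) D_M(s) integrates to a
    product of a bounded factor and of one which tends to 0. Close to the corner,
    H has bounded variation and a two-dimensional version of Jordan's theorem
    gives the limit (pi/2)^2 H(0+, 0+) ([bv2_dirk_lim2]). As H(0+, 0+) is the sum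
    of the four limits of f, the factor pi^-2 turns this into their mean.

    The two-dimensional Jordan theorem is obtained by regarding a function of two
    variables of bounded variation as a function of s with values in the functions
    of t of bounded variation, normed by |phi(e)| + Var(phi) ([nv], [bv2]). Such a
    function has small variation close to s = 0, which gives both the existence of
    the double limit at the corner ([bv2_cvg]) and the reduction to the
    one-dimensional theorem ([bv2_dirk_section]); the latter comes from the second
    mean value inequality ([bv_integral_bound]).

    Measurability in the statement is that of Lebesgue, so f is first exchanged for
    a Borel function equal to it almost everywhere ([qL1_borel]); the variation and
    the limits remain those of f itself. *)

Local Notation T2 R := (measurableTypeR R * measurableTypeR R)%type.
Local Notation leb := (@lebesgue_measure _).
Local Notation integrable1 F := ((@lebesgue_measure _).-integrable setT (EFin \o F)).
Local Notation integrable2 F := ((leb2 _).-integrable setT (EFin \o F)).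

(** * Sums over nets *)

Section Nets.
Context {R : realType}.

(** The common shape of one- and two-dimensional variations: rho x y is the size of
    an increment between the neighbours x and y. *)
Fixpoint netsum (T : Type) (rho : T -> T -> R) (s : seq T) : R :=
  if s is x :: s' then (if s' is y :: _ then rho x y else 0) + netsum rho s'
  else 0.

Lemma netsum_ge0 T (rho : T -> T -> R) s :
  (forall x y, 0 <= rho x y) -> 0 <= netsum rho s.
Proof.
move=> rho0; elim: s => //= x [|y s] IH; first by rewrite addr0.
by rewrite addr_ge0.
Qed.

Lemma netsum_cat T (rho : T -> T -> R) s t : (forall x y, 0 <= rho x y) ->
  netsum rho s + netsum rho t <= netsum rho (s ++ t).
Proof.
move=> rho0; elim: s => [|x s IH]; first by rewrite add0r.
rewrite /= -addrA lerD//; case: s {IH} => //=.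
by case: t.
Qed.

Lemma ler_netsum (T : eqType) (rho rho' : T -> T -> R) s :
  {in s &, forall x y, rho x y <= rho' x y} -> netsum rho s <= netsum rho' s.
Proof.
elim: s => //= x s IH h; rewrite lerD//.
  by case: s h {IH} => // y s; apply; rewrite !inE eqxx ?orbT.
by apply: IH => u v us vs; apply: h; rewrite inE ?us ?vs orbT.
Qed.

Lemma eq_netsum (T : eqType) (rho rho' : T -> T -> R) s :
  (forall x y, rho x y = rho' x y) -> netsum rho s = netsum rho' s.
Proof. by move=> h; elim: s => //= x [|y s] ->; rewrite ?h. Qed.

Lemma netsumD T (rho rho' : T -> T -> R) s :
  netsum (fun x y => rho x y + rho' x y) s = netsum rho s + netsum rho' s.
Proof.
elim: s => /= [|x s ->]; first by rewrite addr0.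
by case: s => [|y s]; rewrite ?add0r ?addr0// addrACA.
Qed.

Lemma netsumZ T (rho : T -> T -> R) c s :
  netsum (fun x y => c * rho x y) s = c * netsum rho s.
Proof.
elim: s => /= [|x s ->]; first by rewrite mulr0.
by case: s => [|y s]; rewrite [RHS]mulrDr ?mulr0.
Qed.

Lemma netsum_map T T' (f : T' -> T) (rho : T -> T -> R) s :
  netsum rho (map f s) = netsum (fun x y => rho (f x) (f y)) s.
Proof. by elim: s => //= x s ->; case: s. Qed.

Lemma netsum_rcons2 T (rho : T -> T -> R) s x y :
  netsum rho (rcons (rcons s x) y) = netsum rho (rcons s x) + rho x y.
Proof.
elim: s => [|z s IH] /=; first by rewrite !(add0r, addr0).
by rewrite IH addrA; case: s {IH}.
Qed.

Lemma netsum_rev T (rho : T -> T -> R) s :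
  (forall x y, rho x y = rho y x) -> netsum rho (rev s) = netsum rho s.
Proof.
move=> rhoC; elim: s => // x [//|y s] IH.
rewrite rev_cons; move: IH; rewrite rev_cons => IH.
by rewrite netsum_rcons2 IH rhoC addrC.
Qed.

Lemma netsum_telescope (f : R -> R) x s :
  netsum (fun x y => f y - f x) (x :: s) = f (last x s) - f x.
Proof.
elim: s x => [|y s IH] x /=; first by rewrite addr0 subrr.
by rewrite -/(netsum _ (y :: s)) IH /= addrC subrKA.
Qed.

Lemma netsum_subseq (T : eqType) (rho : T -> T -> R) s t :
  (forall x y, 0 <= rho x y) -> (forall x y z, rho x z <= rho x y + rho y z) ->
  subseq s t -> netsum rho s <= netsum rho t.
Proof.
move=> rho0 rhoT.
have skip y w t' : netsum rho (y :: t') <= netsum rho (y :: w :: t').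
  rewrite /= addrA lerD2r; case: t' => [|z t'] //.
  by rewrite addr0.
have sub y s1 t1 : subseq s1 t1 -> netsum rho (y :: s1) <= netsum rho (y :: t1).
  elim: t1 y s1 => [|w t1 IH] y [|z s1] //.
    by move=> _; rewrite /= !add0r addr_ge0// -/(netsum rho (w :: t1)) netsum_ge0.
  rewrite [subseq _ _]/=; case: eqP => [<-|_] h.
    by rewrite [leLHS]/= [leRHS]/= lerD2l; exact: IH.
  exact: le_trans (IH y _ h) (skip _ _ _).
elim: t s => [|y t IH] [|x s] //.
  by move=> _; exact: netsum_ge0.
rewrite [subseq _ _]/=; case: eqP => [<-|_] h; first exact: sub.
apply: le_trans (IH _ h) _; rewrite /= lerDr.
by case: (t).
Qed.

(** The left end is excluded: functions are studied on half-open intervals, at the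
    left end of which only their limit is known. *)
Definition net (a b : R) (s : seq R) :=
  sorted <%R s && all (fun x => a < x <= b) s.

Lemma net_nil a b : net a b [::]. Proof. by []. Qed.

Lemma net1 a b x : a < x -> x <= b -> net a b [:: x].
Proof. by move=> ax xb; rewrite /net /= ax xb. Qed.

Lemma net2 a b x y : a < x -> x < y -> y <= b -> net a b [:: x; y].
Proof.
move=> ax xy yb; rewrite /net /= ax xy yb (lt_trans ax xy) /=.
by rewrite (ltW (lt_le_trans xy yb)).
Qed.

Lemma net_widen a b a' b' s : a' <= a -> b <= b' -> net a b s -> net a' b' s.
Proof.
move=> aa bb /andP[ss /allP h]; rewrite /net ss /=; apply/allP => x /h /andP[ax xb].
by rewrite (le_lt_trans aa ax) (le_trans xb bb).
Qed.

Lemma net_cat a c b s t : net a c s -> net c b t -> a <= c -> c <= b ->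
  net a b (s ++ t).
Proof.
move=> /andP[ss /allP sh] /andP[st /allP th] ac cb; rewrite /net; apply/andP; split.
  rewrite sorted_pairwise; last exact: lt_trans.
  rewrite pairwise_cat -!sorted_pairwise ?ss ?st ?andbT; try exact: lt_trans.
  by apply/allrelP => x y /sh /andP[_ xc] /th /andP[cy _]; exact: le_lt_trans xc cy.
rewrite all_cat; apply/andP; split; apply/allP => x.
  by move=> /sh /andP[-> xc]; exact: le_trans xc cb.
by move=> /th /andP[cx ->]; rewrite (le_lt_trans ac cx).
Qed.

Lemma net_mem a b s x : net a b s -> x \in s -> a < x <= b.
Proof. by move=> /andP[_ /allP h]; exact: h. Qed.

Lemma sorted_lt_subseq (s t : seq R) : sorted <%R s -> sorted <%R t ->
  {subset s <= t} -> subseq s t.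
Proof.
move=> ss st sub.
have -> : s = [seq x <- t | x \in s]; last exact: filter_subseq.
apply: (irr_sorted_eq lt_trans ltxx) => //.
  by rewrite sorted_filter//; exact: lt_trans.
by move=> x; rewrite mem_filter; apply/idP/andP => [xs|[]//]; split => //; exact: sub.
Qed.

Lemma net_merge a b s t : net a b s -> net a b t ->
  exists u, [/\ net a b u, subseq s u & subseq t u].
Proof.
move=> ns nt; have [/andP[ss hs] /andP[st ht]] := (ns, nt).
pose u := sort <=%R (undup (s ++ t)).
have su : sorted <%R u by rewrite sort_lt_sorted undup_uniq.
have memu x : (x \in u) = (x \in s) || (x \in t).
  by rewrite mem_sort mem_undup mem_cat.
exists u; split.
- rewrite /net su; apply/allP => x; rewrite memu => /orP[].
    exact: net_mem ns.
  exact: net_mem nt.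
- by apply: sorted_lt_subseq => // x xs; rewrite memu xs.
- by apply: sorted_lt_subseq => // x xs; rewrite memu xs orbT.
Qed.

(** Close to the left end the variation is small: by [netsum_cat] it can be added to
    that of an almost optimal net, which stays away from the end. The family rho is
    directed so that, for functions of two variables, the nets of the second
    variable can vary. *)
Lemma netsum_small (I : Type) (i0 : I) (rho : I -> R -> R -> R) (a b V : R) :
  a < b -> (forall i x y, 0 <= rho i x y) ->
  (forall i j, exists k, forall x y, rho i x y <= rho k x y /\ rho j x y <= rho k x y) ->
  (forall i s, net a b s -> netsum (rho i) s <= V) ->
  forall eps, 0 < eps -> exists sigma, [/\ a < sigma, sigma <= b &
    forall i s, net a sigma s -> netsum (rho i) s <= eps].
Proof.
move=> ab rho0 dir bd eps eps0.
pose E := [set r | exists i s, net a b s /\ r = netsum (rho i) s].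
have E0 : has_sup E.
  split; first by exists 0, i0, [::].
  by exists V => _ [i [s [ns ->]]]; exact: bd.
have [_ [i [s [ns ->]]] hs] := sup_adherent eps0 E0.
have ub j t : net a b t -> netsum (rho j) t <= sup E.
  by move=> nt; apply: (sup_upper_bound E0); exists j, t.
case: s ns hs => [|c s] ns hs.
  exists b; split => // j t nt.
  by have := ub j _ nt; move: hs; rewrite /=; lra.
have /andP[ac cb] := net_mem ns (mem_head c s).
(* any sigma in ]a, c[ would do, where c is the first point of the net s *)
exists ((a + c) / 2); split; [by lra|by lra|] => j t nt.
have [k hk] := dir i j.
have nts : net a b (t ++ c :: s).
  apply: (@net_cat a ((a + c) / 2)) => //; [|by lra|by lra].
  case/andP: (ns) => ss _; rewrite /net ss; apply/allP => x xs.
  have /andP[_ ->] := net_mem ns xs.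
  have : c <= x.
    move: xs; rewrite inE => /predU1P[->//|xs].
    by move: ss => /(order_path_min lt_trans)/allP/(_ _ xs)/ltW.
  by rewrite andbT; lra.
have h1 : netsum (rho j) t <= netsum (rho k) t.
  by apply: ler_netsum => x y _ _; have [] := hk x y.
have h2 : netsum (rho i) (c :: s) <= netsum (rho k) (c :: s).
  by apply: ler_netsum => x y _ _; have [] := hk x y.
have := netsum_cat t (c :: s) (rho0 k).
have := ub k _ nts; move: hs h1 h2.
set A := netsum (rho i) _; set B := netsum (rho k) (c :: s).
lra.
Qed.

End Nets.

(** * Functions of bounded variation at the corner of a rectangle *)

Section BV.
Context {R : realType}.
Implicit Types (F G : R -> R -> R) (phi psi c d : R -> R) (e V W C L s t x y : R).

(** For a net of ]0, e], a lower bound of the norm |phi(e)| + Var(phi; ]0, e]) of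
    the space of functions of bounded variation. *)
Definition nv e (t : seq R) phi :=
  `|phi e| + netsum (fun x y => `|phi y - phi x|) t.

Definition bv1 e phi V := forall t : seq R, net 0 e t -> nv e t phi <= V.

(** A function of two variables of bounded variation, seen as a function of
    the first variable which has bounded variation for the norm [nv] of its
    sections. *)
Definition bv2 e1 e2 F V := forall s t : seq R, net 0 e1 s -> net 0 e2 t ->
  nv e2 t (F e1) + netsum (fun x y => nv e2 t (F y \- F x)) s <= V.

Lemma nv_ge0 e (t : seq R) phi : 0 <= nv e t phi.
Proof. by rewrite addr_ge0// netsum_ge0. Qed.

Lemma nvD e (t : seq R) phi psi : nv e t (phi \+ psi) <= nv e t phi + nv e t psi.
Proof.
rewrite /nv addrACA lerD ?ler_normD// -netsumD; apply: ler_netsum => x y _ _ /=.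
by rewrite opprD addrACA ler_normD.
Qed.

Lemma nvZ e (t : seq R) (c : R) phi : nv e t (fun x => c * phi x) = `|c| * nv e t phi.
Proof.
rewrite /nv mulrDr normrM -netsumZ; congr (_ + _); apply: eq_netsum => x y.
by rewrite -mulrBr normrM.
Qed.

Lemma nv_subseq e (t u : seq R) phi : subseq t u -> nv e t phi <= nv e u phi.
Proof.
move=> tu; rewrite lerD2l netsum_subseq// => x y z.
by rewrite [X in _ <= X]addrC ler_distD.
Qed.

Lemma ler_nv_sup e (u : seq R) phi x : net 0 e u -> x \in u -> e \in u ->
  `|phi x| <= nv e u phi.
Proof.
move=> nu xu eu; have /andP[x0] := net_mem nu xu; rewrite le_eqVlt => /predU1P[->|xe].
  by rewrite lerDl netsum_ge0.
apply: (le_trans _ (nv_subseq e phi (_ : subseq [:: x; e] u))).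
  rewrite /nv /= !(add0r, addr0) -{1}(subrK (phi e) (phi x)) addrC.
  by rewrite (le_trans (ler_normD _ _))// lerD2l distrC.
apply: sorted_lt_subseq; first by rewrite /= xe.
  by case/andP: nu.
by move=> y; rewrite !inE => /orP[] /eqP->.
Qed.

Lemma bv1_sup e phi V x : bv1 e phi V -> 0 < x -> x <= e -> `|phi x| <= V.
Proof.
move=> h x0; rewrite le_eqVlt => /predU1P[->|xe].
  by apply: (le_trans _ (h [::] _)); rewrite // lerDl netsum_ge0.
have n2 : net 0 e [:: x; e] by apply: net2.
by apply: (le_trans _ (h _ n2)); apply: ler_nv_sup; rewrite ?inE ?eqxx ?orbT.
Qed.

Lemma bv1_ge0 e phi V : bv1 e phi V -> 0 <= V.
Proof. by move=> h; apply: (le_trans _ (h [::] _)) => //; exact: nv_ge0. Qed.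

Lemma bv2_ge0 e1 e2 F V : bv2 e1 e2 F V -> 0 <= V.
Proof.
move=> h; apply: (le_trans _ (h [::] [::] _ _)) => //.
by rewrite addr_ge0 ?nv_ge0.
Qed.

(** The net [:: s; e1] compares the section at s with the one at e1, which is
    controlled directly. *)
Lemma bv2_section e1 e2 F V s : bv2 e1 e2 F V -> 0 < s -> s <= e1 ->
  bv1 e2 (F s) V.
Proof.
move=> h s0; rewrite le_eqVlt => /predU1P[->|se] t nt.
  by have := h [::] t (net_nil _ _) nt; rewrite /= addr0; apply.
apply: (le_trans _ (h [:: s; e1] t _ nt)); last exact: net2.
rewrite /= !addr0 [in leLHS](_ : F s = F e1 \+ (fun x => -1 * (F e1 \- F s) x)).
  by rewrite (le_trans (nvD _ _ _ _))// nvZ normrN1 mul1r.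
by apply/funext => x /=; rewrite mulN1r opprB subrKC.
Qed.

Lemma bv1_small e phi V : 0 < e -> bv1 e phi V -> forall eps, 0 < eps ->
  exists sigma, [/\ 0 < sigma, sigma <= e & forall s : seq R, net 0 sigma s ->
    netsum (fun x y => `|phi y - phi x|) s <= eps].
Proof.
move=> e0 h eps eps0.
have [||| s [s0 se hs]] := @netsum_small R unit tt (fun _ x y => `|phi y - phi x|)
    0 e V e0 _ _ _ eps eps0.
- by [].
- by move=> _ _; exists tt.
- by move=> _ t nt; apply: (le_trans _ (h _ nt)); rewrite lerDr.
- by exists s; split => // t; exact: (hs tt).
Qed.

Lemma bv2_small e1 e2 F V : 0 < e1 -> bv2 e1 e2 F V -> forall eps, 0 < eps ->
  exists sigma, [/\ 0 < sigma, sigma <= e1 & forall s t : seq R, net 0 sigma s -> net 0 e2 t ->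
    netsum (fun x y => nv e2 t (F y \- F x)) s <= eps].
Proof.
move=> e0 h eps eps0.
have [|||s [s0 se hs]] := @netsum_small R {t | net 0 e2 t} (exist _ [::] isT)
    (fun w x y => nv e2 (sval w) (F y \- F x)) 0 e1 V e0 _ _ _ eps eps0.
- by move=> ? ? ?; exact: nv_ge0.
- move=> i j; have [u [nu iu ju]] := net_merge (svalP i) (svalP j).
  by exists (exist _ u nu) => x y /=; split; exact: nv_subseq.
- move=> [t nt] s ns /=; apply: (le_trans _ (h _ _ ns nt)).
  by rewrite lerDr nv_ge0.
- by exists s; split => // u t nu nt; exact: (hs (exist _ t nt)).
Qed.

(** The net [:: s; x] in the first variable, and one through t and e2 in the second:
    the norm [nv] of an increment bounds its values. *)
Lemma bv2_close e1 e2 F eps s x t : 0 < s -> s <= x -> 0 < t -> t <= e2 ->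
  (forall s t : seq R, net 0 x s -> net 0 e2 t ->
    netsum (fun x y => nv e2 t (F y \- F x)) s <= eps) ->
  `|F x t - F s t| <= eps.
Proof.
move=> s0 sx t0 te h; have eps0 : 0 <= eps by exact: (h [::] [::] isT isT).
move: sx; rewrite le_eqVlt => /predU1P[->|sx]; first by rewrite subrr normr0.
have ns : net 0 x [:: s; x] by exact: net2.
have [u [nu tu eu]] : exists u, [/\ net 0 e2 u, t \in u & e2 \in u].
  have [|u [nu tu eu]] := @net_merge R 0 e2 [:: t] [:: e2] (net1 t0 te).
    by rewrite net1 // (lt_le_trans t0).
  by exists u; split => //; rewrite -sub1seq.
apply: (le_trans _ (h _ _ ns nu)); rewrite /= !addr0.
exact: (ler_nv_sup (F x \- F s) nu tu eu).
Qed.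

Lemma bv1_close e phi eps x t :  0 < t -> t <= x ->
  (forall s : seq R, net 0 x s -> netsum (fun x y => `|phi y - phi x|) s <= eps) ->
  `|phi x - phi t| <= eps.
Proof.
move=> t0 tx h; have eps0 : 0 <= eps by exact: (h [::] isT).
move: tx; rewrite le_eqVlt => /predU1P[->|tx]; first by rewrite subrr normr0.
by have /h := net2 t0 tx (lexx x); rewrite /= !addr0.
Qed.

Lemma bv1_cvg e phi V : 0 < e -> bv1 e phi V -> cvg (phi @ 0^'+).
Proof.
move=> e0 h; apply/cauchy_cvgP; apply: cauchy_exP => eps eps0.
have [x [x0 xe hx]] := bv1_small e0 h (divr_gt0 eps0 (ltr0n _ 2)).
exists (phi x); rewrite /fmap /= /nbhs /=; near=> t.
rewrite /ball /=; apply: (@le_lt_trans _ _ (eps / 2)); last by lra.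
by apply: (@bv1_close e) hx; near: t; [exact: nbhs_right_gt|exact: nbhs_right_le].
Unshelve. all: by end_near. Qed.

(** Cauchy criterion: close to the axis s = 0 all sections are uniformly close to a
    fixed one, which has a limit by the one-dimensional case. *)
Lemma bv2_cvg e1 e2 F V : 0 < e1 -> 0 < e2 -> bv2 e1 e2 F V ->
  cvg ((fun p => F p.1 p.2) @ filter_prod 0^'+ 0^'+).
Proof.
move=> e10 e20 h; apply/cauchy_cvgP; apply: cauchy_exP => eps eps0.
have e4 : 0 < eps / 4 by rewrite divr_gt0.
have [x [x0 xe hx]] := bv2_small e10 h e4.
have [y [y0 ye hy]] := bv1_small e20 (bv2_section h x0 xe) e4.
exists (F x y); rewrite /fmap /= /nbhs /=.
near=> p; rewrite /ball /=.
have p1 : 0 < p.1 <= x.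
  near: p; apply: (@filter_prod1 _ _ (0^'+) (0^'+) _ (fun s => 0 < s <= x)).
  near=> s; apply/andP; split; near: s; [exact: nbhs_right_gt|exact: nbhs_right_le].
have p2 : 0 < p.2 <= y.
  near: p; apply: (@filter_prod2 _ _ (0^'+) (0^'+) _ (fun s => 0 < s <= y)).
  near=> s; apply/andP; split; near: s; [exact: nbhs_right_gt|exact: nbhs_right_le].
move: p1 p2 => /andP[p10 p1x] /andP[p20 p2y].
rewrite -(subrKA (F x p.2)) (le_lt_trans (ler_normD _ _))//.
have := bv2_close e1 p10 p1x p20 (le_trans p2y ye) hx.
have := bv1_close e2 p20 p2y hy.
by lra.
Unshelve. all: by end_near. Qed.

Lemma bv2D e1 e2 F G V W : bv2 e1 e2 F V -> bv2 e1 e2 G W ->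
  bv2 e1 e2 (fun s t => F s t + G s t) (V + W).
Proof.
move=> hF hG s t ns nt; apply: (le_trans _ (lerD (hF _ _ ns nt) (hG _ _ ns nt))).
rewrite addrACA lerD//; first exact: nvD.
rewrite -netsumD; apply: ler_netsum => x y _ _.
apply: (le_trans _ (nvD _ _ _ _)); rewrite le_eqVlt; apply/orP; left; apply/eqP.
by congr nv; apply/funext => z /=; rewrite opprD addrACA.
Qed.

Definition bv_mult e C c :=
  (forall x, 0 < x -> x <= e -> `|c x| <= C) /\
  (forall s : seq R, net 0 e s -> netsum (fun x y => `|c y - c x|) s <= C).

(** Leibniz rule: c(y) F(y) - c(x) F(x) = c(y) (F(y) - F(x)) + (c(y) - c(x)) F(x),
    in the norm [nv] of functions of the second variable. *)
Lemma bv2_mul1 e1 e2 F V c C : 0 < e1 -> bv2 e1 e2 F V -> bv_mult e1 C c ->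
  bv2 e1 e2 (fun s t => c s * F s t) (C * V + V * C).
Proof.
move=> e10 hF [hc vc] s t ns nt; have V0 := bv2_ge0 hF.
have C0 : 0 <= C by apply: (le_trans _ (hc e1 e10 (lexx _))).
apply: (@le_trans _ _ (C * (nv e2 t (F e1) + netsum (fun x y => nv e2 t (F y \- F x)) s)
   + V * netsum (fun x y => `|c y - c x|) s)); last first.
  by rewrite lerD// ler_wpM2l// ?hF// vc.
rewrite mulrDr -[X in _ <= X]addrA lerD//.
  rewrite [leLHS](nvZ e2 t (c e1) (F e1)) ler_wpM2r ?nv_ge0//; exact: hc.
rewrite -(netsumZ _ C) -(netsumZ _ V) -netsumD.
apply: ler_netsum => x y xs ys.
have /andP[x0 xe] := net_mem ns xs; have /andP[y0 ye] := net_mem ns ys.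
rewrite (_ : (_ \- _) = (fun t => c y * (F y \- F x) t) \+ (fun t => (c y - c x) * F x t)).
  rewrite (le_trans (nvD _ _ _ _))// !nvZ lerD//.
    by rewrite ler_wpM2r ?nv_ge0// hc.
  by rewrite mulrC ler_wpM2r// (bv2_section hF x0 xe).
by apply/funext => z /=; ring.
Qed.

(** Multiplication by d is bounded for the norm [nv]. The net is enlarged because the
    bound of the values of phi needs the point e. *)
Lemma nv_mul e C d (t : seq R) : 0 < e -> bv_mult e C d -> net 0 e t ->
  exists2 u, net 0 e u & forall phi, nv e t (fun x => d x * phi x) <= (C + C) * nv e u phi.
Proof.
move=> e0 [hd vd] nt.
have C0 : 0 <= C by apply: (le_trans _ (hd e e0 (lexx _))).
have [|u [nu tu eu]] := @net_merge R 0 e t [:: e] nt; first exact: net1.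
exists u => // phi; rewrite sub1seq in eu.
apply: le_trans (nv_subseq _ _ tu) _.
apply: (@le_trans _ _ (C * nv e u phi + nv e u phi * netsum (fun x y => `|d y - d x|) u)); last first.
  by rewrite [leRHS]mulrDl lerD2l [leLHS]mulrC ler_wpM2r ?nv_ge0// vd.
rewrite {1 2}/nv mulrDr -[X in _ <= X]addrA lerD//; first by rewrite normrM ler_wpM2r// hd.
rewrite -(netsumZ _ C) -(netsumZ _ (nv e u phi)) -netsumD.
apply: ler_netsum => x y xu yu.
have /andP[y0 ye] := net_mem nu yu.
rewrite (_ : _ - _ = d y * (phi y - phi x) + (d y - d x) * phi x); last by ring.
rewrite (le_trans (ler_normD _ _))// !normrM lerD//.
  by rewrite ler_wpM2r// hd.
by rewrite mulrC ler_wpM2r// ler_nv_sup.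
Qed.

Lemma bv2_mul2 e1 e2 F V d C : 0 < e2 -> bv2 e1 e2 F V -> bv_mult e2 C d ->
  bv2 e1 e2 (fun s t => d t * F s t) ((C + C) * V).
Proof.
move=> e20 hF hd s t ns nt.
have C0 : 0 <= C by case: hd => hd _; apply: (le_trans _ (hd e2 e20 (lexx _))).
have [u nu hu] := nv_mul e20 hd nt.
apply: (@le_trans _ _ ((C + C) * (nv e2 u (F e1) + netsum (fun x y => nv e2 u (F y \- F x)) s))); last first.
  by rewrite ler_wpM2l ?addr_ge0// hF.
rewrite mulrDr -(netsumZ _ (C + C)) lerD ?hu//; apply: ler_netsum => x y _ _.
apply: (le_trans _ (hu _)); rewrite le_eqVlt; apply/orP; left; apply/eqP.
by congr nv; apply/funext => z /=; rewrite mulrBr.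
Qed.

Lemma lipschitz_bv_mult e C L c : 0 < e -> 0 <= C -> 0 <= L ->
  (forall x, 0 < x -> x <= e -> `|c x| <= C) ->
  (forall x y, 0 < x -> x < y -> y <= e -> `|c y - c x| <= L * (y - x)) ->
  bv_mult e (C + L * e) c.
Proof.
move=> e0 C0 L0 hc hL; split=> [x x0 xe|s ns].
  by rewrite (le_trans (hc x x0 xe))// lerDl mulr_ge0// ltW.
apply: (@le_trans _ _ (L * e)); last by rewrite lerDr.
suff H : netsum (fun x y => `|c y - c x|) s <= L * netsum (fun x y => y - x) s.
  apply: le_trans H _; rewrite ler_wpM2l//; case: s ns => [|x s] ns.
    by rewrite /= ltW.
  rewrite (netsum_telescope id) /=.
  have /andP[x0 _] := net_mem ns (mem_head x s).
  have /andP[_ le] := net_mem ns (mem_last x s).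
  by lra.
elim: s ns => [|x [|y s] IH] ns; rewrite /= ?mulr0//.
  by rewrite !addr0 mulr0.
rewrite mulrDr lerD//.
  have /andP[x0 _] := net_mem ns (mem_head x _).
  have ys : y \in [:: x, y & s] by rewrite !inE eqxx orbT.
  have /andP[_ ye] := net_mem ns ys.
  by apply: hL => //; case/andP: ns => /= /andP[].
apply: IH; case/andP: ns => /= /andP[_ ss] /andP[_ aa].
by rewrite /net [sorted _ _]ss [all _ _]aa.
Qed.

End BV.

(** * Integrals of real functions *)

Section AeIntegral.
Context d (T : measurableType d) {R : realType}.
Variable mu : {measure set T -> \bar R}.
Local Open Scope ereal_scope.
Import HBNNSimple.

(** Integrals do not see null sets, even for functions which are not
    measurable: an integral of a nonnegative function is a supremum over simple
    functions, and these can be cut off on a null set. *)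
Lemma ae_ge0_le_integral (f g : T -> \bar R) :
  (forall x, 0 <= f x) -> (forall x, 0 <= g x) -> {ae mu, forall x, f x <= g x} ->
  \int[mu]_x f x <= \int[mu]_x g x.
Proof.
move=> f0 g0 [N [mN N0 fgN]].
have fg x : ~ N x -> f x <= g x.
  by move=> Nx; apply: contrapT => fgx; exact/Nx/fgN.
rewrite !ge0_integralTE//.
apply/ge_ereal_sup => /= _ [h hf <-].
pose k : {nnsfun T >-> R} := mul_nnsfun h (indic_nnsfun R (measurableC mN)).
apply: ereal_sup_ubound; exists k => /=.
  move=> x; rewrite /k /=; have [Nx|Nx] := pselect (N x).
    by rewrite mindicE memNset ?mulr0//; exact.
  by rewrite mindicE mem_set// mulr1 (le_trans (hf x))// fg.
rewrite -!integralT_nnsfun; apply: ae_eq_integral => //.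
- by apply/measurable_EFinP; exact: measurable_funP.
- by apply/measurable_EFinP; exact: measurable_funP.
exists N; split => // x; apply: contra_notP => Nx /= _.
by rewrite mindicE mem_set// mulr1.
Qed.

Lemma ae_integral_congr (D : set T) (f g : T -> \bar R) :
  f = g %[ae mu] -> \int[mu]_(x in D) f x = \int[mu]_(x in D) g x.
Proof.
move=> fg; have ge0 (f' g' : T -> \bar R) : (forall x, 0 <= f' x) -> (forall x, 0 <= g' x) ->
    {ae mu, forall x, f' x = g' x} -> \int[mu]_(x in D) f' x = \int[mu]_(x in D) g' x.
  move=> f0 g0 fg'; rewrite integral_mkcond [RHS]integral_mkcond.
  have p0 (h : T -> \bar R) : (forall x, 0 <= h x) -> forall x, 0 <= (h \_ D) x.
    by move=> h0 x; rewrite /patch; case: ifP.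
  by apply/eqP; rewrite eq_le; apply/andP; split; apply: ae_ge0_le_integral;
    try exact: p0; apply: filterS fg' => x e; rewrite /patch e.
by rewrite integralE [RHS]integralE; congr (_ - _); apply: ge0 => //;
  apply: filterS fg => x /(_ I) e; rewrite ?(funeposE, funenegE) e.
Qed.

Lemma ae_Rintegral_congr (D : set T) (f g : T -> R) :
  f = g %[ae mu] -> (\int[mu]_(x in D) f x = \int[mu]_(x in D) g x)%R.
Proof.
move=> fg; congr fine; apply: ae_integral_congr.
by apply: filterS fg => x /= h /h ->.
Qed.

End AeIntegral.

Section RealIntegral.
Context d (T : measurableType d) {R : realType}.
Variable mu : {measure set T -> \bar R}.
Implicit Types (D : set T) (f g h : T -> R).

Lemma integrable_bmul D f h (C : R) : measurable D -> measurable_fun D h ->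
  (forall x, D x -> `|h x| <= C) -> mu.-integrable D (EFin \o f) ->
  mu.-integrable D (EFin \o (fun x => h x * f x)).
Proof.
move=> mD mh hC intf.
have mf : measurable_fun D f by apply/measurable_EFinP; exact: measurable_int intf.
apply: (le_integrable mD (g := fun x => (C * f x)%:E)).
- by apply/measurable_EFinP; exact: measurable_funM.
- move=> x Dx /=; rewrite lee_fin !normrM ler_wpM2r//.
  by rewrite (le_trans (hC x Dx))// ler_norm.
- by under eq_fun do rewrite EFinM; exact: integrableZl.
Qed.

Lemma integrable_bmulr D f h (C : R) : measurable D -> measurable_fun D h ->
  (forall x, D x -> `|h x| <= C) -> mu.-integrable D (EFin \o f) ->
  mu.-integrable D (EFin \o (fun x => f x * h x)).
Proof.
move=> mD mh hC /(integrable_bmul mD mh hC).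
by apply: eq_integrable => // x _ /=; rewrite mulrC.
Qed.

Lemma le_integrableR D f g : measurable D -> measurable_fun D f ->
  (forall x, D x -> `|f x| <= g x) -> mu.-integrable D (EFin \o g) ->
  mu.-integrable D (EFin \o f).
Proof.
move=> mD mf fg; apply: le_integrable => //; first exact/measurable_EFinP.
by move=> x Dx /=; rewrite lee_fin (le_trans (fg x Dx))// ler_norm.
Qed.

Lemma integrableDR D f g : measurable D -> mu.-integrable D (EFin \o f) ->
  mu.-integrable D (EFin \o g) -> mu.-integrable D (EFin \o (fun x => f x + g x)).
Proof. by move=> mD h1 h2; have := integrableD mD h1 h2. Qed.

Lemma integrableBR D f g : measurable D -> mu.-integrable D (EFin \o f) ->
  mu.-integrable D (EFin \o g) -> mu.-integrable D (EFin \o (fun x => f x - g x)).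
Proof. by move=> mD h1 h2; have := integrableB mD h1 h2. Qed.

Lemma integrableZR D f (c : R) : measurable D -> mu.-integrable D (EFin \o f) ->
  mu.-integrable D (EFin \o (fun x => c * f x)).
Proof. by move=> mD h1; have := integrableZl mD c h1. Qed.

Lemma le_Rintegral_norm D f g : measurable D -> mu.-integrable D (EFin \o f) ->
  mu.-integrable D (EFin \o g) -> (forall x, D x -> `|f x| <= g x) ->
  `|\int[mu]_(x in D) f x| <= \int[mu]_(x in D) g x.
Proof.
move=> mD intf intg fg; apply: le_trans (le_normr_Rintegral mD intf) _.
by apply: le_Rintegral => //; exact: integrable_norm.
Qed.

Lemma integrable_patch D f : measurable D ->
  mu.-integrable D (EFin \o f) -> mu.-integrable setT (EFin \o (f \_ D)).
Proof. by move=> mD; rewrite integrable_mkcond// restrict_EFin. Qed.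

Lemma ae_eq_integrableE D (f : T -> \bar R) : measurable D ->
  mu.-integrable D f -> mu.-integrable D (EFin \o (fine \o f)).
Proof.
move=> mD intf; have mf := measurable_int _ intf.
have mff : measurable_fun D (EFin \o (fine \o f)).
  by apply/measurable_EFinP; apply: measurableT_comp.
move/integrableP : (intf) => [_ fi]; apply/integrableP; split => //.
rewrite (_ : (\int[mu]_(x in D) `|(EFin \o (fine \o f)) x| =
              \int[mu]_(x in D) `|f x|)%E)//.
apply: ae_eq_integral => //; try exact: measurableT_comp.
have := integrable_ae mD intf.
by apply: filterS => x h /h fx; congr abse; exact: fineK.
Qed.

End RealIntegral.

Section Fubini.
Context {R : realType}.
Implicit Types (f : R * R -> R) (D : set R).

Lemma Rfubini12 f : integrable2 f ->
  \int[leb2 R]_p f p = \int[leb]_s \int[leb]_t f (s, t).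
Proof.
move=> intf; rewrite /Rintegral -(integral12_prod_meas1 (m1 := leb) (m2 := leb) intf).
congr fine; apply: ae_integral_congr.
have := ae_integrable1 (m1 := leb) (m2 := leb) intf.
by apply: filterS => s hs _; rewrite /fubini_F fineK// integrable_fin_num.
Qed.

Lemma integrable_fubini1 f : integrable2 f ->
  integrable1 (fun s => \int[leb]_t f (s, t)).
Proof.
move=> intf; apply: ae_eq_integrableE => //.
exact: (integrable_fubini_F (m1 := leb) (m2 := leb) intf).
Qed.

Lemma Rfubini21 f : integrable2 f ->
  \int[leb2 R]_p f p = \int[leb]_t \int[leb]_s f (s, t).
Proof.
move=> intf; rewrite /Rintegral -(integral21_prod_meas1 (m1 := leb) (m2 := leb) intf).
congr fine; apply: ae_integral_congr.
have := ae_integrable2 (m1 := leb) (m2 := leb) intf.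
by apply: filterS => s hs _; rewrite /fubini_G fineK// integrable_fin_num.
Qed.

Lemma integrable_tonelli f (g : R -> R) :
  measurable_fun [set: T2 R] f ->
  integrable1 g ->
  (forall x, (\int[leb]_y (`|f (x, y)|)%:E <= (g x)%:E)%E) ->
  integrable2 f.
Proof.
move=> mf intg fg; apply/(integrable12ltyP leb leb); first exact/measurable_EFinP.
apply: (@le_lt_trans _ _ (\int[leb]_x (g x)%:E)%E); last first.
  by apply: le_lt_trans (integrable_lty measurableT intg).
apply: ge0_le_integral => //=.
- by move=> x _; exact: integral_ge0.
- apply: (measurable_fun_fubini_tonelli_F (m2 := leb) (fun p : R * R => (`|f p|)%:E)) => //=.
  by apply/measurable_EFinP; exact: measurableT_comp.
- exact: measurable_int intg.
Qed.

Lemma integrable_swap f : integrable2 f ->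
  integrable2 (fun p => f (p.2, p.1)).
Proof.
move=> intf.
have mf : measurable_fun [set: T2 R] (EFin \o f).
  exact: measurable_int intf.
have /(integrable21ltyP leb leb mf) fi := intf.
apply/(integrable12ltyP leb leb) => //.
have ms : measurable_fun [set: T2 R]
    (fun p => (p.2, p.1) : measurableTypeR R * measurableTypeR R).
  by apply/measurable_fun_pairP; split; [exact: measurable_snd|exact: measurable_fst].
exact: measurableT_comp mf ms.
Qed.

Lemma integrable_fubini2 f : integrable2 f ->
  integrable1 (fun t => \int[leb]_s f (s, t)).
Proof.
by move=> /integrable_swap /integrable_fubini1.
Qed.

End Fubini.

(** * Second mean value inequalities *)

Section BVIntegral.
Context {R : realType}.
Implicit Types (k phi psi : R -> R) (a b x y V W K : R).

Lemma Rintegral_itv_cst a b (c : R) : a <= b -> \int[leb]_(x in `[a, b[) c = c * (b - a).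
Proof.
move=> ab; rewrite Rintegral_cst//=; rewrite lebesgue_measure_itv /= lte_fin.
case: ltP => [//|ba]; rewrite (_ : b - a = 0) ?mulr0//.
by apply/eqP; rewrite subr_eq0 eq_le ab ba.
Qed.

(** Needed because the superlevel sets of a decreasing function may or may not
    contain their right end point. *)
Lemma initial_segment a b (S : set R) : a <= b -> S `<=` `]a, b] ->
  (forall x y, S y -> a < x -> x <= y -> S x) ->
  exists c, [/\ a <= c, c <= b & S = `]a, c]%classic \/ S = `]a, c[%classic].
Proof.
move=> ab Sab dn; have [S0|/set0P[s0 Ss0]] := eqVneq S set0.
  by exists a; split => //; right; rewrite set_itvoo0.
have Ss : has_sup S.
  by split; [exists s0|exists b => x /Sab/=; rewrite in_itv/= => /andP[]].
have h0 : a < s0 by have := Sab _ Ss0; rewrite /= in_itv/= => /andP[].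
have hs : s0 <= sup S by apply: sup_upper_bound.
exists (sup S); split.
- by rewrite (le_trans (ltW h0)).
- by apply: ge_sup; [exists s0|move=> x /Sab/=; rewrite in_itv/= => /andP[]].
have lt x : a < x -> x < sup S -> S x.
  move=> ax xs; have e0 : 0 < sup S - x by rewrite subr_gt0.
  have [y Sy xy] := sup_adherent e0 Ss.
  by apply: (dn x y) => //; rewrite ltW//; apply: (le_lt_trans _ xy); rewrite opprB subrKC.
have [Ssup|Ssup] := pselect (S (sup S)); [left|right].
  apply/seteqP; split => x /=; rewrite in_itv/=.
    move=> Sx; have := Sab _ Sx; rewrite /= in_itv/= => /andP[-> _].
    by rewrite sup_upper_bound.
  by move=> /andP[ax]; exact: dn.
apply/seteqP; split => x /=; rewrite in_itv/=.
  move=> Sx; have := Sab _ Sx; rewrite /= in_itv/= => /andP[-> _] /=.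
  rewrite lt_neqAle sup_upper_bound// andbT.
  by apply: contra_notN Ssup => /eqP <-.
by move=> /andP[]; exact: lt.
Qed.

(** Second mean value inequality for a decreasing weight, by the layer cake
    formula: the superlevel sets of the weight are initial segments. *)
Lemma nonincreasing_integral_bound a b k K psi W : a <= b ->
  leb.-integrable `]a, b] (EFin \o k) ->
  (forall x, a <= x -> x <= b -> `|\int[leb]_(y in `]a, x]) k y| <= K) ->
  nonincreasing_fun psi -> (forall x, 0 <= psi x) -> (forall x, psi x <= W) ->
  `|\int[leb]_(x in `]a, b]) (psi x * k x)| <= W * K.
Proof.
move=> ab intk hK dpsi psi0 psiW.
have W0 : 0 <= W by exact: le_trans (psi0 0) (psiW 0).
pose kD := k \_ `]a, b].
have intkD : integrable1 kD.
  exact: integrable_patch.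
have mkD : measurable_fun setT kD.
  by apply/measurable_EFinP; exact: measurable_int intkD.
have mpsi : measurable_fun setT psi by exact: nonincreasing_measurable.
(* psi x * k x is the integral of f (x, y) over y, and Fubini exchanges x and y *)
pose f (p : R * R) := if (0 <= p.2) && (p.2 < psi p.1) then kD p.1 else 0.
have mf : measurable_fun setT (f : measurableTypeR R * measurableTypeR R -> R).
  apply: measurable_fun_ifT => //=.
    apply: measurable_and.
      by apply: measurable_fun_ler => //; exact: measurable_snd.
    apply: measurable_fun_ltr; first exact: measurable_snd.
    by apply: measurableT_comp => //; exact: measurable_fst.
  by apply: measurableT_comp => //; exact: measurable_fst.
have fE x y : f (x, y) = ((fun=> kD x) \_ `[0, psi x[) y.
  by rewrite /f /patch mem_setE in_itv.
have Fx x : \int[leb]_y f (x, y) = psi x * kD x.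
  under eq_Rintegral do rewrite fE.
  by rewrite -Rintegral_mkcond Rintegral_itv_cst// subr0 mulrC.
have intf : integrable2 f.
  apply: (integrable_tonelli (g := fun x => W * `|kD x|)) => //.
    by apply: integrableZR => //; exact: integrable_norm.
  move=> x.
  rewrite (_ : (fun y => _) = (fun y => ((fun y => (`|kD x|)%:E) \_ `[0, psi x[) y)); last first.
    by apply/funext => y; rewrite fE /patch; case: ifP => // _; rewrite normr0.
  rewrite -integral_mkcond integral_cst//= muleC lebesgue_measure_itv/= lte_fin.
  case: ltP => [_|_]; last by rewrite mul0e lee_fin mulr_ge0.
  by rewrite -EFinB subr0 -EFinM lee_fin ler_wpM2r.
rewrite (_ : \int[leb]_(x in `]a, b]) (psi x * k x) = \int[leb]_x \int[leb]_y f (x, y)); last first.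
  rewrite Rintegral_mkcond; apply: eq_Rintegral => x _.
  by rewrite Fx /kD /patch; case: ifP; rewrite ?mulr0.
rewrite -Rfubini12// Rfubini21//.
have K0 : 0 <= K by exact: le_trans (normr_ge0 _) (hK a (lexx a) ab).
have inner y : `|\int[leb]_x f (x, y)| <= ((fun=> K) \_ `[0, W[) y.
  have [y0|y0] := ltP y 0.
    rewrite (_ : (fun x => f (x, y)) = cst 0); last first.
      by apply/funext => x; rewrite /f /= leNgt y0.
    rewrite Rintegral_cst// mul0r normr0 /patch; by case: ifP.
  have [Wy|yW] := leP W y.
    rewrite (_ : (fun x => f (x, y)) = cst 0); last first.
      by apply/funext => x; rewrite /f /= [y < _]ltNge (le_trans (psiW x))// andbF.
    rewrite Rintegral_cst// mul0r normr0 /patch; by case: ifP.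
  rewrite /patch mem_setE in_itv /= y0 yW.
  pose S := [set x | [/\ a < x, x <= b & y < psi x]].
  have [||c [ac cb Sc]] := @initial_segment a b S ab.
  - by move=> x [ax xb _]; rewrite /= in_itv /= ax.
  - move=> x z [az zb yz] ax xz; split => //; first exact: le_trans zb.
    by apply: lt_le_trans (dpsi _ _ xz).
  have fS x : f (x, y) = (k \_ S) x.
    rewrite /f /= y0 /= /kD /patch.
    have [Sx|Sx] := pselect (S x).
      by case: (Sx) => ax xb ->; rewrite !mem_set//= in_itv/= ax.
    rewrite [x \in S]memNset//; case: ifP => // yx; case: ifP => //.
    by rewrite mem_setE in_itv/= => /andP[ax xb]; exfalso; apply: Sx.
  under eq_Rintegral do rewrite fS.
  rewrite -Rintegral_mkcond; case: Sc => ->; first exact: hK.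
  rewrite Rintegral_itv_bndo_bndc; first exact: hK.
  apply: integrableS intk => //; apply: subset_itv; by rewrite bnd_simp.
apply: (@le_trans _ _ (\int[leb]_y (((fun=> K) \_ `[0, W[) y))).
  apply: le_Rintegral_norm => //; first exact: integrable_fubini2.
  apply: integrable_patch => //; apply: measurable_bounded_integrable => //.
    by rewrite /= lebesgue_measure_itv/=; case: ifP; rewrite ?ltry.
  by exists K; split; [exact: num_real|move=> M KM x _ /=; rewrite ger0_norm// ltW].
by rewrite -Rintegral_mkcond Rintegral_itv_cst// subr0 mulrC.
Qed.

(** The variation of phi on [x, b]: x itself is put in front of the nets of ]x, b]. *)
Let tailvar b phi x :=
  sup [set r | exists2 s, net x b s & r = netsum (fun x y => `|phi y - phi x|) (x :: s)].

(** Second mean value inequality for a function of bounded variation: by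
    Jordan's decomposition it is, up to a constant, a difference of two decreasing
    functions. *)
Lemma bv_integral_bound a b k K phi V : a < b ->
  leb.-integrable `]a, b] (EFin \o k) ->
  (forall x, a <= x -> x <= b -> `|\int[leb]_(y in `]a, x]) k y| <= K) ->
  (forall s : seq R, net a b s -> netsum (fun x y => `|phi y - phi x|) s <= V) ->
  [/\ measurable_fun `]a, b] phi,
     leb.-integrable `]a, b] (EFin \o (fun x => phi x * k x)) &
     `|\int[leb]_(x in `]a, b]) (phi x * k x)| <= (`|phi b| + 3 * V) * K].
Proof.
move=> ab intk hK hV.
pose v := tailvar b phi.
have V0 : 0 <= V by exact: (hV [::]).
have ncons x s : a < x -> x <= b -> net x b s -> net a b (x :: s).
  move=> ax xb ns; apply: (@net_cat _ a x b [:: x] s) => //; last exact: ltW.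
  by rewrite net1.
have vS x : a < x -> x <= b -> has_sup [set r | exists2 s, net x b s &
    r = netsum (fun x y => `|phi y - phi x|) (x :: s)].
  move=> ax xb; split; first by exists 0; exists [::]; rewrite //= addr0.
  by exists V => _ [s ns ->]; apply: hV; exact: ncons.
have v0 x : a < x -> x <= b -> 0 <= v x.
  move=> ax xb; apply: sup_upper_bound; first exact: vS.
  by exists [::]; rewrite //= addr0.
have vV x : a < x -> x <= b -> v x <= V.
  move=> ax xb; apply: ge_sup; first by case: (vS x ax xb).
  by move=> _ [s ns ->]; apply: hV; exact: ncons.
have vdec x y : a < x -> x <= y -> y <= b -> v y + `|phi y - phi x| <= v x.
  move=> ax; rewrite le_eqVlt => /predU1P[->|xy] yb; first by rewrite subrr normr0 addr0.
  rewrite -lerBrDr; apply: ge_sup; first by case: (vS y (lt_trans ax xy) yb).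
  move=> _ [s ns ->]; rewrite lerBrDr; apply: sup_upper_bound.
    by apply: vS => //; rewrite ltW// (lt_le_trans xy).
  exists (y :: s); last by rewrite /= addrC.
  apply: (@net_cat _ x y b [:: y] s) => //; last exact: ltW.
  by rewrite net1.
(* phi = phi b + p - q on ]a, b]; the values elsewhere keep p and q decreasing *)
pose p x := if x <= a then V else if x <= b then v x else 0.
pose q x := if x <= a then 2 * V else if x <= b then v x - (phi x - phi b) else 0.
have pd : nonincreasing_fun p.
  move=> x y xy; rewrite /p; case: (leP y a) => [ya|ay].
    by rewrite (le_trans xy ya).
  case: (leP y b) => yb; case: (leP x a) => [xa|ax].
  - exact: vV.
  - rewrite (le_trans xy yb); have := vdec x y ax xy yb.
    by have := normr_ge0 (phi y - phi x); lra.
  - by [].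
  - by case: ifP => // xb; exact: v0.
have phib x : a < x -> x <= b -> `|phi b - phi x| <= v x.
  by move=> ax xb; have := vdec x b ax xb (lexx b); have := v0 b ab (lexx b); lra.
have q0 x : a < x -> x <= b -> 0 <= v x - (phi x - phi b).
  by move=> ax xb; have := phib x ax xb; rewrite distrC ler_norml; lra.
have qV x : a < x -> x <= b -> v x - (phi x - phi b) <= 2 * V.
  by move=> ax xb; have := phib x ax xb; have := vV x ax xb; rewrite distrC ler_norml; lra.
have qd : nonincreasing_fun q.
  move=> x y xy; rewrite /q; case: (leP y a) => [ya|ay].
    by rewrite (le_trans xy ya).
  case: (leP y b) => yb; case: (leP x a) => [xa|ax].
  - exact: qV.
  - rewrite (le_trans xy yb); have := vdec x y ax xy yb.
    by have := ler_norm (phi x - phi y); rewrite distrC; lra.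
  - by rewrite mulr_ge0.
  - by case: ifP => // xb; exact: q0.
have p01 x : 0 <= p x <= V.
  rewrite /p; case: (leP x a) => ax; first by rewrite V0 lexx.
  by case: (leP x b) => xb; rewrite ?v0 ?vV// lexx V0.
have q01 x : 0 <= q x <= 2 * V.
  have V2 : 0 <= 2 * V by rewrite mulr_ge0.
  rewrite /q; case: (leP x a) => ax; first by rewrite V2 lexx.
  by case: (leP x b) => xb; rewrite ?q0 ?qV// lexx V2.
have phiE x : a < x -> x <= b -> phi x = phi b + p x - q x.
  by move=> ax xb; rewrite /p /q leNgt ax /= xb; ring.
have mp : measurable_fun `]a, b] p by exact: nonincreasing_measurable.
have mq : measurable_fun `]a, b] q by exact: nonincreasing_measurable.
have intp : leb.-integrable `]a, b] (EFin \o (fun x => p x * k x)).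
  apply: (integrable_bmul (C := V)) => // x _.
  by have /andP[? ?] := p01 x; rewrite ger0_norm.
have intq : leb.-integrable `]a, b] (EFin \o (fun x => q x * k x)).
  apply: (integrable_bmul (C := 2 * V)) => // x _.
  by have /andP[? ?] := q01 x; rewrite ger0_norm.
have intb : leb.-integrable `]a, b] (EFin \o (fun x => phi b * k x)).
  exact: integrableZR.
have E x : x \in `]a, b]%classic -> phi x * k x = phi b * k x + p x * k x - q x * k x.
  by rewrite mem_setE in_itv /= => /andP[ax xb]; rewrite {1}(phiE x ax xb); ring.
have intR : leb.-integrable `]a, b]
    (EFin \o (fun x => phi b * k x + p x * k x - q x * k x)).
  by apply: integrableBR => //; exact: integrableDR.
split.
- apply: (eq_measurable_fun (fun x => phi b + p x - q x)).
    by move=> x; rewrite mem_setE in_itv /= => /andP[ax xb]; rewrite -phiE.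
  by apply: measurable_funB => //; exact: measurable_funD.
- by apply: eq_integrable intR => // x /E /= ->.
have -> : \int[leb]_(x in `]a, b]) (phi x * k x) =
    \int[leb]_(x in `]a, b]) (phi b * k x + p x * k x - q x * k x).
  exact: eq_Rintegral.
rewrite RintegralB// ?RintegralD//; last exact: integrableDR.
rewrite RintegralZl//.
have hp := nonincreasing_integral_bound (ltW ab) intk hK pd
  (fun x => proj1 (andP (p01 x))) (fun x => proj2 (andP (p01 x))).
have hq := nonincreasing_integral_bound (ltW ab) intk hK qd
  (fun x => proj1 (andP (q01 x))) (fun x => proj2 (andP (q01 x))).
have hb : `|phi b * \int[leb]_(x in `]a, b]) k x| <= `|phi b| * K.
  by rewrite normrM ler_wpM2l// hK// ltW.
rewrite (le_trans (ler_normB _ _))//.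
rewrite (le_trans (lerD (ler_normD _ _) (lexx _)))//.
by move: hp hq hb; set P := `|_|; set Q := `|_|; set B := `|_ * _|; lra.
Qed.

End BVIntegral.

(** * The Riemann-Lebesgue lemma *)

Section DCT.
Context d (T : measurableType d) {R : realType}.
Variable mu : {measure set T -> \bar R}.

(** Dominated convergence along a real parameter, by testing on sequences. *)
Lemma dominated_cvg0_pinfty (f : R -> T -> R) (g : T -> R) :
  (forall M, mu.-integrable setT (EFin \o f M)) -> mu.-integrable setT (EFin \o g) ->
  {ae mu, forall x, forall M, `|f M x| <= g x} ->
  {ae mu, forall x, f M x @[M --> +oo] --> (0 : R)} ->
  \int[mu]_x f M x @[M --> +oo] --> (0 : R).
Proof.
move=> intf intg fg f0; apply/cvg_pinftyP => u uoo.
have [||||| _ _] := @dominated_convergence _ T R mu setT measurableT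
    (fun n x => (f (u n) x)%:E) (cst 0%E) (EFin \o g) _ _ _ _ _.
- by move=> n; exact: measurable_int (intf (u n)).
- exact: measurable_cst.
- apply: filterS f0 => x fx _.
  apply: cvg_EFin; first by apply: nearW.
  by move/cvg_pinftyP : fx; apply.
- exact: intg.
- by apply: filterS fg => x fgx n _; rewrite /= lee_fin.
rewrite integral0 => /fine_cvgP[_].
by apply: cvg_trans.
Qed.

End DCT.

Section RiemannLebesgue.
Context {R : realType}.
Implicit Types (k phi g : R -> R) (a b c M eps : R).

Lemma Rintegral_itv_cat a b c phi : a <= b -> b <= c ->
  leb.-integrable `]a, c] (EFin \o phi) ->
  \int[leb]_(x in `]a, c]) phi x =
  \int[leb]_(x in `]a, b]) phi x + \int[leb]_(x in `]b, c]) phi x.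
Proof.
move=> ab bc intphi; rewrite -(@Rintegral_itvB R phi (BRight a) (BRight c) b)// ?bnd_simp//.
by rewrite subrKC.
Qed.

Lemma sub_itv_integrable a b c d' phi : a <= c -> d' <= b ->
  leb.-integrable `]a, b] (EFin \o phi) -> leb.-integrable `]c, d'] (EFin \o phi).
Proof.
by move=> ac db; apply: integrableS => //; apply: subset_itv; rewrite bnd_simp.
Qed.

Lemma continuous_itv_integrable a b g : continuous g ->
  leb.-integrable `]a, b] (EFin \o g).
Proof.
move=> cg; have h : leb.-integrable `[a, b] (EFin \o g).
  apply: continuous_compact_integrable; first exact: segment_compact.
  exact: continuous_subspaceT.
by apply: integrableS h => //; apply: subset_itv; rewrite bnd_simp.
Qed.

Lemma continuous_sinM M : continuous (fun s : R => sin (M * s)).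
Proof.
by move=> x; apply: continuous_comp; [exact: mulrl_continuous|exact: continuous_sin].
Qed.

Lemma measurable_sinM D M : measurable D -> measurable_fun D (fun s : R => sin (M * s)).
Proof.
by move=> mD; apply: measurable_funTS; apply: continuous_measurable_fun; exact: continuous_sinM.
Qed.

Lemma norm_sin_le1 (x : R) : `|sin x| <= 1.
Proof. by rewrite ler_norml sin_geN1 sin_le1. Qed.

Lemma integrable_sinM phi M D : measurable D -> leb.-integrable D (EFin \o phi) ->
  leb.-integrable D (EFin \o (fun s => phi s * sin (M * s))).
Proof.
move=> mD h; under eq_fun do rewrite mulrC.
by apply: (integrable_bmul (C := 1)) => // [|x _]; [exact: measurable_sinM|exact: norm_sin_le1].
Qed.

Lemma Rintegral_FTC a b (f F : R -> R) : a <= b -> continuous f ->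
  (forall x : R, is_derive x (1 : R) F (f x)) -> \int[leb]_(x in `]a, b]) f x = F b - F a.
Proof.
rewrite le_eqVlt => /predU1P[->|ab] cf dF; first by rewrite set_itvoc0 Rintegral_set0 subrr.
rewrite Rintegral_itv_obnd_cbnd; last exact: continuous_itv_integrable.
have cF : continuous F.
  by move=> x; apply: differentiable_continuous; apply/derivable1_diffP; exact: ex_derive.
rewrite /Rintegral (@continuous_FTC2 _ _ F)//; first exact/continuous_subspaceT.
- by split; [move=> x _; exact: ex_derive|exact: (cvg_at_right_filter (cF a))|exact: (cvg_at_left_filter (cF b))].
- by move=> x _; rewrite derive1E; apply: derive_val.
Qed.

Lemma is_derive_mull M (x : R) : is_derive x (1 : R) ( *%R M) M.
Proof.
have : is_derive x (1 : R) (M *: (@id R)) (M *: 1) by exact: is_deriveZ.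
by rewrite [M *: 1]mulr1.
Qed.

Lemma integral_sinM a b M : 0 < M -> a <= b ->
  `|\int[leb]_(s in `]a, b]) sin (M * s)| <= 2 / M.
Proof.
move=> M0 ab; pose F : R -> R := (- M^-1) *: (cos \o ( *%R M)).
have dF (x : R) : is_derive x (1 : R) F (sin (M * x)).
  have dM := is_derive_mull M x.
  apply: is_derive_eq; rewrite /GRing.scale /=; field.
  by rewrite gt_eqF.
rewrite (Rintegral_FTC ab (@continuous_sinM M) dF).
rewrite /F /= -!/(GRing.scale _ _) /GRing.scale /=.
have -> : - M^-1 * cos (M * b) - - M^-1 * cos (M * a) = (cos (M * a) - cos (M * b)) / M.
  by ring.
rewrite normrM (ger0_norm (_ : 0 <= M^-1)) ?invr_ge0 ?(ltW M0)//.
rewrite ler_wpM2r ?invr_ge0 ?(ltW M0)//.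
have := cos_le1 (M * a); have := cos_geN1 (M * a).
have := cos_le1 (M * b); have := cos_geN1 (M * b).
by rewrite ler_norml; lra.
Qed.

(** On a short interval g is almost constant and [integral_sinM] applies. Uniform
    continuity is replaced by a supremum argument on the end point c of the intervals
    ]a, c] where the bound holds. *)
Lemma continuous_sinM_small a b g : a <= b -> continuous g -> forall eps, 0 < eps ->
  exists2 C, 0 <= C & forall M, 0 < M ->
    `|\int[leb]_(s in `]a, b]) (g s * sin (M * s))| <= eps * (b - a) + C / M.
Proof.
move=> ab cg eps eps0.
pose P c := exists2 C, 0 <= C & forall M, 0 < M ->
    `|\int[leb]_(s in `]a, c]) (g s * sin (M * s))| <= eps * (c - a) + C / M.
have intg c d' : leb.-integrable `]c, d'] (EFin \o g) by exact: continuous_itv_integrable.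
pose S := [set c | [/\ a <= c, c <= b & P c]].
have Sa : S a.
  split => //; exists 0 => // M M0.
  by rewrite set_itvoc0 Rintegral_set0 normr0 subrr mulr0 mul0r addr0.
have hS : has_sup S by split; [exists a|exists b => c []].
pose m := sup S.
have am : a <= m by exact: sup_upper_bound.
have mb : m <= b by apply: ge_sup; [exists a|move=> c []].
have /cvgrPdist_le/(_ _ eps0) /nbhs_ballP[del /= del0 hdel] := cg m.
have [c Sc mc] := sup_adherent del0 hS.
have cm : c <= m by exact: sup_upper_bound.
have [ac cb [C C0 hC]] := Sc.
pose e := Num.min b (m + del / 2).
have me : m <= e by rewrite /e le_min mb lerDl divr_ge0 ?ltW.
have eb : e <= b by rewrite /e ge_min lexx.
have Se : S e.
  split => //; first by rewrite (le_trans am).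
  exists (C + `|g m| * 2) => [|M M0]; first by rewrite addr_ge0// mulr_ge0.
  rewrite (@Rintegral_itv_cat a c e)//; [|exact: le_trans cm me|exact: integrable_sinM].
  rewrite (le_trans (ler_normD _ _))//.
  have -> : eps * (e - a) + (C + `|g m| * 2) / M =
      (eps * (c - a) + C / M) + (eps * (e - c) + `|g m| * (2 / M)) by ring.
  rewrite lerD ?hC//.
  have -> : \int[leb]_(s in `]c, e]) (g s * sin (M * s)) =
    \int[leb]_(s in `]c, e]) ((g s - g m) * sin (M * s) + g m * sin (M * s)).
    by apply: eq_Rintegral => s _; ring.
  have isin : leb.-integrable `]c, e] (EFin \o (fun s => sin (M * s))).
    exact/continuous_itv_integrable/continuous_sinM.
  have icst : leb.-integrable `]c, e] (EFin \o (fun s => g s - g m)).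
    by apply/continuous_itv_integrable => x; apply: cvgB; [exact: cg|exact: cvg_cst].
  rewrite RintegralD//; [|exact: integrable_sinM|exact: integrableZR].
  rewrite (le_trans (ler_normD _ _))// lerD//; last first.
    rewrite RintegralZl// normrM ler_wpM2l// integral_sinM//.
    exact: le_trans cm me.
  apply: (@le_trans _ _ (\int[leb]_(s in `]c, e]) eps)); last first.
    rewrite Rintegral_cst//= lebesgue_measure_itv/= lte_fin.
    by case: ltP => [_|ec]//=; rewrite mulr0 mulr_ge0 ?subr_ge0 ?(ltW eps0) ?(le_trans cm).
  apply: le_Rintegral_norm => //; first exact: integrable_sinM.
    by apply/continuous_itv_integrable => x; exact: cvg_cst.
  move=> s; rewrite /= in_itv/= => /andP[cs se].
  rewrite normrM -[leRHS]mulr1 ler_pM ?norm_sin_le1// distrC hdel//.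
  rewrite /ball /= ltr_norml; move: mc se; rewrite /e le_min -/m => mc /andP[_].
  by move: del0; lra.
have : e <= m by exact: sup_upper_bound.
rewrite /e ge_min => /orP[bm|]; last by move: del0; lra.
have [_ _ Pb] := Se; have -> : b = e by apply/eqP; rewrite eq_le eb (le_trans bm).
exact: Pb.
Qed.

(** Truncation to a bounded interval, then approximation in mean by a continuous
    function. *)
Lemma riemann_lebesgue phi : integrable1 phi ->
  \int[leb]_s (phi s * sin (M * s)) @[M --> +oo] --> (0 : R).
Proof.
have aux1 (e x y : R) : y <= e / 4 -> x <= e / 4 -> y + x <= e / 2 by lra.
have aux2 (e x y z : R) : x <= e / 4 -> y <= e / 4 -> z <= e / 2 -> x + (y + z) <= e.
  by lra.
move=> intphi; apply/cvgrPdist_le => /= eps eps0; have e4 : 0 < eps / 4 by rewrite divr_gt0.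
pose E n : set R := `](- n%:R), n%:R]%classic.
have mphi : measurable_fun setT phi by apply/measurable_EFinP; exact: measurable_int intphi.
have mE n : measurable (E n : set (measurableTypeR R)) by rewrite /E.
have iE n : leb.-integrable (E n) (EFin \o phi).
  by rewrite /E; apply: integrableS intphi.
have iEp n : integrable1 (phi \_ (E n)).
  by apply: integrable_patch; [rewrite /E|exact: iE].
have [||||| _ tail _] := @dominated_convergence _ _ R leb setT measurableT
    (fun n x => ((phi \_ (E n)) x)%:E) (EFin \o phi) (EFin \o (fun x => `|phi x|)) _ _ _ _ _.
- by move=> n; exact: measurable_int (iEp n).
- exact: measurable_int intphi.
- apply: aeW => x _; apply: cvg_near_cst; near=> n.
  rewrite /patch mem_set// /E /= in_itv /=.
  have xn : `|x| < n%:R by near: n; exact: nbhs_infty_gtr.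
  by move: xn; rewrite ltr_norml => /andP[-> /ltW].
- exact: integrable_norm.
- apply: aeW => x n _ /=; rewrite lee_fin /patch; case: ifP => // _.
  by rewrite normr0.
have [n hn] : exists n, \int[leb]_s `|(phi \_ (E n)) s - phi s| <= eps / 4.
  move/fine_cvgP : tail => [_] /cvgrPdist_le /(_ _ e4) [n _ /(_ n (leqnn n))].
  rewrite sub0r normrN ger0_norm; first by move=> h; exists n.
  by rewrite fine_ge0// integral_ge0.
have En : (leb (E n) < +oo)%E.
  by rewrite /E lebesgue_measure_itv/=; case: ifP; rewrite ?ltry.
have [g [cg ig gphi]] := approximation_continuous_integrable (measurable_itv _) En (iE n).
have [j hj] : exists j, \int[leb]_(s in E n) `|phi s - g j s| <= eps / 4.
  move/fine_cvgP : gphi => [_] /cvgrPdist_le /(_ _ e4) [j _ /(_ j (leqnn j))].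
  rewrite sub0r normrN ger0_norm; first by move=> h; exists j.
  by rewrite fine_ge0// integral_ge0.
have nn : - n%:R <= n%:R :> R by rewrite (le_trans _ (ler0n _ n))// lerNl oppr0.
have e5 : 0 < eps / 4 / (n%:R - - n%:R + 1).
  by rewrite divr_gt0// ltr_pwDr// subr_ge0.
have [C C0 hC] := continuous_sinM_small nn (cg j) e5.
near=> M.
have M0 : 0 < M by near: M; exact: nbhs_pinfty_gt.
have MC : C / (eps / 4) <= M by near: M; apply: nbhs_pinfty_ge; exact: num_real.
rewrite sub0r normrN.
have iE' f : leb.-integrable (E n) (EFin \o f) -> 
  leb.-integrable (E n) (EFin \o (fun s => f s * sin (M * s))).
  by move=> h; exact: (integrable_sinM M (mE n) h).
have -> : \int[leb]_s (phi s * sin (M * s)) =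
   \int[leb]_s ((phi s - (phi \_ (E n)) s) * sin (M * s)) +
   \int[leb]_s ((phi \_ (E n)) s * sin (M * s)).
  rewrite -RintegralD//; first by apply: eq_Rintegral => s _; rewrite -mulrDl subrK.
    by apply: integrable_sinM => //; exact: integrableBR.
  exact: integrable_sinM.
have -> : \int[leb]_s ((phi \_ (E n)) s * sin (M * s)) =
   \int[leb]_(s in E n) ((phi s - g j s) * sin (M * s)) +
   \int[leb]_(s in E n) (g j s * sin (M * s)).
  rewrite -RintegralD//.
  - rewrite [RHS]Rintegral_mkcond; apply: eq_Rintegral => s _.
    by rewrite /patch; case: ifP => _; rewrite ?mul0r// -mulrDl subrK.
  - by apply: iE'; exact: integrableBR.
  - exact: iE'.
have h1 : `|\int[leb]_s ((phi s - (phi \_ (E n)) s) * sin (M * s))| <= eps / 4.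
  apply: le_trans hn; apply: le_Rintegral_norm => //.
  - by apply: integrable_sinM => //; exact: integrableBR.
  - by apply: integrable_norm; exact: integrableBR.
  - move=> s _; rewrite normrM -[leRHS]mulr1 ler_pM ?norm_sin_le1//.
    by rewrite distrC.
have h2 : `|\int[leb]_(s in E n) ((phi s - g j s) * sin (M * s))| <= eps / 4.
  apply: le_trans hj; apply: le_Rintegral_norm => //.
  - by apply: iE'; exact: integrableBR.
  - by apply: integrable_norm; exact: integrableBR.
  - by move=> s _; rewrite normrM -[leRHS]mulr1 ler_pM ?norm_sin_le1.
have h3 : `|\int[leb]_(s in E n) (g j s * sin (M * s))| <= eps / 2.
  apply: (le_trans (hC M M0)).
  have : C / M <= eps / 4.
    by rewrite ler_pdivrMr// mulrC -ler_pdivrMr.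
  have : eps / 4 / (n%:R - - n%:R + 1) * (n%:R - - n%:R) <= eps / 4.
    have L0 : 0 <= n%:R - - n%:R :> R by rewrite subr_ge0.
    rewrite -[_ / _ * _]mulrA ler_piMr ?(ltW e4)// mulrC ler_pdivrMr ?mul1r ?lerDl//.
  exact: aux1.
rewrite (le_trans (ler_normD _ _))// (le_trans (lerD (lexx _) (ler_normD _ _)))//.
exact: aux2.
Unshelve. all: by end_near. Qed.

End RiemannLebesgue.

Section RiemannLebesgue2.
Context {R : realType}.
Implicit Types (F : R * R -> R) (c w : R -> R) (M eps : R).

Lemma measurable_fun_fst c : measurable_fun setT c ->
  measurable_fun [set: T2 R] (fun p => c p.1).
Proof. by move=> mc; apply: measurableT_comp => //; exact: measurable_fst. Qed.

Lemma measurable_fun_snd c : measurable_fun setT c ->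
  measurable_fun [set: T2 R] (fun p => c p.2).
Proof. by move=> mc; apply: measurableT_comp => //; exact: measurable_snd. Qed.

Lemma integrable2_sinM F M : integrable2 F ->
  integrable2 (fun p => F p * sin (M * p.1)).
Proof.
move=> h; under eq_fun do rewrite mulrC.
apply: (integrable_bmul (C := 1)) => // [|x _]; last exact: norm_sin_le1.
by apply: (measurable_fun_fst (c := fun s => sin (M * s))); exact: measurable_sinM.
Qed.

Lemma riemann_lebesgue2 F : integrable2 F ->
  \int[leb]_t `|\int[leb]_s (F (s, t) * sin (M * s))| @[M --> +oo] --> (0 : R).
Proof.
move=> intF.
have aeF := ae_integrable2 (m1 := leb) (m2 := leb) intF.
apply: (@dominated_cvg0_pinfty _ _ _ leb (fun M t => `|\int[leb]_s (F (s, t) * sin (M * s))|)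
  (fun t => \int[leb]_s `|F (s, t)|)).
- move=> M; apply: integrable_norm => //.
  exact: (integrable_fubini2 (integrable2_sinM M intF)).
- by apply: (integrable_fubini2 (f := fun p => `|F p|)); exact: integrable_norm.
- apply: filterS aeF => t it M; rewrite normr_id.
  apply: le_Rintegral_norm => //; first exact: integrable_sinM.
    exact: integrable_norm.
  by move=> s _; rewrite normrM -[leRHS]mulr1 ler_pM ?norm_sin_le1.
- by apply: filterS aeF => t it; apply/norm_cvg0P; exact: riemann_lebesgue.
Qed.

(** The uniformity in w, a bounded factor which depends on the second variable only,
    is what allows both frequencies to tend to infinity independently. *)
Lemma riemann_lebesgue2_unif F : integrable2 F ->
  forall eps, 0 < eps -> exists M0, forall M, M0 < M -> forall w,
    measurable_fun setT w -> (forall t, `|w t| <= 1) ->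
    `|\int[leb2 R]_p (F p * sin (M * p.1) * w p.2)| <= eps.
Proof.
move=> intF eps eps0.
have /cvgrPdist_le/(_ _ eps0)[M0 [_ hM0]] := riemann_lebesgue2 intF.
exists M0 => M MM w mw w1.
have h := hM0 M MM; rewrite sub0r normrN ger0_norm in h; last by apply: Rintegral_ge0.
apply: le_trans h.
have i1 := integrable2_sinM M intF.
have i2 : integrable2 (fun p => F p * sin (M * p.1) * w p.2).
  under eq_fun do rewrite mulrC.
  by apply: (integrable_bmul (C := 1)) => //; exact: measurable_fun_snd.
rewrite Rfubini21//.
have -> : \int[leb]_t \int[leb]_s (F (s, t) * sin (M * s) * w t) =
    \int[leb]_t (w t * \int[leb]_s (F (s, t) * sin (M * s))).
  apply: ae_Rintegral_congr.
  have := ae_integrable2 (m1 := leb) (m2 := leb) i1.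
  by apply: filterS => t it _; rewrite mulrC -RintegralZr.
have i3 := integrable_fubini2 i1.
apply: le_Rintegral_norm => //.
- by apply: (integrable_bmul (C := 1)).
- exact: integrable_norm.
by move=> t _; rewrite normrM ler_piMl.
Qed.

End RiemannLebesgue2.

(** * The Dirichlet kernel and the Dirichlet integral *)

Section RectangleFubini.
Context {R : realType}.
Implicit Types (F : R * R -> R) (A B : set (measurableTypeR R)) (u w : R -> R).

Lemma Rintegral_indic d (T : measurableType d) (mu : {measure set T -> \bar R})
    (A : set T) (f : T -> R) :
  \int[mu]_x (\1_A x * f x) = \int[mu]_(x in A) f x.
Proof.
rewrite [RHS]Rintegral_mkcond; apply: eq_Rintegral => x _.
by rewrite /patch indicE; case: ifP; rewrite ?mul1r ?mul0r.
Qed.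

Lemma integrable_indicM d (T : measurableType d) (mu : {measure set T -> \bar R})
    (A : set T) (f : T -> R) : measurable A ->
  mu.-integrable A (EFin \o f) -> mu.-integrable setT (EFin \o (fun x => \1_A x * f x)).
Proof.
move=> mA /(integrable_patch mA); apply: eq_integrable => // x _ /=.
by rewrite /patch indicE; case: ifP; rewrite ?mul1r ?mul0r.
Qed.

Lemma Rfubini_rect12 A B F : integrable2 (fun p => \1_A p.1 * \1_B p.2 * F p) ->
  \int[leb2 R]_p (\1_A p.1 * \1_B p.2 * F p) =
  \int[leb]_(s in A) \int[leb]_(t in B) F (s, t).
Proof.
move=> h; rewrite Rfubini12// -[RHS]Rintegral_indic; apply: eq_Rintegral => s _.
rewrite -[in RHS]Rintegral_indic /=.
have [sA|sA] := boolP (s \in A); last first.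
  rewrite indicE (negbTE sA) mul0r; under eq_Rintegral do rewrite 2!mul0r.
  by rewrite Rintegral_cst// mul0r.
by rewrite indicE sA mul1r; under eq_Rintegral do rewrite mul1r.
Qed.

Lemma Rfubini_rect21 A B F : integrable2 (fun p => \1_A p.1 * \1_B p.2 * F p) ->
  \int[leb2 R]_p (\1_A p.1 * \1_B p.2 * F p) =
  \int[leb]_(t in B) \int[leb]_(s in A) F (s, t).
Proof.
move=> h; rewrite Rfubini21// -[RHS]Rintegral_indic; apply: eq_Rintegral => t _.
rewrite -[in RHS]Rintegral_indic /=.
have [tB|tB] := boolP (t \in B); last first.
  rewrite [in RHS]indicE (negbTE tB) mul0r.
  under eq_Rintegral do rewrite [\1_B t]indicE (negbTE tB) mulr0 mul0r.
  by rewrite Rintegral_cst// mul0r.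
rewrite [in RHS]indicE tB mul1r.
by under eq_Rintegral do rewrite [\1_B t]indicE tB mulr1.
Qed.

Lemma integrable_prodM u w F C :
  integrable1 u -> integrable1 w ->
  measurable_fun [set: T2 R] F -> (forall p, `|F p| <= C) ->
  integrable2 (fun p => u p.1 * w p.2 * F p).
Proof.
move=> iu iw mF hF.
have mu : measurable_fun setT u by apply/measurable_EFinP; exact: measurable_int iu.
have mw : measurable_fun setT w by apply/measurable_EFinP; exact: measurable_int iw.
have iw' := integrable_norm iw.
apply: (integrable_tonelli (g := fun x => `|u x| * (C * \int[leb]_y `|w y|))).
- apply: measurable_funM => //; apply: measurable_funM.
    exact: measurable_fun_fst.
  exact: measurable_fun_snd.
- under eq_fun do rewrite mulrC.
  by apply: integrableZR => //; exact: integrable_norm.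
move=> x; apply: (@le_trans _ _ (\int[leb]_y ((`|u x| * C) * `|w y|)%:E)%E); last first.
  have := RintegralZl (`|u x| * C) measurableT iw'.
  rewrite -mulrA => <-; rewrite fineK//.
  by apply: integrable_fin_num => //; exact: integrableZR.
apply: ge0_le_integral => //=.
- apply/measurable_EFinP; apply: measurableT_comp => //.
  apply: measurable_funM; first by apply: measurable_funM.
  exact: (measurable_fun_pair2 x mF).
- by apply/measurable_EFinP; apply: measurable_funM => //; exact: measurableT_comp.
move=> y _; rewrite lee_fin !normrM -mulrA -[leRHS]mulrA ler_wpM2l//.
by rewrite mulrC ler_wpM2r.
Qed.

Lemma integrable_itv_indicM (i : interval R) (f : R -> R) :
  leb.-integrable [set` i] (EFin \o f) ->
  integrable1 (fun x => \1_[set` i] x * f x).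
Proof. exact: integrable_indicM. Qed.

Lemma integrable_indic_itv' (a b : R) :
  integrable1 (\1_(`]a, b]%classic) : R -> R).
Proof. exact: (integrable_indic_itv a b false false). Qed.

End RectangleFubini.

Section DirichletKernel.
Context {R : realType}.
Implicit Types (a b c s t x y M T sigma : R).

(** Without the usual factor 1 / pi; the value at 0 is 0, on a null set. *)
Definition dirk M s := sin (M * s) / s.

Lemma measurable_invR : measurable_fun setT (fun x : R => x^-1).
Proof.
rewrite (_ : setT = [set 0 : R] `|` ~` [set 0]); last by rewrite setUv.
apply/measurable_funU => //; first exact: measurableC.
split; first exact: measurable_fun_set1.
apply: open_continuous_measurable_fun.
  by rewrite openC; apply: accessible_closed_set1; apply: hausdorff_accessible; exact: Rhausdorff.
by move=> x /[!inE] /= /eqP x0; exact: inv_continuous.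
Qed.

Lemma measurable_dirk M D : measurable D -> measurable_fun D (dirk M).
Proof.
move=> mD; apply: measurable_funTS; apply: measurable_funM; last exact: measurable_invR.
exact: measurable_sinM.
Qed.

Lemma norm_sin_le (x : R) : `|sin x| <= `|x|.
Proof.
wlog x0 : x / 0 <= x.
  move=> h; have [|x0] := leP 0 x; first exact: h.
  by rewrite -normrN -sinN -[leRHS]normrN; apply: h; rewrite oppr_ge0 ltW.
have dS (y : R) : is_derive y (1 : R) (@sin R) (cos y) by exact: is_derive_sin.
have -> : sin x = \int[leb]_(y in `]0, x]) cos y.
  by rewrite (Rintegral_FTC x0 (@continuous_cos R) dS) sin0 subr0.
rewrite (ger0_norm x0).
apply: (@le_trans _ _ (\int[leb]_(y in `]0, x]) 1)).
  apply: le_Rintegral_norm => //.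
  - exact/continuous_itv_integrable/continuous_cos.
  - by apply/continuous_itv_integrable => y; exact: cvg_cst.
  - by move=> y _; rewrite ler_norml cos_geN1 cos_le1.
rewrite Rintegral_cst//= lebesgue_measure_itv/= lte_fin.
by case: ltP => [_|_]; rewrite ?mul1r ?mulr0//= subr0.
Qed.

Lemma norm_dirk M s : 0 <= M -> `|dirk M s| <= M.
Proof.
move=> M0; have [->|s0] := eqVneq s 0; first by rewrite /dirk invr0 mulr0 normr0.
rewrite /dirk normrM normfV ler_pdivrMr ?normr_gt0//.
by apply: le_trans (norm_sin_le _) _; rewrite normrM ger0_norm.
Qed.

Lemma integrable_dirk M a b : 0 <= M -> leb.-integrable `]a, b] (EFin \o dirk M).
Proof.
move=> M0; apply: measurable_bounded_integrable => //.
- by rewrite /= lebesgue_measure_itv/=; case: ifP; rewrite ?ltry.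
- exact: measurable_dirk.
- exists M; split; first exact: num_real.
  by move=> x Mx y _ /=; rewrite (le_trans (norm_dirk _ M0))// ltW.
Qed.

(** Second mean value inequality for sin (M s) with the decreasing weight 1 / s, made
    constant on ]-oo, sigma] to be decreasing everywhere. *)
Lemma dirk_tail M sigma x : 0 < M -> 0 < sigma -> sigma <= x ->
  `|\int[leb]_(s in `]sigma, x]) dirk M s| <= 2 / (sigma * M).
Proof.
move=> M0 s0 sx; pose psi (s : R) := (Num.max s sigma)^-1.
have mx (s : R) : 0 < Num.max s sigma by rewrite lt_max s0 orbT.
have -> : \int[leb]_(s in `]sigma, x]) dirk M s =
    \int[leb]_(s in `]sigma, x]) (psi s * sin (M * s)).
  apply: eq_Rintegral => s; rewrite mem_setE in_itv/= => /andP[ss _].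
  by rewrite /dirk /psi max_l ?(ltW ss)// mulrC.
rewrite invfM mulrCA.
apply: (nonincreasing_integral_bound (k := fun s => sin (M * s)) sx).
- exact/continuous_itv_integrable/continuous_sinM.
- by move=> y sy _; exact: integral_sinM.
- move=> y z yz; rewrite /psi lef_pV2 ?posrE// ge_max.
  by rewrite le_max yz /= le_max lexx orbT.
- by move=> y; rewrite /psi invr_ge0 ltW.
- by move=> y; rewrite /psi lef_pV2 ?posrE// le_max lexx orbT.
Qed.

(** The kernel is at most M on ]0, 1 / M], which contributes 1; the rest is at most 2
    by [dirk_tail]. *)
Lemma dirk_bound M x : 0 < M -> 0 <= x -> `|\int[leb]_(s in `]0, x]) dirk M s| <= 3.
Proof.
move=> M0 x0.
have near0 y : 0 <= y -> y <= M^-1 -> `|\int[leb]_(s in `]0, y]) dirk M s| <= 1.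
  move=> y0 yM; apply: (@le_trans _ _ (\int[leb]_(s in `]0, y]) M)).
    apply: le_Rintegral_norm => //; first exact/integrable_dirk/ltW.
      by apply/continuous_itv_integrable => z; exact: cvg_cst.
    by move=> s _; exact/norm_dirk/ltW.
  rewrite Rintegral_cst//= lebesgue_measure_itv/= lte_fin.
  case: ltP => [_|_]; rewrite ?mulr0//= subr0.
  by rewrite mulrC -ler_pdivlMr// mul1r.
have [xM|Mx] := leP x M^-1; first by apply: le_trans (near0 _ x0 xM) _; lra.
have M1 : 0 < M^-1 by rewrite invr_gt0.
rewrite (@Rintegral_itv_cat _ 0 M^-1 x) ?(ltW Mx) ?(ltW M1)//; last exact/integrable_dirk/ltW.
rewrite (le_trans (ler_normD _ _))//.
have := near0 _ (ltW M1) (lexx _); have := dirk_tail M0 M1 (ltW Mx).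
by rewrite mulVf ?gt_eqF// divr1; lra.
Qed.

End DirichletKernel.

Section DirichletIntegral.
Context {R : realType}.
Implicit Types (a b c s t x y M T m sigma : R).

Lemma ler0_archi x c : (forall n, x <= c / n.+1%:R) -> x <= 0.
Proof.
move=> h; rewrite leNgt; apply/negP => x0.
have := h (Num.truncn (c / x)); rewrite ler_pdivlMr// mulrC -ler_pdivlMr//.
by apply/negP; rewrite -ltNge; exact: truncnS_gt.
Qed.

Local Notation P := (`]0%R, +oo[%classic : set R).

Let integrable_expN : leb.-integrable P (EFin \o (fun s => expR (- s))).
Proof.
have h := integrable_exponential_pdf (@ltr01 R).
have : leb.-integrable P (EFin \o exponential_pdf 1) by apply: integrableS h.
apply: eq_integrable => // s; rewrite mem_setE in_itv/= andbT => s0.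
by rewrite exponential_pdfE ?(ltW s0)// mul1r mulN1r.
Qed.

Let continuous_expN : continuous (fun s : R => expR (- s)).
Proof.
by move=> s; apply: continuous_comp; [exact: opp_continuous|exact: continuous_expR].
Qed.

Let is_derive_expN s : is_derive s (1 : R) (fun s => expR (- s)) (- expR (- s)).
Proof.
have : is_derive s (1 : R) (expR \o -%R) (expR (- s) * - 1) by exact: is_derive1_comp.
by rewrite mulrN1.
Qed.

Let integral_expN : \int[leb]_(s in P) expR (- s) = 1.
Proof.
rewrite -Rintegral_indic /Rintegral -[RHS]/(fine 1%E).
rewrite -(integral_exponential_pdf (@ltr01 R)); congr fine.
rewrite [LHS](@ae_integral_congr _ _ _ leb setT _ (EFin \o exponential_pdf 1))//.
exists [set 0]; split => //; first exact: lebesgue_measure_set1.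
move=> s /=; apply: contra_notP => /eqP s0 _.
rewrite indicE; have [sP|sP] := boolP (s \in P).
  move: sP; rewrite mem_setE in_itv/= andbT => sP.
  by rewrite exponential_pdfE ?(ltW sP)// !mul1r mulN1r.
rewrite mul0r lt0_exponential_pdf// lt_neqAle s0/= leNgt.
by move: sP; rewrite mem_setE in_itv/= andbT.
Qed.

Let integral_expN_itv T : 0 <= T -> \int[leb]_(s in `]0, T]) expR (- s) = 1 - expR (- T).
Proof.
move=> T0; have dF s : is_derive s (1 : R) (- (fun s => expR (- s))) (expR (- s)).
  have := is_deriveN (is_derive_expN s); by rewrite opprK.
by rewrite (Rintegral_FTC T0 continuous_expN dF) /= !fctE oppr0 expR0 opprK addrC.
Qed.

Let integral_cos M s : s != 0 -> 0 <= M ->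
  \int[leb]_(m in `]0, M]) (expR (- s) * cos (s * m)) = expR (- s) * dirk M s.
Proof.
move=> s0 M0.
have cc : continuous (fun m => cos (s * m)).
  by move=> x; apply: continuous_comp; [exact: mulrl_continuous|exact: continuous_cos].
rewrite RintegralZl//; last exact: continuous_itv_integrable.
have dF m : is_derive m (1 : R) (s^-1 *: (sin \o ( *%R s))) (cos (s * m)).
  have dM := is_derive_mull s m.
  by apply: is_derive_eq; rewrite /GRing.scale /=; field.
rewrite (Rintegral_FTC M0 cc dF) /= !fctE /GRing.scale /= mulr0 sin0 mulr0 subr0.
by rewrite /dirk mulrC [s * M]mulrC; ring.
Qed.

Let den m : 1 + m ^+ 2 != 0.
Proof. by rewrite gt_eqF// ltr_pwDl// sqr_ge0. Qed.

Let integral_expcos T m : 0 <= T ->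
  \int[leb]_(s in `]0, T]) (expR (- s) * cos (s * m)) =
  (1 + m ^+ 2)^-1 + expR (- T) * (m * sin (T * m) - cos (T * m)) / (1 + m ^+ 2).
Proof.
move=> T0.
have cm (f : R -> R) : continuous f -> continuous (fun s => f (s * m)).
  by move=> cf x; apply: continuous_comp; [exact: mulrr_continuous|exact: cf].
have cc : continuous (fun s => expR (- s) * cos (s * m)).
  move=> x; apply: cvgM; first exact: continuous_expN.
  exact: (cm cos (@continuous_cos R)).
pose F := (1 + m ^+ 2)^-1 *: ((fun s => expR (- s)) * 
  (m *: (sin \o ( *%R m)) - (cos \o ( *%R m)))).
have dF s : is_derive s (1 : R) F (expR (- s) * cos (s * m)).
  have dM := is_derive_mull m s; have dE := is_derive_expN s.
  apply: is_derive_eq; rewrite /GRing.scale /= !fctE /= /GRing.scale/= [s * m]mulrC.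
  by field; exact: den.
rewrite (Rintegral_FTC T0 cc dF) /F /= ?fctE /GRing.scale /= ?fctE /GRing.scale /=.
rewrite mulr0 sin0 cos0 oppr0 expR0 [T * m]mulrC.
by field; exact: den.
Qed.

(** The kernel is the integral of cos (s m) over m in ]0, M]. The integrals
    are exchanged for s in ]0, T], then T = n tends to infinity: the factor exp(-s)
    makes the tails small. *)
Lemma integral_exp_dirk M : 0 < M -> \int[leb]_(s in P) (expR (- s) * dirk M s) = atan M.
Proof.
move=> M0.
have M0' := ltW M0.
have intP : leb.-integrable P (EFin \o (fun s => expR (- s) * dirk M s)).
  apply: (integrable_bmulr (C := M)) => // [|s _]; first exact: measurable_dirk.
  exact: norm_dirk.
apply/eqP; rewrite -subr_eq0 -normr_le0; apply: (@ler0_archi _ (3 * M)) => n.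
pose T : R := n%:R.
have T0 : 0 <= T by exact: ler0n.
have intT : leb.-integrable `]0, T] (EFin \o (fun s => expR (- s) * dirk M s)).
  by apply: integrableS intP => //; apply: subset_itvl; rewrite bnd_simp.
have eT : expR (- T) <= n.+1%:R^-1.
  by rewrite expRN lef_pV2 ?posrE ?expR_gt0// -natr1 addrC expR_ge1Dx.
have -> : \int[leb]_(s in P) (expR (- s) * dirk M s) - atan M =
  (\int[leb]_(s in P) (expR (- s) * dirk M s) -
   \int[leb]_(s in `]0, T]) (expR (- s) * dirk M s)) +
  (\int[leb]_(s in `]0, T]) (expR (- s) * dirk M s) - atan M) by rewrite addrA subrK.
have tail : `|\int[leb]_(s in P) (expR (- s) * dirk M s) -
    \int[leb]_(s in `]0, T]) (expR (- s) * dirk M s)| <= M * expR (- T).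
  have hP : `]0, T] `<=` P by apply: subset_itvl; rewrite bnd_simp.
  have iP := integrable_itv_indicM intP.
  have iT := integrable_itv_indicM intT.
  have iTe : leb.-integrable `]0, T] (EFin \o (fun s => expR (- s))).
    exact: continuous_itv_integrable.
  have iP' := integrable_itv_indicM integrable_expN.
  have iT' := integrable_itv_indicM iTe.
  rewrite -[X in X - _]Rintegral_indic -[X in _ - X]Rintegral_indic -RintegralB//.
  have -> : M * expR (- T) =
      \int[leb]_s (M * (\1_P s * expR (- s) - \1_(`]0, T]%classic) s * expR (- s))).
    rewrite RintegralZl//; last exact: integrableBR.
    rewrite RintegralB// !Rintegral_indic integral_expN integral_expN_itv//.
    by congr (_ * _); lra.
  apply: le_Rintegral_norm => //; first exact: integrableBR.
    by apply: integrableZR => //; exact: integrableBR.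
  move=> s _.
  have d0 : 0 <= \1_P s - \1_(`]0, T]%classic) s :> R.
    rewrite !indicE subr_ge0 ler_nat; case: (boolP (s \in `]0, T]%classic)) => // sT.
    by rewrite mem_set//; apply: hP; rewrite -in_setE.
  rewrite -!mulrBl 2!normrM (ger0_norm d0) (ger0_norm (expR_ge0 _)) mulrA mulrC.
  by rewrite ler_wpM2r ?norm_dirk//; exact: mulr_ge0 d0 (expR_ge0 _).
have cT (s : R) : continuous (fun m => cos (s * m)).
  by move=> x; apply: continuous_comp; [exact: mulrl_continuous|exact: continuous_cos].
have mcos : measurable_fun [set: T2 R] (fun p => cos (p.1 * p.2)).
  apply: measurableT_comp; first by apply: continuous_measurable_fun; exact: continuous_cos.
  by apply: measurable_funM; [exact: measurable_fst|exact: measurable_snd].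
have iTe : leb.-integrable `]0, T] (EFin \o (fun s => expR (- s))).
  exact: continuous_itv_integrable.
have ib : integrable2 (fun p => \1_(`]0, T]%classic) p.1 *
    \1_(`]0, M]%classic) p.2 * (expR (- p.1) * cos (p.1 * p.2))).
  have cb (p : R * R) : `|cos (p.1 * p.2)| <= 1 by rewrite ler_norml cos_geN1 cos_le1.
  have := integrable_prodM (integrable_itv_indicM iTe) (integrable_indic_itv' 0 M) mcos cb.
  by apply: eq_integrable => // p _ /=; congr EFin; ring.
have main : `|\int[leb]_(s in `]0, T]) (expR (- s) * dirk M s) - atan M| <= 2 * M * expR (- T).
  have -> : \int[leb]_(s in `]0, T]) (expR (- s) * dirk M s) =
      \int[leb]_(s in `]0, T]) \int[leb]_(m in `]0, M]) (expR (- s) * cos (s * m)).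
    apply: eq_Rintegral => s; rewrite mem_setE in_itv/= => /andP[s0 _].
    by rewrite integral_cos// gt_eqF.
  rewrite -(Rfubini_rect12 ib) (Rfubini_rect21 ib) /=.
  have cden : continuous (fun m : R => (1 + m ^+ 2)^-1).
    move=> x; apply: cvgV => //; apply: cvgD; first exact: cvg_cst.
    exact: exprn_continuous.
  have -> : atan M = \int[leb]_(m in `]0, M]) (1 + m ^+ 2)^-1.
    have dA (x : R) : is_derive x (1 : R) (@atan R) (1 + x ^+ 2)^-1 by exact: is_derive1_atan.
    by rewrite (Rintegral_FTC M0' cden dA) atan0 subr0.
  pose r m := expR (- T) * (m * sin (T * m) - cos (T * m)) / (1 + m ^+ 2).
  have cr : continuous r.
    move=> x; apply: cvgM; last exact: cden.
    apply: cvgM; first exact: cvg_cst.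
    apply: cvgB; last exact: cT.
    by apply: cvgM; [exact: cvg_id|exact: continuous_sinM].
  have -> : \int[leb]_(m in `]0, M]) \int[leb]_(s in `]0, T]) (expR (- s) * cos (s * m)) =
      \int[leb]_(m in `]0, M]) ((1 + m ^+ 2)^-1 + r m).
    by apply: eq_Rintegral => m _; exact: integral_expcos.
  rewrite RintegralD//; try exact: continuous_itv_integrable.
  rewrite addrC addKr; apply: (@le_trans _ _ (\int[leb]_(m in `]0, M]) (2 * expR (- T)))).
    apply: le_Rintegral_norm => //; try exact: continuous_itv_integrable.
      by apply: continuous_itv_integrable => x; exact: cvg_cst.
    move=> m; rewrite /= in_itv/= => /andP[m0 _]; rewrite /r -mulrA normrM.
    rewrite ger0_norm ?expR_ge0// mulrC ler_wpM2r ?expR_ge0//.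
    have dm : 0 < 1 + m ^+ 2 by rewrite ltr_pwDl// sqr_ge0.
    rewrite normrM normfV (ger0_norm (ltW dm)) ler_pdivrMr//.
    have h1 := sin_le1 (T * m); have h2 := sin_geN1 (T * m).
    have h3 := cos_le1 (T * m); have h4 := cos_geN1 (T * m).
    have h5 : `|m * sin (T * m)| <= m.
      by rewrite normrM (gtr0_norm m0) ler_piMr ?(ltW m0)// ler_norml h1 h2.
    have h6 : `|cos (T * m)| <= 1 by rewrite ler_norml h3 h4.
    apply: le_trans (ler_normB _ _) _; apply: le_trans (lerD h5 h6) _.
    by have := sqr_ge0 (m - 1); nra.
  rewrite Rintegral_cst//= lebesgue_measure_itv/= lte_fin M0 /= subr0.
  by rewrite mulrAC.
rewrite (le_trans (ler_normD _ _))//.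
apply: (@le_trans _ _ (3 * M * expR (- T))).
  by apply: le_trans (lerD tail main) _; lra.
by rewrite ler_wpM2l// mulr_ge0.
Qed.

(** The Dirichlet integral. The integral of exp(-s) sin (M s) / s over ]0, +oo[ is
    atan M, which tends to pi / 2; the weight h = exp(-s) / s - 1_{]0, sigma]}(s) / s
    by which it differs from the one here is integrable, since the singularities at 0
    cancel, and contributes a Riemann-Lebesgue term. *)
Lemma dirk_cvg sigma : 0 < sigma ->
  \int[leb]_(s in `]0, sigma]) dirk M s @[M --> +oo] --> (pi / 2 : R).
Proof.
move=> s0.
pose h (s : R) : R := \1_P s * (expR (- s) / s) - \1_(`]0, sigma]%classic) s * s^-1.
have hh : integrable1 h.
  pose g (s : R) : R := \1_(`]0, sigma]%classic) s + sigma^-1 * (\1_P s * expR (- s)).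
  apply: (@le_integrableR _ _ R leb setT h g) => //.
  - apply: measurable_funB; apply: measurable_funM; try exact: measurable_indic.
      apply: measurable_funM; last exact: measurable_invR.
      exact: continuous_measurable_fun.
    exact: measurable_invR.
  - move=> s _; rewrite /h /g !indicE !mem_setE !in_itv/= andbT.
    case: (ltP 0 s) => [sp|sn] /=; last first.
      by rewrite !mul0r mulr0 addr0 subr0 normr0.
    rewrite !mul1r; case: (leP s sigma) => [sle|slt].
      rewrite mul1r -[X in _ - X]mul1r -mulrBl normrM normfV (gtr0_norm sp).
      apply: (@le_trans _ _ 1); last by rewrite lerDl mulr_ge0 ?invr_ge0 ?(ltW s0) ?expR_ge0.
      rewrite ler_pdivrMr// mul1r ler_norml.
      have := expR_ge1Dx (- s); have := expR_gt0 (- s).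
      have : expR (- s) <= 1 by rewrite expR_le1 oppr_le0 ltW.
      by lra.
    rewrite mul0r subr0 add0r normrM normfV (gtr0_norm sp) ger0_norm ?expR_ge0//.
    by rewrite mulrC ler_wpM2r ?expR_ge0// lef_pV2 ?posrE// ltW.
  - apply: integrableDR => //; first exact: integrable_indic_itv'.
    by apply: integrableZR => //; exact: integrable_itv_indicM.
have /cvgrPdist_le RL := riemann_lebesgue hh.
have /cvgrPdist_le AT := @cvgy_atan R.
apply/cvgrPdist_le => eps eps0; have e2 : 0 < eps / 2 by rewrite divr_gt0.
near=> M.
have M0 : 0 < M by near: M; exact: nbhs_pinfty_gt.
have h1 : `|0 - \int[leb]_s (h s * sin (M * s))| <= eps / 2 by near: M; exact: RL.
have h2 : `|pi / 2 - atan M| <= eps / 2 by near: M; exact: AT.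
have E : \int[leb]_s (h s * sin (M * s)) = atan M - \int[leb]_(s in `]0, sigma]) dirk M s.
  have M0' := ltW M0.
  rewrite -integral_exp_dirk// -[X in X - _]Rintegral_indic -[X in _ - X]Rintegral_indic.
  rewrite -RintegralB//; first by apply: eq_Rintegral => s _; rewrite /h /dirk; ring.
    apply: integrable_itv_indicM.
    apply: (integrable_bmulr (C := M)) => // [|s _]; first exact: measurable_dirk.
    exact: norm_dirk.
  by apply: integrable_itv_indicM; exact: integrable_dirk.
move: h1; rewrite E sub0r opprB => h1.
have -> : pi / 2 - \int[leb]_(s in `]0, sigma]) dirk M s =
  (pi / 2 - atan M) - (\int[leb]_(s in `]0, sigma]) dirk M s - atan M) by ring.
rewrite (le_trans (ler_normB _ _))//.
by rewrite (le_trans (lerD h2 h1))// -splitr.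
Unshelve. all: by end_near. Qed.

End DirichletIntegral.

(** * Jordan's theorem in one and two variables *)

Section LocalTheorem.
Context {R : realType}.
Implicit Types (F : R -> R -> R) (phi : R -> R) (e V w M N eps sigma : R).

(** [bv_integral_bound] with the bound 3 of the kernel: the factor |phi(e)| + 3 Var is
    at most 4 V. *)
Lemma bv1_dirk e phi V M : 0 < e -> 0 < M -> bv1 e phi V ->
  [/\ measurable_fun `]0, e] phi,
     leb.-integrable `]0, e] (EFin \o (fun x => phi x * dirk M x)) &
     `|\int[leb]_(x in `]0, e]) (phi x * dirk M x)| <= 12 * V].
Proof.
move=> e0 M0 h; have V0 := bv1_ge0 h.
have [|x x0 _|s ns|m i b] := @bv_integral_bound R 0 e (dirk M) 3 phi V e0.
- exact/integrable_dirk/ltW.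
- exact: dirk_bound.
- by apply: (le_trans _ (h s ns)); rewrite lerDr.
split => //; apply: (le_trans b).
by have := bv1_sup h e0 (lexx e); lra.
Qed.

(** On ]0, sigma], phi - phi(sigma) has variation at most w and vanishes at sigma; on
    ]sigma, e] the integrals of the kernel are at most 2 / (sigma M). *)
Lemma bv1_dirk_near e phi V w sigma M : 0 < sigma -> sigma <= e -> 0 < M ->
  bv1 e phi V -> (forall s : seq R, net 0 sigma s -> netsum (fun x y => `|phi y - phi x|) s <= w) ->
  `|\int[leb]_(x in `]0, e]) (phi x * dirk M x) -
    phi sigma * \int[leb]_(x in `]0, sigma]) dirk M x| <= 9 * w + 8 * V * (sigma * M)^-1.
Proof.
move=> s0 se M0 h hw; have V0 := bv1_ge0 h.
have e0 : 0 < e by exact: lt_le_trans se.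
have [_ i _] := bv1_dirk e0 M0 h.
have w0 : 0 <= w by exact: (hw [::]).
have sM : 0 < sigma * M by rewrite mulr_gt0.
rewrite (Rintegral_itv_cat (ltW s0) se)//.
have i0 : leb.-integrable `]0, sigma] (EFin \o (fun x => phi x * dirk M x)).
  exact: (sub_itv_integrable (lexx 0) se).
have ik : leb.-integrable `]0, sigma] (EFin \o dirk M) by exact/integrable_dirk/ltW.
have near : `|\int[leb]_(x in `]0, sigma]) (phi x * dirk M x) -
    phi sigma * \int[leb]_(x in `]0, sigma]) dirk M x| <= 9 * w.
  rewrite -RintegralZl// -RintegralB//; last exact: integrableZR.
  have -> : \int[leb]_(x in `]0, sigma]) (phi x * dirk M x - phi sigma * dirk M x) =
      \int[leb]_(x in `]0, sigma]) ((phi x - phi sigma) * dirk M x).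
    by apply: eq_Rintegral => x _; ring.
  have [//|x x0 _|s ns|_ _ b] := @bv_integral_bound R 0 sigma (dirk M) 3 (fun x => phi x - phi sigma) w s0.
  - exact: dirk_bound.
  - apply: (le_trans _ (hw s ns)); apply: ler_netsum => x y _ _.
    by rewrite opprB addrA subrK.
  - by apply: (le_trans b); rewrite subrr normr0; lra.
have far : `|\int[leb]_(x in `]sigma, e]) (phi x * dirk M x)| <= 8 * V * (sigma * M)^-1.
  move: se; rewrite le_eqVlt => /predU1P[->|se].
    by rewrite set_itvoc0 Rintegral_set0 normr0 !mulr_ge0// invr_ge0 ?mulr_ge0 ?ltW.
  have [|x x0 _|s ns|_ _ b] := @bv_integral_bound R sigma e (dirk M) (2 / (sigma * M)) phi V se.
  - exact/integrable_dirk/ltW.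
  - exact: dirk_tail.
  - apply: (le_trans _ (h s _)); first by rewrite lerDr.
    exact: net_widen (ltW s0) (lexx e) ns.
  apply: (le_trans b); have := bv1_sup h e0 (lexx e).
  have : 0 < (sigma * M)^-1 by rewrite invr_gt0.
  by set r := _^-1; nra.
rewrite addrAC (le_trans (ler_normD _ _))//.
by rewrite lerD.
Qed.

Definition lim2 (G : R -> R -> R) (l : R) :=
  forall eps, 0 < eps -> exists X, forall M N, X < M -> X < N -> `|G M N - l| <= eps.

Lemma pihalf_le2 : pi / 2 <= 2 :> R.
Proof. by have /andP[_ /ltW] := @pihalf_02 R. Qed.

Lemma pihalf_ge0 : 0 <= pi / 2 :> R.
Proof. by rewrite divr_ge0// pi_ge0. Qed.

(** P K = P k + P (K - k) with K close to k = pi / 2 and P close to k g. *)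
Let product_error (P K p k g V d w : R) : 0 <= V -> `|K - k| <= d -> `|P| <= V ->
  `|P - k * p| <= d -> `|p - g| <= w -> 0 <= k -> k <= 2 ->
  `|P * K - k * (k * g)| <= V * d + 2 * d + 4 * w.
Proof.
move=> V0 hK hP hp hg k0 k2.
have -> : P * K - k * (k * g) = P * (K - k) + k * (P - k * p) + k * k * (p - g) by ring.
apply: le_trans (ler_normD _ _) _; apply: le_trans (lerD (ler_normD _ _) (lexx _)) _.
rewrite !normrM (ger0_norm k0) !lerD// ?ler_pM//.
  exact: mulr_ge0.
by nra.
Qed.

Let tail_small (c sigma eps : R) : 0 <= c -> 0 < sigma -> 0 < eps ->
  exists X : R, 0 < X /\ forall M, X < M -> c * (sigma * M)^-1 <= eps.
Proof.
move=> c0 s0 eps0; exists (c / (sigma * eps) + 1); split.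
  by rewrite ltr_wpDl// divr_ge0// mulr_ge0 ?(ltW s0) ?(ltW eps0).
move=> M XM.
have cM : c / (sigma * eps) < M by apply: lt_trans XM; rewrite ltrDl.
have M0 : 0 < M by apply: le_lt_trans cM; rewrite divr_ge0// mulr_ge0 ?(ltW s0) ?(ltW eps0).
rewrite ler_pdivrMr ?mulr_gt0//; move: cM; rewrite ltr_pdivrMr ?mulr_gt0// => /ltW.
by rewrite mulrA mulrC [M * sigma]mulrC.
Qed.

Let frac_small (V eps : R) : 0 <= V -> 0 < eps -> exists d : R, 0 < d /\ (V + 1) * d <= eps.
Proof.
move=> V0 eps0; have V1 : 0 < V + 1 by rewrite ltr_wpDl.
exists (eps / (V + 1)); split; first by rewrite divr_gt0.
by rewrite mulrC divfK// gt_eqF.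
Qed.

(** By [bv1_dirk_near] the integral is close to phi(sigma) times that of the kernel
    over ]0, sigma], for a sigma with small variation on ]0, sigma]. *)
Lemma bv1_dirk_cvg e phi V l : 0 < e -> bv1 e phi V -> phi x @[x --> 0^'+] --> l ->
  \int[leb]_(x in `]0, e]) (phi x * dirk M x) @[M --> +oo] --> pi / 2 * l.
Proof.
move=> e0 h hl; have V0 := bv1_ge0 h.
suff H eps : 0 < eps -> \forall M \near +oo,
    `|\int[leb]_(x in `]0, e]) (phi x * dirk M x) - pi / 2 * l| <= eps.
  apply/cvgrPdist_le => eps eps0; near=> M; rewrite distrC; near: M; exact: H.
move=> eps0.
have [w [w0 hw]] : exists w, 0 < w /\ 13 * w <= eps / 4.
  by exists (eps / 52); split; lra.
have e4 : 0 < eps / 4 by rewrite divr_gt0.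
have [d [d0 hd]] := frac_small (addr_ge0 V0 (ler0n R 1)) e4.
have [sigma [s0 se hs]] := bv1_small e0 h w0.
have sl : `|phi sigma - l| <= w.
  have cl : `|phi sigma - phi x| @[x --> 0^'+] --> `|phi sigma - l|.
    by apply: cvg_norm; apply: cvgB => //; exact: cvg_cst.
  apply: (cvgr_to_le cl); near=> x; apply: (bv1_close e _ _ hs); near: x.
    exact: nbhs_right_gt.
  exact: nbhs_right_le.
have /cvgrPdist_le K := dirk_cvg s0.
have [X [X0 hX]] := tail_small (mulr_ge0 (ler0n R 8) V0) s0 e4.
near=> M.
have M0 : 0 < M by near: M; exact: nbhs_pinfty_gt.
have KM : `|\int[leb]_(s in `]0, sigma]) dirk M s - pi / 2| <= d.
  by rewrite distrC; near: M; exact: K.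
have MX : X < M by near: M; apply: nbhs_pinfty_gt; exact: num_real.
have b1 := bv1_dirk_near s0 se M0 h hs.
have b2 : `|phi sigma * \int[leb]_(s in `]0, sigma]) dirk M s - pi / 2 * l| <=
    V * d + (pi / 2) * w.
  have -> : phi sigma * \int[leb]_(s in `]0, sigma]) dirk M s - pi / 2 * l =
    phi sigma * (\int[leb]_(s in `]0, sigma]) dirk M s - pi / 2) + pi / 2 * (phi sigma - l).
    by ring.
  apply: le_trans (ler_normD _ _) _.
  rewrite (normrM (phi sigma)) (normrM (pi / 2)) (ger0_norm pihalf_ge0).
  apply: lerD; last by rewrite ler_wpM2l ?pihalf_ge0.
  by apply: ler_pM => //; exact: (bv1_sup h s0 se).
rewrite -(subrKA (phi sigma * \int[leb]_(s in `]0, sigma]) dirk M s)).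
apply: le_trans (ler_normD _ _) _; apply: le_trans (lerD b1 b2) _.
apply: (@le_trans _ _ (9 * w + eps / 4 + (V * d + 2 * w))).
  by rewrite lerD// lerD// ?hX// ler_wpM2r ?(ltW w0)// pihalf_le2.
apply: (@le_trans _ _ (13 * w + eps / 4 + (V + 1 + 1) * d)).
  by move: V0 (ltW d0) (ltW w0); clear; nra.
by move: hw hd eps0; clear; lra.
Unshelve. all: by end_near. Qed.

(** The variation of s |-> int F(s, t) k(t) dt is the integral of k against a sum Phi of
    increments of F with the signs of the increments of the integral. The norm [nv]
    of Phi is at most the sum of those of the increments of F. *)
Let signed_increments e2 F N s : 0 < e2 -> 0 < N ->
  (forall x, x \in s -> exists V, bv1 e2 (F x) V) ->
  exists Phi, [/\ exists V, bv1 e2 Phi V,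
    (forall t : seq R, net 0 e2 t ->
      nv e2 t Phi <= netsum (fun x y => nv e2 t (F y \- F x)) s) &
    netsum (fun x y => `|\int[leb]_(t in `]0, e2]) (F y t * dirk N t) -
      \int[leb]_(t in `]0, e2]) (F x t * dirk N t)|) s =
    \int[leb]_(t in `]0, e2]) (Phi t * dirk N t)].
Proof.
move=> e20 N0.
have base : exists Phi, [/\ exists V, bv1 e2 Phi V,
    (forall t : seq R, net 0 e2 t -> nv e2 t Phi <= 0) &
    0 = \int[leb]_(t in `]0, e2]) (Phi t * dirk N t)].
  have nv0 t : nv e2 t (cst 0) = 0.
    rewrite (_ : cst 0 = (fun x => 0 * cst (0 : R) x)); last first.
      by apply/funext => z; rewrite mul0r.
    by rewrite nvZ normr0 mul0r.
  exists (cst 0); split.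
  - by exists 0 => t nt; rewrite nv0.
  - by move=> t nt; rewrite nv0.
  - by under eq_Rintegral do rewrite mul0r; rewrite Rintegral_cst// mul0r.
elim: s => [|x [|y s] IH] hF //; first by rewrite /= addr0.
have [Phi [[V hV] hPhi iPhi]] := IH (fun z zs => hF z (mem_behead (s := [:: x, y & s]) zs)).
have [Vx hx] := hF x (mem_head _ _).
have [Vy hy] : exists V, bv1 e2 (F y) V by apply: hF; rewrite !inE eqxx orbT.
set J := fun x => \int[leb]_(t in `]0, e2]) (F x t * dirk N t) in iPhi *.
pose sg := Num.sg (J y - J x).
have sg1 : `|sg| <= 1 by rewrite /sg normr_sg; case: eqP.
pose Psi := (fun t => sg * (F y \- F x) t) \+ Phi.
have nvd t : nv e2 t (F y \- F x) <= nv e2 t (F y) + nv e2 t (F x).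
  rewrite (_ : F y \- F x = F y \+ (fun t => -1 * F x t)); last first.
    by apply/funext => z /=; rewrite mulN1r.
  by apply: le_trans (nvD _ _ _ _) _; rewrite nvZ normrN1 mul1r.
have nvPsi t : nv e2 t Psi <= nv e2 t (F y \- F x) + nv e2 t Phi.
  apply: le_trans (nvD _ _ _ _) _; rewrite lerD2r nvZ.
  by rewrite ler_piMl ?nv_ge0.
exists Psi; split.
- exists (Vy + Vx + V) => t nt; apply: (le_trans (nvPsi t)).
  by rewrite lerD ?hV//; apply: (le_trans (nvd t)); rewrite lerD ?hx ?hy.
- move=> t nt; apply: (le_trans (nvPsi t)).
  by have := hPhi t nt; rewrite [in X in _ -> X]/= -/(netsum _ (y :: s)) lerD2l.
have [_ ix _] := bv1_dirk e20 N0 hx.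
have [_ iy _] := bv1_dirk e20 N0 hy.
have [_ ip _] := bv1_dirk e20 N0 hV.
have -> : \int[leb]_(t in `]0, e2]) (Psi t * dirk N t) =
   \int[leb]_(t in `]0, e2]) (sg * (F y t * dirk N t - F x t * dirk N t) + Phi t * dirk N t).
  by apply: eq_Rintegral => t _; rewrite /Psi /=; ring.
have iyx : leb.-integrable `]0, e2] (EFin \o (fun t => F y t * dirk N t - F x t * dirk N t)).
  exact: integrableBR.
rewrite RintegralD//; last exact: integrableZR.
rewrite RintegralZl// RintegralB// -iPhi -/(J x) -/(J y).
by rewrite -normrEsg.
Qed.

(** The bounds are uniform in N, although the integral over t oscillates: [bv1_dirk]
    only sees the norm of the increments of F. *)
Lemma bv2_dirk_section e1 e2 F V N : 0 < e1 -> 0 < e2 -> 0 < N -> bv2 e1 e2 F V ->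
  let psi s := \int[leb]_(t in `]0, e2]) (F s t * dirk N t) in
  bv1 e1 psi (24 * V) /\
  forall sigma w, 0 < sigma -> sigma <= e1 ->
    (forall s t : seq R, net 0 sigma s -> net 0 e2 t ->
      netsum (fun x y => nv e2 t (F y \- F x)) s <= w) ->
    forall s : seq R, net 0 sigma s -> netsum (fun x y => `|psi y - psi x|) s <= 12 * w.
Proof.
move=> e10 e20 N0 h psi.
have bvs x : 0 < x -> x <= e1 -> bv1 e2 (F x) V by exact: bv2_section.
have main sigma w : 0 < sigma -> sigma <= e1 ->
    (forall s t : seq R, net 0 sigma s -> net 0 e2 t ->
      netsum (fun x y => nv e2 t (F y \- F x)) s <= w) ->
    forall s : seq R, net 0 sigma s -> netsum (fun x y => `|psi y - psi x|) s <= 12 * w.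
  move=> s0 se hw s ns.
  have [x xs|Phi [_ hPhi ->]] := @signed_increments e2 F N s e20 N0.
    by have /andP[x0 xe] := net_mem ns xs; exists V; apply: bvs => //; exact: le_trans se.
  have bPhi : bv1 e2 Phi w by move=> t nt; apply: le_trans (hPhi t nt) (hw s t ns nt).
  by have [_ _] := bv1_dirk e20 N0 bPhi; apply: le_trans; exact: ler_norm.
split=> // s ns; have [_ _ b1] := bv1_dirk e20 N0 (bvs e1 e10 (lexx e1)).
have b2 : netsum (fun x y => `|psi y - psi x|) s <= 12 * V.
  apply: (main e1 V e10 (lexx e1)) => // s' t ns' nt.
  by apply: (le_trans _ (h s' t ns' nt)); rewrite lerDr nv_ge0.
by apply: le_trans (lerD b1 b2) _; lra.
Qed.

(** [bv1_dirk_near] for the function psi(s) = int F(s, t) D_N(t) dt, with bounds which do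
    not depend on N, leaves psi(sigma) times the integral of D_M; and psi(sigma) tends
    to pi / 2 times the limit l of F(sigma, .), which is close to g. *)
Lemma bv2_dirk_lim2 e1 e2 F V g : 0 < e1 -> 0 < e2 -> bv2 e1 e2 F V ->
  (fun p => F p.1 p.2) @ filter_prod 0^'+ 0^'+ --> g ->
  lim2 (fun M N => \int[leb]_(s in `]0, e1])
    ((\int[leb]_(t in `]0, e2]) (F s t * dirk N t)) * dirk M s)) (pi / 2 * (pi / 2 * g)).
Proof.
move=> e10 e20 h hg eps eps0; have V0 := bv2_ge0 h.
have e4 : 0 < eps / 4 by rewrite divr_gt0.
have [w [w0 hw]] : exists w, 0 < w /\ 112 * w <= eps / 4.
  by exists (eps / 448); split; lra.
have V24 : 0 <= 24 * V by rewrite mulr_ge0.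
have [d [d0 hd]] := frac_small (addr_ge0 V24 (ler0n R 1)) e4.
have [sigma [s0 se hs]] := bv2_small e10 h w0.
have bvs := bv2_section h s0 se.
have /cvg_ex[l hl] := bv1_cvg e20 bvs.
have lg : `|l - g| <= w.
  have c1 : (fun p : R * R => F sigma p.2) @ filter_prod 0^'+ 0^'+ --> l.
    exact: cvg_comp cvg_snd hl.
  have c2 : `|F sigma p.2 - F p.1 p.2| @[p --> filter_prod 0^'+ 0^'+] --> `|l - g|.
    by apply: cvg_norm; apply: cvgB.
  apply: (cvgr_to_le c2); near=> p.
  have p1 : 0 < p.1 <= sigma.
    near: p; apply: (@filter_prod1 _ _ (0^'+) (0^'+) _ (fun s => 0 < s <= sigma)).
    near=> s; apply/andP; split; near: s; [exact: nbhs_right_gt|exact: nbhs_right_le].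
  have p2 : 0 < p.2 <= e2.
    near: p; apply: (@filter_prod2 _ _ (0^'+) (0^'+) _ (fun s => 0 < s <= e2)).
    near=> s; apply/andP; split; near: s; [exact: nbhs_right_gt|exact: nbhs_right_le].
  case/andP: p1 p2 => p10 p1s /andP[p20 p2e].
  exact: (bv2_close e1 p10 p1s p20 p2e hs).
have /cvgrPdist_le/(_ _ d0)[X1 [_ h1]] := bv1_dirk_cvg e20 bvs hl.
have /cvgrPdist_le/(_ _ d0)[X2 [_ h2]] := dirk_cvg s0.
have [X3 [X30 h3]] := tail_small (mulr_ge0 (ler0n R 8) V24) s0 e4.
exists (Num.max X3 (Num.max X1 X2)) => M N; rewrite !gt_max.
move=> /andP[M3 /andP[M1 M2]] /andP[N3 /andP[N1 N2]].
have M0 : 0 < M by exact: lt_trans M3.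
have N0 : 0 < N by exact: lt_trans N3.
have [bpsi vpsi] := bv2_dirk_section e10 e20 N0 h.
have near := bv1_dirk_near s0 se M0 bpsi (vpsi sigma w s0 se hs).
have hK : `|\int[leb]_(s in `]0, sigma]) dirk M s - pi / 2| <= d.
  by rewrite distrC; exact: h2.
have hP : `|\int[leb]_(t in `]0, e2]) (F sigma t * dirk N t) - pi / 2 * l| <= d.
  by rewrite distrC; exact: h1.
have hB := bv1_sup bpsi s0 se.
have prod := product_error V24 hK hB hP lg pihalf_ge0 pihalf_le2.
have tl := h3 M M3.
set P := _ * \int[leb]_(s in `]0, sigma]) dirk M s in near prod.
rewrite -(subrKA P); apply: le_trans (ler_normD _ _) _; apply: le_trans (lerD near prod) _.
move: hw hd tl V0 (ltW d0) (ltW w0) (ltW eps0); clear.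
by set r := (sigma * M)^-1; lra.
Unshelve. all: by end_near. Qed.

End LocalTheorem.

(** * The four regions of a quadrant *)

Section AeSections.
Context {R : realType}.

Lemma ae_Rintegral_congr_in d (T : measurableType d) (mu : {measure set T -> \bar R})
    (D : set T) (f g : T -> R) :
  {ae mu, forall x, D x -> f x = g x} -> \int[mu]_(x in D) f x = \int[mu]_(x in D) g x.
Proof.
move=> fg; rewrite Rintegral_mkcond [RHS]Rintegral_mkcond; apply: ae_Rintegral_congr.
apply: filterS fg => x h _; rewrite /patch; case: ifP => // xD; apply: h.
by rewrite inE in xD.
Qed.

Lemma ae_sections (P : T2 R -> Prop) : {ae leb2 R, forall p, P p} ->
  {ae leb, forall s, {ae leb, forall t, P (s, t)}}.
Proof.
move=> [N [mN N0 PN]].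
have mx : measurable_fun setT (fun s => leb (xsection N s)).
  exact: (measurable_fun_xsection leb mN).
have : ae_eq leb setT (fun s => leb (xsection N s)) (cst 0%E).
  apply/(ae_eq_integral_abs leb measurableT mx).
  rewrite -[RHS]N0; apply: eq_integral => s _.
  by rewrite gee0_abs// measure_ge0.
apply: filterS => s /(_ I) Ns; exists (xsection N s); split => //.
  exact: measurable_xsection.
by move=> t /= nP; rewrite /xsection/= inE; apply: PN.
Qed.

Lemma Rintegral_swap (f : R * R -> R) : integrable2 f ->
  \int[leb2 R]_p f (p.2, p.1) = \int[leb2 R]_p f p.
Proof.
move=> h; rewrite Rfubini12//; last exact: integrable_swap.
by rewrite [RHS]Rfubini21.
Qed.

End AeSections.

Section Quadrant.
Context {R : realType}.
Implicit Types (G : R -> R -> R) (H : R * R -> R) (M N l : R).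

Lemma lim2_eq G G' l : (forall M N, 0 < M -> 0 < N -> G M N = G' M N) ->
  lim2 G l -> lim2 G' l.
Proof.
move=> GG h eps /h [X hX]; exists (Num.max 0 X) => M N.
by rewrite !gt_max => /andP[M0 XM] /andP[N0 XN]; rewrite -GG//; exact: hX.
Qed.

Lemma lim2D G G' l l' : lim2 G l -> lim2 G' l' -> lim2 (fun M N => G M N + G' M N) (l + l').
Proof.
move=> h h' eps eps0; have e2 : 0 < eps / 2 by rewrite divr_gt0.
have [X hX] := h _ e2; have [X' hX'] := h' _ e2; exists (Num.max X X') => M N.
rewrite !gt_max => /andP[XM XM'] /andP[XN XN'].
rewrite opprD addrACA (le_trans (ler_normD _ _))//.
by rewrite [leRHS]splitr lerD ?hX ?hX'.
Qed.

Lemma lim2_swap G l : lim2 G l -> lim2 (fun M N => G N M) l.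
Proof. by move=> h eps /h[X hX]; exists X => M N XM XN; exact: hX. Qed.

Lemma indicator_bound (A : set R) (x : R) : `|\1_A x : R| <= 1.
Proof. by rewrite indicE; case: (x \in A); rewrite ?normr1 ?normr0. Qed.

Let rect (A B : set (measurableTypeR R)) H M N (p : R * R) : R :=
  \1_A p.1 * \1_B p.2 * (H p * dirk M p.1 * dirk N p.2).

Let rect_integrable A B H M N : measurable A -> measurable B -> 0 < M -> 0 < N ->
  integrable2 H ->
  integrable2 (rect A B H M N).
Proof.
move=> mA mB M0 N0 iH.
have -> : rect A B H M N =
    (fun p => \1_A p.1 * \1_B p.2 * dirk M p.1 * dirk N p.2 * H p).
  by apply/funext => p; rewrite /rect; ring.
apply: (integrable_bmul (C := 1 * 1 * M * N)) => //.
  apply: measurable_funM; last first.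
    by apply: (measurable_fun_snd (c := dirk N)); exact: measurable_dirk.
  apply: measurable_funM; last first.
    by apply: (measurable_fun_fst (c := dirk M)); exact: measurable_dirk.
  apply: measurable_funM.
    by apply: (measurable_fun_fst (c := \1_A)); exact: measurable_indic.
  by apply: (measurable_fun_snd (c := \1_B)); exact: measurable_indic.
move=> p _; rewrite normrM; apply: ler_pM => //; last by rewrite norm_dirk// ltW.
rewrite normrM; apply: ler_pM => //; last by rewrite norm_dirk// ltW.
by rewrite normrM ler_pM// indicator_bound.
Qed.

Let far_bound (e x : R) : 0 < e -> `|\1_(`]e, +oo[%classic) x / x| <= e^-1.
Proof.
move=> e0; rewrite indicE mem_setE in_itv/= andbT; case: ltP => ex; last first.
  by rewrite mul0r normr0 invr_ge0 ltW.
have x0 : 0 < x by exact: lt_trans ex.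
by rewrite mul1r gtr0_norm ?invr_gt0// lef_pV2 ?posrE//; exact: ltW.
Qed.

Let measurable_far (e : R) :
  measurable_fun setT (fun x : R => \1_(`]e, +oo[%classic) x / x : R).
Proof. by apply: measurable_funM; [exact: measurable_indic|exact: measurable_invR]. Qed.

(** 1 / (s t) is bounded here, so that H / (s t) is integrable. *)
Let far_far H e1 e2 : 0 < e1 -> 0 < e2 -> integrable2 H ->
  lim2 (fun M N => \int[leb2 R]_p rect `]e1, +oo[ `]e2, +oo[ H M N p) 0.
Proof.
move=> e10 e20 iH eps eps0.
pose A : set (measurableTypeR R) := `]e1, +oo[%classic.
pose B : set (measurableTypeR R) := `]e2, +oo[%classic.
pose phi (p : R * R) := (\1_A p.1 / p.1) * (\1_B p.2 / p.2) * H p.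
have iphi : integrable2 phi.
  apply: (integrable_bmul (C := e1^-1 * e2^-1)) => //.
    apply: measurable_funM.
      exact: (measurable_fun_fst (measurable_far e1)).
    exact: (measurable_fun_snd (measurable_far e2)).
  by move=> p _; rewrite normrM ler_pM// far_bound.
have [X hX] := riemann_lebesgue2_unif iphi eps0; exists X => M N XM _.
have := hX M XM (fun t => sin (N * t)) (measurable_sinM N measurableT).
move=> /(_ (fun t => norm_sin_le1 _)); rewrite subr0; apply: le_trans.
rewrite le_eqVlt; apply/orP; left; apply/eqP; congr (`|_|); apply: eq_Rintegral => p _.
by rewrite /rect /phi /dirk -/A -/B; ring.
Qed.

(** On this strip along the axis s = 0, H(s, t) = (H(s, t) - P(t)) + P(t). The first part
    divided by s is integrable by hypothesis, a Riemann-Lebesgue term. The second part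
    gives a product of integrals, bounded for s and a Riemann-Lebesgue term for t. *)
Let near_far H (P : R -> R) e1 e2 : 0 < e1 -> 0 < e2 ->
  integrable2 H -> integrable1 P ->
  integrable2 (fun p => \1_(`]0, e1]%classic) p.1 *
    \1_(`]e2, +oo[%classic) p.2 * ((H p - P p.2) / p.1)) ->
  lim2 (fun M N => \int[leb2 R]_p rect `]0, e1] `]e2, +oo[ H M N p) 0.
Proof.
move=> e10 e20 iH iP iLC eps eps0.
pose A : set (measurableTypeR R) := `]0, e1]%classic.
pose B : set (measurableTypeR R) := `]e2, +oo[%classic.
have aux : 3 * (eps / 6) <= eps / 2 by lra.
pose phi (p : R * R) := (\1_B p.2 / p.2) * (\1_A p.1 * \1_B p.2 * ((H p - P p.2) / p.1)).
pose chi (t : R) : R := (\1_B t / t) * P t.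
have iphi : integrable2 phi.
  apply: (integrable_bmul (C := e2^-1)) => //.
    exact: (measurable_fun_snd (measurable_far e2)).
  by move=> p _; exact: far_bound.
have ichi : integrable1 chi.
  apply: (integrable_bmul (C := e2^-1)) => //; first exact: measurable_far.
  by move=> t _; exact: far_bound.
have idirk M : 0 < M -> integrable1 (fun s => \1_A s * dirk M s).
  by move=> M0; apply: integrable_itv_indicM; exact/integrable_dirk/ltW.
have ichiS N : integrable1 (fun t => chi t * sin (N * t)).
  exact: integrable_sinM.
pose rest M N (p : R * R) := \1_A p.1 * dirk M p.1 * (chi p.2 * sin (N * p.2)) * 1.
have irest M N : 0 < M -> integrable2 (rest M N).
  move=> M0; apply: (integrable_prodM (C := 1) (idirk M M0) (ichiS N)) => //.
  by move=> p; rewrite normr1.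
have iphis M N : integrable2 (fun p => phi p * sin (M * p.1) * sin (N * p.2)).
  apply: (integrable_bmulr (C := 1)) => //.
  - exact: (measurable_fun_snd (measurable_sinM N measurableT)).
  - by move=> p _; exact: norm_sin_le1.
  - exact: integrable2_sinM.
have e2' : 0 < eps / 2 by rewrite divr_gt0.
have e6 : 0 < eps / 6 by rewrite divr_gt0.
have [X hX] := riemann_lebesgue2_unif iphi e2'.
have /cvgrPdist_le/(_ _ e6)[Y [_ hY]] := riemann_lebesgue ichi.
exists (Num.max 0 (Num.max X Y)) => M N; rewrite !gt_max.
move=> /andP[M0 /andP[XM YM]] /andP[N0 /andP[XN YN]]; rewrite subr0.
have -> : \int[leb2 R]_p rect `]0, e1] `]e2, +oo[ H M N p =
    \int[leb2 R]_p (phi p * sin (M * p.1) * sin (N * p.2)) + \int[leb2 R]_p rest M N p.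
  rewrite -RintegralD//; last exact: irest.
  apply: eq_Rintegral => p _; rewrite /rect /rest /phi /chi /dirk -/A -/B.
  by rewrite !indicE; case: (p.2 \in B) => /=; ring.
have h1 := hX M XM (fun t => sin (N * t)) (measurable_sinM N measurableT)
  (fun t => norm_sin_le1 _).
have h2 : `|\int[leb2 R]_p rest M N p| <= eps / 2.
  rewrite Rfubini12; last exact: irest.
  have -> : \int[leb]_s \int[leb]_t rest M N (s, t) =
      \int[leb]_s (\1_A s * dirk M s * \int[leb]_t (chi t * sin (N * t))).
    apply: eq_Rintegral => s _; rewrite -RintegralZl//; apply: eq_Rintegral => t _.
    by rewrite /rest mulr1.
  rewrite RintegralZr//; last exact: idirk.
  have hQ := hY N YN; rewrite sub0r normrN in hQ.
  have hK : `|\int[leb]_s (\1_A s * dirk M s)| <= 3.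
    by rewrite Rintegral_indic; apply: dirk_bound => //; exact: ltW.
  by rewrite normrM; apply: (le_trans _ aux); exact: ler_pM.
by rewrite (le_trans (ler_normD _ _))// [leRHS]splitr lerD.
Qed.

Let far_near H (Q : R -> R) e1 e2 : 0 < e1 -> 0 < e2 ->
  integrable2 H -> integrable1 Q ->
  integrable2 (fun p => \1_(`]e1, +oo[%classic) p.1 *
    \1_(`]0, e2]%classic) p.2 * ((H p - Q p.1) / p.2)) ->
  lim2 (fun M N => \int[leb2 R]_p rect `]e1, +oo[ `]0, e2] H M N p) 0.
Proof.
move=> e10 e20 iH iQ iLC.
have := @near_far (fun p => H (p.2, p.1)) Q e2 e1 e20 e10 (integrable_swap iH) iQ _.
have -> : (fun p : R * R => \1_(`]0, e2]%classic) p.1 * \1_(`]e1, +oo[%classic) p.2 *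
    ((H (p.2, p.1) - Q p.2) / p.1)) = (fun p : R * R =>
    (fun p : R * R => \1_(`]e1, +oo[%classic) p.1 *
    \1_(`]0, e2]%classic) p.2 * ((H p - Q p.1) / p.2)) (p.2, p.1)).
  by apply/funext => p /=; rewrite [X in X * _]mulrC.
move=> /(_ (integrable_swap iLC)) /lim2_swap; apply: lim2_eq => M N M0 N0.
rewrite -[RHS]Rintegral_swap; last exact: rect_integrable.
by apply: eq_Rintegral => p _; rewrite /rect /=; ring.
Qed.

(** F is the function of bounded variation, defined pointwise; H is only equal to it
    almost everywhere but is measurable. *)
Let near_near H F e1 e2 V g : 0 < e1 -> 0 < e2 ->
  integrable2 H -> bv2 e1 e2 F V ->
  (fun p => F p.1 p.2) @ filter_prod 0^'+ 0^'+ --> g ->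
  {ae leb2 R, forall p : T2 R, H p = F p.1 p.2} ->
  lim2 (fun M N => \int[leb2 R]_p rect `]0, e1] `]0, e2] H M N p) (pi / 2 * (pi / 2 * g)).
Proof.
move=> e10 e20 iH hF hg aeF; apply: lim2_eq (bv2_dirk_lim2 e10 e20 hF hg) => M N M0 N0.
have ir : integrable2 (rect `]0, e1] `]0, e2] H M N).
  exact: rect_integrable.
rewrite (Rfubini_rect12 ir); apply: ae_Rintegral_congr_in.
apply: filterS (ae_sections aeF) => s aes; rewrite /= in_itv/= => /andP[s0 se].
have [_ iF _] := bv1_dirk e20 N0 (bv2_section hF s0 se).
rewrite -RintegralZr//; apply: ae_Rintegral_congr_in.
by apply: filterS aes => t -> _ /=; ring.
Qed.

Lemma quadrant_lim2 H F P Q e1 e2 V g : 0 < e1 -> 0 < e2 ->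
  integrable2 H ->
  integrable1 P -> integrable1 Q ->
  integrable2 (fun p => \1_(`]0, e1]%classic) p.1 *
    \1_(`]e2, +oo[%classic) p.2 * ((H p - P p.2) / p.1)) ->
  integrable2 (fun p => \1_(`]e1, +oo[%classic) p.1 *
    \1_(`]0, e2]%classic) p.2 * ((H p - Q p.1) / p.2)) ->
  bv2 e1 e2 F V -> (fun p => F p.1 p.2) @ filter_prod 0^'+ 0^'+ --> g ->
  {ae leb2 R, forall p : T2 R, H p = F p.1 p.2} ->
  lim2 (fun M N => \int[leb2 R]_p (\1_(`]0, +oo[%classic) p.1 * \1_(`]0, +oo[%classic) p.2 *
    (H p * dirk M p.1 * dirk N p.2))) (pi / 2 * (pi / 2 * g)).
Proof.
move=> e10 e20 iH iP iQ LC1 LC2 hF hg aeF.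
have nn := near_near e10 e20 iH hF hg aeF.
have nf := near_far e10 e20 iH iP LC1; have fn := far_near e10 e20 iH iQ LC2.
have ff := far_far e10 e20 iH.
have := lim2D (lim2D nn nf) (lim2D fn ff).
rewrite !addr0; apply: lim2_eq => M N M0 N0.
have ir A B : measurable A -> measurable B ->
  integrable2 (rect A B H M N) by move=> *; exact: rect_integrable.
have i11 := ir `]0, e1]%classic `]0, e2]%classic (measurable_itv _) (measurable_itv _).
have i12 := ir `]0, e1]%classic `]e2, +oo[%classic (measurable_itv _) (measurable_itv _).
have i21 := ir `]e1, +oo[%classic `]0, e2]%classic (measurable_itv _) (measurable_itv _).
have i22 := ir `]e1, +oo[%classic `]e2, +oo[%classic (measurable_itv _) (measurable_itv _).
rewrite -!RintegralD//; try exact: integrableDR.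
apply: eq_Rintegral => p _; rewrite /rect.
have split (e x : R) : 0 < e -> \1_(`]0, +oo[%classic) x =
    \1_(`]0, e]%classic) x + \1_(`]e, +oo[%classic) x :> R.
  move=> e0; rewrite !indicE !mem_setE !in_itv/= !andbT.
  by case: (ltP 0 x) => x0; case: (ltP e x) => ex; rewrite ?add0r ?addr0//=; lra.
by rewrite (split e1)// (split e2)//; ring.
Qed.

End Quadrant.

(** * From a rectangle around a point to its four quadrants *)

Section NetsOfPartitions.
Context {R : realType}.
Implicit Types (a b x y : R) (g : R * R -> R).

Lemma netsum_nth (rho : R -> R -> R) (d a : R) s :
  netsum rho (a :: s) =
  \sum_(0 <= i < size s) rho (nth d (a :: s) i) (nth d (a :: s) i.+1).
Proof.
elim: s a => [|y s IH] a; first by rewrite /= big_nil addr0.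
by rewrite [LHS]/= -/(netsum _ (y :: s)) IH /= big_nat_recl.
Qed.

Definition cnet a b (s : seq R) := sorted <%R s && all (fun x => a <= x <= b) s.

Lemma cnet_partition a b s : a < b -> cnet a b s ->
  exists2 s', itv_partition a b s' & subseq s (a :: s').
Proof.
move=> ab /andP[ss /allP hs]; pose s0 := [seq x <- s | a < x < b].
have s0s : sorted <%R s0 by rewrite sorted_filter//; exact: lt_trans.
have a0 : all (fun x => a < x < b) s0 by exact: filter_all.
have p : path <%R a (rcons s0 b).
  rewrite rcons_path; apply/andP; split.
    rewrite path_min_sorted//; apply/allP => x /(allP a0) /andP[] //.
  have := mem_last a s0; rewrite inE => /predU1P[->//|].
  by move=> /(allP a0) /andP[].
exists (rcons s0 b); first by rewrite /itv_partition p last_rcons eqxx.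
apply: sorted_lt_subseq => // x xs; have /andP[ax xb] := hs x xs.
rewrite inE mem_rcons inE mem_filter xs andbT.
by move: ax xb; rewrite !le_eqVlt => /predU1P[<-|->]; rewrite ?eqxx// => /predU1P[->|->];
  rewrite ?eqxx ?orbT.
Qed.

Lemma bounded_variation_cnet a b (phi : R -> R) : a < b -> bounded_variation a b phi ->
  exists C, forall s, cnet a b s -> netsum (fun x y => `|phi y - phi x|) s <= C.
Proof.
move=> ab [C hC]; exists C => s /(cnet_partition ab)[s' ps' ss'].
apply: le_trans (netsum_subseq (t := a :: s') _ _ ss') _ => //.
  by move=> x y z; rewrite [leRHS]addrC ler_distD.
rewrite (netsum_nth _ b); apply: hC; exists s' => //.
Qed.

Definition delta2 g x y u v := g (y, v) - g (y, u) - g (x, v) + g (x, u).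

Lemma BVF_cnet a1 b1 a2 b2 g : a1 < b1 -> a2 < b2 -> BVF a1 b1 a2 b2 g ->
  exists C, forall s t, cnet a1 b1 s -> cnet a2 b2 t ->
    netsum (fun x y => netsum (fun u v => `|delta2 g x y u v|) t) s <= C.
Proof.
move=> ab1 ab2 [[C hC] _ _]; exists C => s t.
move=> /(cnet_partition ab1)[s' ps' ss'] /(cnet_partition ab2)[t' pt' tt'].
have tri u v w x y : `|delta2 g x y u w| <= `|delta2 g x y u v| + `|delta2 g x y v w|.
  apply: le_trans (ler_normD _ _); rewrite le_eqVlt; apply/orP; left; apply/eqP.
  by congr (`|_|); rewrite /delta2; ring.
have tri' u v x y z : `|delta2 g x z u v| <= `|delta2 g x y u v| + `|delta2 g y z u v|.
  apply: le_trans (ler_normD _ _); rewrite le_eqVlt; apply/orP; left; apply/eqP.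
  by congr (`|_|); rewrite /delta2; ring.
apply: (@le_trans _ _ (netsum (fun x y => netsum (fun u v => `|delta2 g x y u v|) (a2 :: t')) s)).
  by apply: ler_netsum => x y _ _; apply: netsum_subseq.
apply: (@le_trans _ _ (netsum (fun x y => netsum (fun u v => `|delta2 g x y u v|) (a2 :: t')) (a1 :: s'))).
  apply: netsum_subseq => // [x y|x y z]; first exact: netsum_ge0.
  by rewrite -netsumD; apply: ler_netsum => u v _ _.
rewrite (netsum_nth _ b1); apply: le_trans (hC s' t' ps' pt').
rewrite /variation2; apply: ler_sum => i _.
by rewrite (netsum_nth _ b2).
Qed.

(** For sg = -1 the image is decreasing and has to be reversed. *)
Lemma net_image x0 e (sg : R) s : sg = 1 \/ sg = -1 -> net 0 e s ->
  exists2 s', cnet (x0 - e) (x0 + e) s' & forall rho : R -> R -> R,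
    (forall x y, rho x y = rho y x) ->
    netsum (fun x y => rho (x0 + sg * x) (x0 + sg * y)) s = netsum rho s'.
Proof.
move=> sgE /andP[ss /allP hs].
have bd x : x \in map (fun x => x0 + sg * x) s -> x0 - e <= x <= x0 + e.
  move=> /mapP[z /hs /andP[z0 ze] ->]; rewrite !lerD2l.
  by case: sgE => ->; rewrite ?mul1r ?mulN1r; lra.
case: sgE => E.
  exists (map (fun x => x0 + sg * x) s); last by move=> rho _; rewrite netsum_map.
  rewrite /cnet; apply/andP; split; last exact/allP.
  by apply: homo_sorted ss => x y; rewrite E !mul1r ltrD2l.
exists (rev (map (fun x => x0 + sg * x) s)); last first.
  by move=> rho rhoC; rewrite netsum_rev// netsum_map.
rewrite /cnet; apply/andP; split; last by apply/allP => x; rewrite mem_rev; exact: bd.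
rewrite rev_sorted; apply: homo_sorted ss => x y.
by rewrite E !mulN1r ltrD2l ltrN2.
Qed.

(** The definition of BVF provides one section of bounded variation in each
    direction; the mixed differences transfer this to any other section, in particular
    to those through the corner (e1, e2) of the quadrant, on which [bv2] is based. *)
Lemma BVF_bv2 x0 y0 e1 e2 sg tg g : 0 < e1 -> 0 < e2 -> sg = 1 \/ sg = -1 ->
  tg = 1 \/ tg = -1 -> BVF (x0 - e1) (x0 + e1) (y0 - e2) (y0 + e2) g ->
  exists V, bv2 e1 e2 (fun s t => g (x0 + sg * s, y0 + tg * t)) V.
Proof.
move=> e10 e20 sgE tgE h.
have ab1 : x0 - e1 < x0 + e1 by lra.
have ab2 : y0 - e2 < y0 + e2 by lra.
have [C hC] := BVF_cnet ab1 ab2 h.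
have [_ [s1 s1I /(bounded_variation_cnet ab2)[C1 hC1]] [t1 t1I /(bounded_variation_cnet ab1)[C2 hC2]]] := h.
have C0 : 0 <= C by exact: (hC [::] [::]).
have two a b x y : a <= x -> x <= b -> a <= y -> y <= b -> x != y ->
    exists z w, cnet a b [:: z; w] /\ ((z = x /\ w = y) \/ (z = y /\ w = x)).
  move=> ax xb ay yb; rewrite neq_lt => /orP[xy|yx].
    by exists x, y; split; [rewrite /cnet/= xy ax xb ay yb|left].
  by exists y, x; split; [rewrite /cnet/= yx ax xb ay yb|right].
have in1 x : 0 < x -> x <= e1 -> x0 - e1 <= x0 + sg * x <= x0 + e1.
  by move=> *; case: sgE => ->; lra.
have in2 x : 0 < x -> x <= e2 -> y0 - e2 <= y0 + tg * x <= y0 + e2.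
  by move=> *; case: tgE => ->; lra.
have symd x y u v : `|delta2 g x y u v| = `|delta2 g y x u v|.
  by rewrite -normrN; congr (`|_|); rewrite /delta2; ring.
have symd2 x y u v : `|delta2 g x y u v| = `|delta2 g x y v u|.
  by rewrite -normrN; congr (`|_|); rewrite /delta2; ring.
(* mixed differences on a net with only two points in one variable *)
have row x x' t : x0 - e1 <= x <= x0 + e1 -> x0 - e1 <= x' <= x0 + e1 ->
    cnet (y0 - e2) (y0 + e2) t -> netsum (fun u v => `|delta2 g x x' u v|) t <= C.
  move=> /andP[? ?] /andP[? ?] nt; have [<-|xx'] := eqVneq x x'.
    rewrite (eq_netsum t (rho' := fun _ _ => 0 * 0)); last first.
      by move=> u v; rewrite mul0r; apply/eqP; rewrite normr_eq0; apply/eqP; rewrite /delta2; ring.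
    by rewrite netsumZ mul0r.
  have [|||||z [w [nz zw]]] := two (x0 - e1) (x0 + e1) x x' => //.
  apply: le_trans (hC _ _ nz nt); rewrite /= !addr0.
  case: zw => -[-> ->] //.
  by rewrite le_eqVlt; apply/orP; left; apply/eqP; apply: eq_netsum.
have col u u' s : y0 - e2 <= u <= y0 + e2 -> y0 - e2 <= u' <= y0 + e2 ->
    cnet (x0 - e1) (x0 + e1) s -> netsum (fun x y => `|delta2 g x y u u'|) s <= C.
  move=> /andP[? ?] /andP[? ?] ns; have [<-|uu'] := eqVneq u u'.
    rewrite (eq_netsum s (rho' := fun _ _ => 0 * 0)); last first.
      by move=> x y; rewrite mul0r; apply/eqP; rewrite normr_eq0; apply/eqP; rewrite /delta2; ring.
    by rewrite netsumZ mul0r.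
  have [|||||z [w [nz zw]]] := two (y0 - e2) (y0 + e2) u u' => //.
  apply: le_trans (hC _ _ ns nz); rewrite le_eqVlt; apply/orP; left; apply/eqP.
  by apply: eq_netsum => x y; rewrite /= !addr0; case: zw => -[-> ->].
have s1' : x0 - e1 <= s1 <= x0 + e1 by move: s1I; rewrite in_itv.
have t1' : y0 - e2 <= t1 <= y0 + e2 by move: t1I; rewrite in_itv.
have rowE t : cnet (y0 - e2) (y0 + e2) t ->
    netsum (fun u v => `|g (x0 + sg * e1, v) - g (x0 + sg * e1, u)|) t <= C1 + C.
  move=> nt; apply: le_trans (lerD (hC1 t nt) (row s1 (x0 + sg * e1) t s1' (in1 e1 e10 (lexx _)) nt)).
  rewrite -netsumD; apply: ler_netsum => u v _ _.
  apply: le_trans (ler_normD _ _); rewrite le_eqVlt; apply/orP; left; apply/eqP.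
  by congr (`|_|); rewrite /delta2; ring.
have colE s : cnet (x0 - e1) (x0 + e1) s ->
    netsum (fun x y => `|g (y, y0 + tg * e2) - g (x, y0 + tg * e2)|) s <= C2 + C.
  move=> ns; apply: le_trans (lerD (hC2 s ns) (col t1 (y0 + tg * e2) s t1' (in2 e2 e20 (lexx _)) ns)).
  rewrite -netsumD; apply: ler_netsum => x y _ _.
  apply: le_trans (ler_normD _ _); rewrite le_eqVlt; apply/orP; left; apply/eqP.
  by congr (`|_|); rewrite /delta2; ring.
exists (`|g (x0 + sg * e1, y0 + tg * e2)| + (C1 + C) + ((C2 + C) + C)) => s t ns nt.
have [s' cs' hs'] := net_image x0 sgE ns; have [t' ct' ht'] := net_image y0 tgE nt.
rewrite {1}/nv; apply: lerD; first apply: lerD => //.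
  rewrite (ht' (fun u v => `|g (x0 + sg * e1, v) - g (x0 + sg * e1, u)|)); first exact: rowE.
  by move=> u v; rewrite distrC.
rewrite netsumD; apply: lerD.
  rewrite (hs' (fun x y => `|g (y, y0 + tg * e2) - g (x, y0 + tg * e2)|)); first exact: colE.
  by move=> x y; rewrite distrC.
have -> : netsum (fun x y => netsum (fun u v =>
    `|((fun t => g (x0 + sg * y, y0 + tg * t)) \- (fun t => g (x0 + sg * x, y0 + tg * t))) v -
      ((fun t => g (x0 + sg * y, y0 + tg * t)) \- (fun t => g (x0 + sg * x, y0 + tg * t))) u|) t) s =
  netsum (fun x y => netsum (fun u v => `|delta2 g x y u v|) t') s'.
  rewrite -(hs' (fun x y => netsum (fun u v => `|delta2 g x y u v|) t')); last first.
    by move=> x y; apply: eq_netsum => u v.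
  apply: eq_netsum => x y.
  rewrite -(ht' (fun u v => `|delta2 g (x0 + sg * x) (x0 + sg * y) u v|)); last first.
    by move=> u v.
  by apply: eq_netsum => u v; congr (`|_|); rewrite /delta2 /=; ring.
exact: hC.
Qed.

End NetsOfPartitions.

Section MeasurePreserving.
Context d (T : measurableType d) {R : realType}.
Variable mu : {measure set T -> \bar R}.
Variable phi : T -> T.
Hypothesis mphi : measurable_fun setT phi.
Hypothesis phiK : forall A, measurable A -> mu (phi @^-1` A) = mu A.

Lemma preserving_ae (P : T -> Prop) : {ae mu, forall x, P x} -> {ae mu, forall x, P (phi x)}.
Proof.
move=> [N [mN N0 PN]]; exists (phi @^-1` N); split.
- by rewrite -[X in measurable X]setTI; exact: mphi.
- by rewrite phiK.
- by move=> x /= nP; exact: PN.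
Qed.

Lemma preserving_integrable (f : T -> R) : mu.-integrable setT (EFin \o f) ->
  mu.-integrable setT (EFin \o (fun x => f (phi x))).
Proof.
move=> h; have mf := measurable_int _ h; apply/integrableP; split.
  exact: measurableT_comp mf mphi.
have mnf : measurable_fun setT (fun x => `|(EFin \o f) x|%E) by exact: measurableT_comp.
have e := ge0_integral_pushforward mphi mu measurableT mnf (fun x _ => abse_ge0 _).
rewrite preimage_setT in e; rewrite -e.
rewrite (_ : (\int[_]_(y in _) _ = \int[mu]_y `|(EFin \o f) y|)%E).
  by case/integrableP : h.
by apply: eq_measure_integral => A mA _; exact: phiK.
Qed.

Lemma preserving_Rintegral (f : T -> R) : mu.-integrable setT (EFin \o f) ->
  \int[mu]_x f (phi x) = \int[mu]_x f x.
Proof.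
move=> h; have mf := measurable_int _ h; congr fine.
have e := integral_pushforward mphi mf (preserving_integrable h) measurableT.
rewrite preimage_setT in e; rewrite -[LHS]e.
by apply: eq_measure_integral => A mA _; exact: phiK.
Qed.

End MeasurePreserving.

Section Reflections.
Context {R : realType}.
Implicit Types (x y sg tg : R).

Definition refl x sg (s : measurableTypeR R) : measurableTypeR R := x + sg * s.

Lemma measurable_refl x sg : measurable_fun setT (refl x sg).
Proof.
apply: measurable_funD; first exact: measurable_cst.
by apply: measurable_funM; first exact: measurable_cst.
Qed.

Lemma leb_refl x sg A : sg = 1 \/ sg = -1 -> measurable A ->
  leb (refl x sg @^-1` A) = leb A.
Proof.
move=> sgE mA.
apply/esym; apply: (@lebesgue_measure_unique R (pushforward leb (refl x sg))) => //.
  exact: measurable_refl.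
move=> ? _ [[a b] _ <-]; rewrite /pushforward /=.
case: sgE => E.
  rewrite [X in _ = leb X](_ : _ = `]a - x, b - x]%classic); last first.
    by apply/seteqP; split => s; rewrite /= !in_itv/= /refl E mul1r => /andP[? ?];
      apply/andP; split; lra.
  by rewrite !lebesgue_measure_itv/= !lte_fin ltrD2r; case: ifP => // _;
    rewrite -!EFinB; congr EFin; ring.
rewrite [X in _ = leb X](_ : _ = `[x - b, x - a[%classic); last first.
  by apply/seteqP; split => s; rewrite /= !in_itv/= /refl E mulN1r => /andP[? ?];
    apply/andP; split; lra.
by rewrite !lebesgue_measure_itv/= !lte_fin ltrD2l ltrN2; case: ifP => // _;
  rewrite -!EFinB; congr EFin; ring.
Qed.

Definition refl2 x sg y tg (p : T2 R) : T2 R := (refl x sg p.1, refl y tg p.2).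

Lemma measurable_refl2 x sg y tg : measurable_fun setT (refl2 x sg y tg).
Proof.
apply/measurable_fun_pairP; split.
  exact: (measurableT_comp (measurable_refl x sg) measurable_fst).
exact: (measurableT_comp (measurable_refl y tg) measurable_snd).
Qed.

Lemma leb2_refl2 x sg y tg A : sg = 1 \/ sg = -1 -> tg = 1 \/ tg = -1 -> measurable A ->
  leb2 R (refl2 x sg y tg @^-1` A) = leb2 R A.
Proof.
move=> sgE tgE mA; apply/esym.
apply: (@product_measure_unique _ _ _ _ R leb leb (pushforward (leb2 R) (refl2 x sg y tg))) => //.
  exact: measurable_refl2.
move=> ? B C mB mC; rewrite /pushforward.
transitivity (leb2 R ((refl x sg @^-1` B) `*` (refl y tg @^-1` C))); first by [].
rewrite [LHS]product_measure1E//; last 2 first.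
- by rewrite -[X in measurable X]setTI; exact: measurable_refl.
- by rewrite -[X in measurable X]setTI; exact: measurable_refl.
by congr (_ * _)%E; exact: leb_refl.
Qed.

Definition swap2 (p : T2 R) : T2 R := (p.2, p.1).

Lemma measurable_swap2 : measurable_fun setT swap2.
Proof. by apply/measurable_fun_pairP; split; [exact: measurable_snd|exact: measurable_fst]. Qed.

Lemma leb2_swap2 A : measurable A -> leb2 R (swap2 @^-1` A) = leb2 R A.
Proof.
move=> mA; apply/esym.
apply: (@product_measure_unique _ _ _ _ R leb leb (pushforward (leb2 R) swap2)) => //.
  exact: measurable_swap2.
move=> ? B C mB mC; rewrite /pushforward.
transitivity (leb2 R (C `*` B)).
  by congr (leb2 R _); apply/seteqP; split => p [].
by rewrite [LHS]product_measure1E// muleC.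
Qed.

Lemma ae_sections2 (P : T2 R -> Prop) : {ae leb2 R, forall p, P p} ->
  {ae leb, forall t, {ae leb, forall s, P (s, t)}}.
Proof.
by move=> /(preserving_ae measurable_swap2 leb2_swap2) /(ae_sections (P := fun p => P (swap2 p))).
Qed.

Lemma ae_off_axes x y : {ae leb2 R, forall p : T2 R, p.1 != x /\ p.2 != y}.
Proof.
have n1 : (leb2 R).-negligible ([set x] `*` setT).
  exists ([set x] `*` setT); split => //; first exact: measurableX.
  rewrite [LHS]product_measure1E// [X in (X * _)%E](_ : _ = 0%E) ?mul0e//.
  exact: lebesgue_measure_set1.
have n2 : (leb2 R).-negligible (setT `*` [set y]).
  exists (setT `*` [set y]); split => //; first exact: measurableX.
  rewrite [LHS]product_measure1E// [X in (_ * X)%E](_ : _ = 0%E) ?mule0//.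
  exact: lebesgue_measure_set1.
have := negligibleU n1 n2; apply: negligibleS => p /= h.
have [->|p1] := eqVneq p.1 x; first by left.
have [->|p2] := eqVneq p.2 y; first by right.
by exfalso; exact: h.
Qed.

(** Each open quadrant at (x, y) is mapped to the first one by a reflection, which
    preserves the measure; the axes are a null set. *)
Lemma fold_plane (g : R * R -> R) x y : integrable2 g ->
  let P : set (measurableTypeR R) := `]0, +oo[%classic in
  let gs (sg tg : R) (p : R * R) := g (x + sg * p.1, y + tg * p.2) in
  \int[leb2 R]_p g p = \int[leb2 R]_p (\1_P p.1 * \1_P p.2 *
    (gs (-1) (-1) p + gs 1 1 p + gs (-1) 1 p + gs 1 (-1) p)).
Proof.
move=> ig P gs.
pose Q (sg z s : R) : R := \1_P (sg * (s - z)).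
have mQ sg z : measurable_fun setT (Q sg z).
  apply: measurableT_comp; first by rewrite /P; exact: measurable_indic.
  apply: measurable_funM; first exact: measurable_cst.
  by apply: measurable_funB.
pose G sg tg (p : R * R) := Q sg x p.1 * Q tg y p.2 * g p.
have iG sg tg : integrable2 (G sg tg).
  apply: (integrable_bmul (C := 1 * 1)) => //.
    by apply: measurable_funM; [exact: (measurable_fun_fst (mQ sg x))|exact: (measurable_fun_snd (mQ tg y))].
  by move=> p _; rewrite normrM ler_pM// indicator_bound.
have -> : \int[leb2 R]_p g p =
    \int[leb2 R]_p (G (-1) (-1) p + G 1 1 p + G (-1) 1 p + G 1 (-1) p).
  apply: ae_Rintegral_congr; apply: filterS (ae_off_axes x y) => p [p1 p2] _.
  have QE z s : s != z -> Q (-1) z s + Q 1 z s = 1.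
    rewrite /Q !indicE !mem_setE !in_itv/= !andbT mulN1r mul1r oppr_gt0 subr_lt0 subr_gt0.
    by case: (ltgtP s z) => //; rewrite ?add0r ?addr0.
  transitivity ((Q (-1) x p.1 + Q 1 x p.1) * (Q (-1) y p.2 + Q 1 y p.2) * g p).
    by rewrite !QE// !mul1r.
  by rewrite /G; ring.
have E sg tg : sg = 1 \/ sg = -1 -> tg = 1 \/ tg = -1 ->
    integrable2 (fun p => \1_P p.1 * \1_P p.2 * gs sg tg p) /\
    \int[leb2 R]_p G sg tg p = \int[leb2 R]_p (\1_P p.1 * \1_P p.2 * gs sg tg p).
  move=> sgE tgE.
  have e : (fun p => \1_P p.1 * \1_P p.2 * gs sg tg p) = (fun p => G sg tg (refl2 x sg y tg p)).
    apply/funext => p; rewrite /G /gs /refl2 /refl /Q /=.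
    have q (z s r : R) : r = 1 \/ r = -1 -> r * (z + r * s - z) = s.
      by case=> ->; ring.
    by rewrite !q.
  have m := measurable_refl2 x sg y tg.
  have k A := @leb2_refl2 x sg y tg A sgE tgE.
  split; first by rewrite e; exact: (preserving_integrable m k (iG sg tg)).
  by rewrite e (preserving_Rintegral m k (iG sg tg)).
have [i1 e1] := E (-1) (-1) (or_intror erefl) (or_intror erefl).
have [i2 e2] := E 1 1 (or_introl erefl) (or_introl erefl).
have [i3 e3] := E (-1) 1 (or_intror erefl) (or_introl erefl).
have [i4 e4] := E 1 (-1) (or_introl erefl) (or_intror erefl).
rewrite !RintegralD//; try (do ?[exact: integrableDR | apply: integrableDR => //]).
rewrite e1 e2 e3 e4 -!RintegralD//; try (do ?[exact: integrableDR | apply: integrableDR => //]).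
by apply: eq_Rintegral => p _; ring.
Qed.

End Reflections.

(** * Quaternions and the kernels by coordinates *)

Section Quaternions.
Context {R : realType}.
Implicit Types (p q r : quat R) (c : R) (n : nat).

(** The coordinates indexed by a number, so that one proof serves for all four. *)
Definition qc n q : R :=
  match n with 0%N => qr q | 1%N => qi q | 2%N => qj q | _ => qk q end.

Lemma qc_ext p q : (forall n, qc n p = qc n q) -> p = q.
Proof.
case: p q => [a b c d] [a' b' c' d'] h.
by have := h 0%N; have := h 1%N; have := h 2%N; have := h 3%N => /= -> -> -> ->.
Qed.

Lemma qcD n p q : qc n (p + q) = qc n p + qc n q.
Proof. by case: n => [|[|[|n]]]. Qed.
Lemma qcN n p : qc n (- p) = - qc n p.
Proof. by case: n => [|[|[|n]]]. Qed.
Lemma qcB n p q : qc n (p - q) = qc n p - qc n q.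
Proof. by rewrite qcD qcN. Qed.
Lemma qcZ n c q : qc n (c *: q) = c * qc n q.
Proof. by case: n => [|[|[|n]]]. Qed.

Lemma scaleqAl c p q : (c *: p) * q = c *: (p * q).
Proof. by congr Quat; rewrite /=; ring. Qed.
Lemma scaleqAr c p q : p * (c *: q) = c *: (p * q).
Proof. by congr Quat; rewrite /=; ring. Qed.

Lemma sqr_qnorm_ge0 q : 0 <= sqr_qnorm q.
Proof. by rewrite !addr_ge0// sqr_ge0. Qed.

Lemma qnormM p q : qnorm (p * q) = qnorm p * qnorm q.
Proof.
rewrite /qnorm -sqrtrM ?sqr_qnorm_ge0//; congr Num.sqrt.
by rewrite /sqr_qnorm /=; ring.
Qed.

Lemma ler_qc_qnorm n q : `|qc n q| <= qnorm q.
Proof.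
rewrite -sqrtr_sqr ler_wsqrtr// /sqr_qnorm.
have := sqr_ge0 (qr q); have := sqr_ge0 (qi q); have := sqr_ge0 (qj q); have := sqr_ge0 (qk q).
by case: n => [|[|[|n]]] /=; lra.
Qed.

Lemma ler_qnorm_qc q : qnorm q <= \sum_(n < 4) `|qc n q|.
Proof.
rewrite !big_ord_recr big_ord0 /= add0r.
rewrite -[leRHS]ger0_norm ?addr_ge0// -sqrtr_sqr ler_wsqrtr// /sqr_qnorm.
rewrite -(real_normK (num_real (qr q))) -(real_normK (num_real (qi q))).
rewrite -(real_normK (num_real (qj q))) -(real_normK (num_real (qk q))).
have := normr_ge0 (qr q); have := normr_ge0 (qi q).
have := normr_ge0 (qj q); have := normr_ge0 (qk q).
by nra.
Qed.

Lemma qexpD (mu : quat R) (a b : R) : mu = iq \/ mu = jq ->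
  qexp mu (a + b) = qexp mu a * qexp mu b.
Proof. by case=> ->; rewrite /qexp cosD sinD; congr Quat => /=; ring. Qed.

Lemma qexp0 (mu : quat R) : qexp mu 0 = 1.
Proof. by rewrite /qexp cos0 sin0 scale1r scale0r addr0. Qed.

Lemma qnorm_qexp (mu : quat R) (a : R) : mu = iq \/ mu = jq -> qnorm (qexp mu a) = 1.
Proof.
move=> muE; rewrite /qnorm -[RHS](@sqrtr1 R); congr Num.sqrt; rewrite -(cos2Dsin2 a).
by case: muE => ->; rewrite /sqr_qnorm /=; ring.
Qed.

(** The factor 1 / sqrt(mu 2 pi b) becomes a scalar and a constant phase, which commutes
    with the exponential of the same unit mu. *)
Lemma lct_kernelE (mu : quat R) (A : 'M[R]_2) (x y : R) : mu = iq \/ mu = jq -> A 0 1 != 0 ->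
  lct_kernel mu A x y = (Num.sqrt (2 * pi * `|A 0 1|))^-1 *:
    qexp mu (A 0 0 / (2 * A 0 1) * x ^+ 2 - (A 0 1)^-1 * (x * y) +
      A 1 1 / (2 * A 0 1) * y ^+ 2 - Num.sg (A 0 1) * pi / 4).
Proof.
move=> muE b0; rewrite /lct_kernel /=; set th := _ + _ * y ^+ 2.
set k := Num.sqrt _; set a := Num.sg _ * _ / _.
have k0 : k != 0.
  by rewrite /k gt_eqF// sqrtr_gt0 !mulr_gt0 ?pi_gt0 ?normr_gt0.
have e1 : qsqrt2pi mu (A 0 1) * (k^-1 *: qexp mu (- a)) = 1.
  rewrite /qsqrt2pi -/k -/a scaleqAl scaleqAr scalerA divff// scale1r -qexpD//.
  by rewrite subrr qexp0.
have e2 : (k^-1 *: qexp mu (- a)) * qsqrt2pi mu (A 0 1) = 1.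
  rewrite /qsqrt2pi -/k -/a scaleqAl scaleqAr scalerA mulVf// scale1r -qexpD//.
  by rewrite addNr qexp0.
have u : qsqrt2pi mu (A 0 1) \is a GRing.unit by apply/unitrP; eexists; split; [exact: e2|exact: e1].
have -> : (qsqrt2pi mu (A 0 1))^-1 = k^-1 *: qexp mu (- a).
  by rewrite -[LHS]mulr1 -e1 mulKr.
by rewrite scaleqAl -qexpD// addrC.
Qed.

Lemma invmx2E (A : 'M[R]_2) : \det A = 1 ->
  [/\ invmx A 0 0 = A 1 1, invmx A 0 1 = - A 0 1 & invmx A 1 1 = A 0 0].
Proof.
move=> dA.
have -> : invmx A = \adj A.
  by rewrite -[LHS]mulmx1 -(_ : A *m \adj A = 1%:M) ?mulKmx ?unitmxE ?dA ?unitr1// mul_mx_adj dA.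
have l0 : lift 0 0 = 1 :> 'I_2 by exact/val_inj.
have l1 : lift 1 0 = 0 :> 'I_2 by exact/val_inj.
rewrite !mxE /cofactor !det_mx11 !mxE !l0 !l1 /=.
by split; rewrite -signr_odd /= ?expr0 ?expr1 ?mul1r ?mulN1r.
Qed.

End Quaternions.

Section QuaternionIntegral.
Context d (T : measurableType d) {R : realType}.
Variable m : {measure set T -> \bar R}.
Implicit Types (D : set T) (g h E : T -> quat R).

Definition qintegrable D g := forall n, m.-integrable D (EFin \o (fun x => qc n (g x))).

Definition qbounded D E := forall n, measurable_fun D (fun x => qc n (E x)) /\
  exists C : R, forall x, D x -> `|qc n (E x)| <= C.

Lemma qc_qintegral n D g : qc n (qintegral m D g) = \int[m]_(x in D) qc n (g x).
Proof. by case: n => [|[|[|n]]]. Qed.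

Let coord4 D (g0 g1 g2 g3 : T -> R) (c0 c1 c2 c3 : R) : measurable D ->
  m.-integrable D (EFin \o g0) -> m.-integrable D (EFin \o g1) ->
  m.-integrable D (EFin \o g2) -> m.-integrable D (EFin \o g3) ->
  m.-integrable D (EFin \o (fun x => c0 * g0 x + c1 * g1 x + c2 * g2 x + c3 * g3 x)) /\
  \int[m]_(x in D) (c0 * g0 x + c1 * g1 x + c2 * g2 x + c3 * g3 x) =
    c0 * (\int[m]_(x in D) g0 x) + c1 * (\int[m]_(x in D) g1 x) +
    c2 * (\int[m]_(x in D) g2 x) + c3 * (\int[m]_(x in D) g3 x).
Proof.
move=> mD i0 i1 i2 i3.
have z (c : R) (g : T -> R) : m.-integrable D (EFin \o g) -> m.-integrable D (EFin \o (fun x => c * g x)).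
  exact: integrableZR.
split; first by do !(apply: integrableDR => //); exact: z.
rewrite RintegralD//; last exact: z; last first.
  by do !(apply: integrableDR => //); exact: z.
rewrite RintegralD//; last exact: z; last first.
  by do !(apply: integrableDR => //); exact: z.
by rewrite RintegralD ?RintegralZl//; exact: z.
Qed.

Lemma qc_mul n (a b : quat R) : exists c0 c1 c2 c3 : R, forall q,
  qc n (a * q * b) = c0 * qc 0 q + c1 * qc 1 q + c2 * qc 2 q + c3 * qc 3 q.
Proof.
exists (qc n (a * b)), (qc n (a * iq * b)), (qc n (a * jq * b)), (qc n (a * kq * b)) => q.
by case: n => [|[|[|n]]] /=; ring.
Qed.

(** Two-sided multiplication by constants is linear over the reals, although the
    quaternions do not commute. *)
Lemma qintegral_mul D g (a b : quat R) : measurable D -> qintegrable D g ->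
  qintegral m D (fun x => a * g x * b) = a * qintegral m D g * b.
Proof.
move=> mD ig; apply: qc_ext => n; have [c0 [c1 [c2 [c3 h]]]] := qc_mul n a b.
rewrite h !qc_qintegral; under eq_Rintegral do rewrite h.
by have [_ ->] := coord4 c0 c1 c2 c3 mD (ig 0%N) (ig 1%N) (ig 2%N) (ig 3%N).
Qed.

Lemma qbounded_cst D (a : quat R) : qbounded D (fun=> a).
Proof. by move=> n; split; [exact: measurable_cst|exists `|qc n a|]. Qed.

Lemma qintegrable_mull D E g : measurable D -> qbounded D E -> qintegrable D g ->
  qintegrable D (fun x => E x * g x).
Proof.
move=> mD hE hg.
have pr i j : m.-integrable D (EFin \o (fun x => qc i (E x) * qc j (g x))).
  by have [mE [C hC]] := hE i; exact: (integrable_bmul mD mE hC (hg j)).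
move=> n; case: n => [|[|[|n]]] /=.
- apply: integrableBR (pr 3%N 3%N) => //; apply: integrableBR (pr 2%N 2%N) => //.
  by apply: integrableBR (pr 1%N 1%N) => //; exact: (pr 0%N 0%N).
- apply: integrableBR (pr 3%N 2%N) => //; apply: integrableDR (pr 2%N 3%N) => //.
  by apply: integrableDR (pr 1%N 0%N) => //; exact: (pr 0%N 1%N).
- apply: integrableDR (pr 3%N 1%N) => //; apply: integrableDR (pr 2%N 0%N) => //.
  by apply: integrableBR (pr 1%N 3%N) => //; exact: (pr 0%N 2%N).
- apply: integrableDR (pr 3%N 0%N) => //; apply: integrableBR (pr 2%N 1%N) => //.
  by apply: integrableDR (pr 1%N 2%N) => //; exact: (pr 0%N 3%N).
Qed.

Lemma qintegrable_mulr D E g : measurable D -> qbounded D E -> qintegrable D g ->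
  qintegrable D (fun x => g x * E x).
Proof.
move=> mD hE hg.
have pr i j : m.-integrable D (EFin \o (fun x => qc i (g x) * qc j (E x))).
  by have [mE [C hC]] := hE j; exact: (integrable_bmulr mD mE hC (hg i)).
move=> n; case: n => [|[|[|n]]] /=.
- apply: integrableBR (pr 3%N 3%N) => //; apply: integrableBR (pr 2%N 2%N) => //.
  by apply: integrableBR (pr 1%N 1%N) => //; exact: (pr 0%N 0%N).
- apply: integrableBR (pr 3%N 2%N) => //; apply: integrableDR (pr 2%N 3%N) => //.
  by apply: integrableDR (pr 1%N 0%N) => //; exact: (pr 0%N 1%N).
- apply: integrableDR (pr 3%N 1%N) => //; apply: integrableDR (pr 2%N 0%N) => //.
  by apply: integrableBR (pr 1%N 3%N) => //; exact: (pr 0%N 2%N).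
- apply: integrableDR (pr 3%N 0%N) => //; apply: integrableBR (pr 2%N 1%N) => //.
  by apply: integrableDR (pr 1%N 2%N) => //; exact: (pr 0%N 3%N).
Qed.

End QuaternionIntegral.

(** * The truncated inversion integral *)

Section ParametricFubini.
Context d (T : measurableType d) {R : realType}.
Variable m : {sigma_finite_measure set T -> \bar R}.
Variables (D : set (measurableTypeR R)) (X : measurableTypeR R * T -> R) (g : T -> R) (C : R).
Hypotheses (mD : measurable D) (iD : leb.-integrable D (EFin \o cst (1 : R))).
Hypotheses (mX : measurable_fun setT X) (X_C : forall z, `|X z| <= C).
Hypothesis ig : m.-integrable setT (EFin \o g).

Let f (z : measurableTypeR R * T) : R := \1_D z.1 * (X z * g z.2).

Let mg : measurable_fun setT g.
Proof. by apply/measurable_EFinP; exact: measurable_int ig. Qed.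

Let mf : measurable_fun setT f.
Proof.
have mI : measurable_fun [set: measurableTypeR R] (\1_D : R -> R) by exact: measurable_indic.
apply: measurable_funM; first exact: (measurableT_comp mI measurable_fst).
by apply: measurable_funM => //; exact: (measurableT_comp mg measurable_snd).
Qed.

Let isec u : m.-integrable setT (EFin \o (fun x => X (u, x) * g x)).
Proof.
apply: (integrable_bmul measurableT _ (fun x _ => X_C (u, x)) ig).
exact: (measurableT_comp mX (measurable_pair1 u)).
Qed.

Let iX x : leb.-integrable D (EFin \o (fun u => X (u, x))).
Proof.
have mX2 : measurable_fun D (fun u : measurableTypeR R => X (u, x)).
  by apply: measurable_funTS; exact: (measurableT_comp mX (measurable_pair2 x)).
have := integrable_bmul mD mX2 (fun u _ => X_C (u, x)) iD.
by apply: eq_integrable => // u _ /=; rewrite mulr1.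
Qed.

Let itsec u : m.-integrable setT (EFin \o (fun x => f (u, x))).
Proof. exact: (integrableZR (\1_D u : R) measurableT (isec u)). Qed.

Let iusec x : integrable1 (fun u => f (u, x)).
Proof.
have := integrable_indicM mD (integrableZR (g x) mD (iX x)).
by apply: eq_integrable => // u _ /=; rewrite /f /= (mulrC (g x)).
Qed.

Let intf : ((leb : {sigma_finite_measure set _ -> \bar R}) \x m)%E.-integrable setT (EFin \o f).
Proof.
apply/(integrable12ltyP leb m); first exact/measurable_EFinP.
pose k := \int[m]_x `|g x|.
have igC : m.-integrable setT (EFin \o (fun x => C * `|g x|)).
  by apply: integrableZR => //; exact: integrable_norm.
have iI : integrable1 (fun u => \1_D u * (C * k) * 1).
  have := integrable_indicM mD (integrableZR (C * k) mD iD).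
  by apply: eq_integrable => // u _ /=; rewrite mulrA.
apply: (@le_lt_trans _ _ (\int[leb]_u ((\1_D u : R) * (C * k) * 1)%:E)%E); last first.
  by apply: le_lt_trans (integrable_lty measurableT iI).
apply: ge0_le_integral => //=.
- by move=> u _; exact: integral_ge0.
- apply: (measurable_fun_fubini_tonelli_F (m2 := m) (fun p : measurableTypeR R * T => (`|f p|)%:E)) => //=.
  by apply/measurable_EFinP; exact: measurableT_comp.
- exact: measurable_int iI.
move=> u _; have iN := integrable_norm (itsec u).
have -> : (\int[m]_x (`|f (u, x)|)%:E = (\int[m]_x `|f (u, x)|)%:E)%E.
  by rewrite /Rintegral fineK//; exact: integrable_fin_num.
have -> : \1_D u * (C * k) * 1 = \int[m]_x (\1_D u * (C * `|g x|)).
  rewrite mulr1 RintegralZl// /k RintegralZl//; exact: integrable_norm.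
rewrite lee_fin; apply: le_Rintegral => //; first exact: (integrableZR (\1_D u : R) measurableT igC).
move=> x _; rewrite /f /= !normrM [`|\1_D u|]ger0_norm//.
by apply: ler_wpM2l => //; rewrite ler_wpM2r.
Qed.

Lemma integrable_param : leb.-integrable D (EFin \o (fun u => \int[m]_x (X (u, x) * g x))).
Proof.
have := integrable_fubini_F intf.
move=> /(integrableS measurableT mD (@subsetT _ _)).
apply: eq_integrable => // u Du; rewrite /fubini_F /= fineK; last exact: (integrable_fin_num measurableT (isec u)).
by apply: eq_integral => x _; rewrite /f /= indicE Du mul1r.
Qed.

Lemma integrable_param2 : m.-integrable setT
  (EFin \o (fun x => (\int[leb]_(u in D) X (u, x)) * g x)).
Proof.
have e x : fine (fubini_G leb (EFin \o f) x) = (\int[leb]_(u in D) X (u, x)) * g x.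
  by rewrite -RintegralZr// -Rintegral_indic.
have igC : m.-integrable setT (EFin \o (fun x => (\int[leb]_(u in D) C) * `|g x|)).
  by apply: integrableZR => //; exact: integrable_norm.
apply: (le_integrableR measurableT _ _ igC) => [|x _].
  under eq_fun do rewrite -e.
  by apply: measurableT_comp => //; exact: (measurable_fubini_G intf).
rewrite normrM ler_wpM2r// le_Rintegral_norm//.
have := integrableZR C mD iD.
by apply: eq_integrable => // u _ /=; rewrite mulr1.
Qed.

Lemma Rintegral_param : \int[leb]_(u in D) \int[m]_x (X (u, x) * g x) =
  \int[m]_x ((\int[leb]_(u in D) X (u, x)) * g x).
Proof.
rewrite -Rintegral_indic.
have -> : \int[leb]_u (\1_D u * \int[m]_x (X (u, x) * g x)) = \int[leb]_u \int[m]_x f (u, x).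
  by apply: eq_Rintegral => u _; rewrite /f /= RintegralZl.
have -> : \int[m]_x ((\int[leb]_(u in D) X (u, x)) * g x) = \int[m]_x \int[leb]_u f (u, x).
  apply: eq_Rintegral => x _; rewrite -RintegralZr//.
  by rewrite -Rintegral_indic.
have fu u : (\int[m]_x f (u, x))%:E = (\int[m]_x (f (u, x))%:E)%E.
  by rewrite fineK//; exact: (integrable_fin_num measurableT (itsec u)).
have fx x : (\int[leb]_u f (u, x))%:E = (\int[leb]_u (f (u, x))%:E)%E.
  by rewrite fineK//; exact: (integrable_fin_num measurableT (iusec x)).
rewrite /Rintegral; congr fine; under eq_integral do rewrite fu.
by under [RHS]eq_integral do rewrite fx; exact: (Fubini intf).
Qed.

End ParametricFubini.

Section TruncatedInversion.
Context {R : realType}.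


Import lebesgue_integral_fubini.
(* The plane measure as a sigma-finite measure, as Fubini's theorem on R * (R * R)
   requires. *)
Let lebs : {sigma_finite_measure set _ -> \bar R} := leb.
Let leb2s : {sigma_finite_measure set (T2 R) -> \bar R} := HB.pack (Measure.sort (leb2 R))
  (measure_function_Measure_isSigmaFinite__to__measure_function_isSFinite lebs lebs)
  (measure_function_Measure_isSigmaFinite__to__measure_function_isSigmaFinite lebs lebs).

Let integrable_cst1 (M : R) : leb.-integrable `[- M, M] (EFin \o cst (1 : R)).
Proof.
by apply: continuous_compact_integrable; [exact: segment_compact|
  apply: continuous_subspaceT => x; exact: cst_continuous].
Qed.

Lemma integral_cos_sym (k M a : R) : 0 < k -> 0 < M -> a != 0 ->
  \int[leb]_(u in `[- M, M]) cos (k * u * a) = 2 / k * dirk (k * M) a.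
Proof.
move=> k0 M0 a0.
have ka : k * a != 0 by rewrite mulf_neq0// gt_eqF.
have cf : continuous (fun u : R => cos (k * u * a)).
  move=> u; apply: continuous_comp; last exact: continuous_cos.
  by apply: cvgMr_tmp; apply: cvgMl_tmp; exact: cvg_id.
have MM : - M <= M by rewrite ge0_cp// ltW.
rewrite -Rintegral_itv_obnd_cbnd; last exact: continuous_itv_integrable.
have dF (x : R) : is_derive x (1 : R) ((k * a)^-1 *: (sin \o ( *%R (k * a)))) (cos (k * x * a)).
  have d1 := is_derive_mull (k * a) x.
  by apply: is_derive_eq; rewrite /GRing.scale /= mulrC mulfK 1?mulrAC.
rewrite (Rintegral_FTC MM cf dF) /dirk /GRing.scale /= mulrN sinN [k * a * M]mulrAC.
by rewrite invfM /GRing.scale /=; ring.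
Qed.

Lemma integral_sin_sym (k M a : R) : 0 < M ->
  \int[leb]_(u in `[- M, M]) sin (k * u * a) = 0.
Proof.
move=> M0; have cf : continuous (fun u : R => sin (k * u * a)).
  move=> u; apply: continuous_comp; last exact: continuous_sin.
  by apply: cvgMr_tmp; apply: cvgMl_tmp; exact: cvg_id.
have MM : - M <= M by rewrite ge0_cp// ltW.
have [ka|ka] := eqVneq (k * a) 0.
  rewrite -[RHS](Rintegral_set0 leb (fun=> 0)) /Rintegral !integral0_eq// => u _.
  by rewrite mulrAC ka mul0r sin0.
rewrite -Rintegral_itv_obnd_cbnd; last exact: continuous_itv_integrable.
have dF (x : R) : is_derive x (1 : R) ((- (k * a)^-1) *: (cos \o ( *%R (k * a)))) (sin (k * x * a)).
  have d1 := is_derive_mull (k * a) x.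
  by apply: is_derive_eq; rewrite /GRing.scale /= mulrC mulNr mulrN mulNr opprK mulfK 1?mulrAC.
by rewrite (Rintegral_FTC MM cf dF) /GRing.scale /= mulrN cosN subrr.
Qed.

(** What additivity of the triple integral of F requires. *)
Definition iterable3 (M N : R) (F : R -> R -> R * R -> R) := [/\
  forall u v, integrable2 (F u v),
  forall v, leb.-integrable `[- M, M] (EFin \o (fun u => \int[leb2 R]_p F u v p)) &
  leb.-integrable `[- N, N]
    (EFin \o (fun v => \int[leb]_(u in `[- M, M]) \int[leb2 R]_p F u v p))].

Lemma iterable3D M N F G : iterable3 M N F -> iterable3 M N G ->
  iterable3 M N (fun u v p => F u v p + G u v p) /\
  \int[leb]_(v in `[- N, N]) \int[leb]_(u in `[- M, M]) \int[leb2 R]_p (F u v p + G u v p) =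
  \int[leb]_(v in `[- N, N]) \int[leb]_(u in `[- M, M]) \int[leb2 R]_p F u v p +
  \int[leb]_(v in `[- N, N]) \int[leb]_(u in `[- M, M]) \int[leb2 R]_p G u v p.
Proof.
move=> [f1 f2 f3] [g1 g2 g3].
have e u v : \int[leb2 R]_p (F u v p + G u v p) =
    \int[leb2 R]_p F u v p + \int[leb2 R]_p G u v p by rewrite RintegralD.
have e' v : \int[leb]_(u in `[- M, M]) \int[leb2 R]_p (F u v p + G u v p) =
    \int[leb]_(u in `[- M, M]) \int[leb2 R]_p F u v p +
    \int[leb]_(u in `[- M, M]) \int[leb2 R]_p G u v p.
  by under eq_Rintegral do rewrite e; rewrite RintegralD.
split; last by under eq_Rintegral do rewrite e'; rewrite RintegralD.
split.
- by move=> u v; exact: (integrableDR measurableT (f1 u v) (g1 u v)).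
- move=> v; apply: eq_integrable (integrableDR _ (f2 v) (g2 v)) => // u _.
  by rewrite /= e.
- by apply: eq_integrable (integrableDR _ f3 g3) => // v _; rewrite /= e'.
Qed.

Section Fubini2.
Variables (phi psi : R -> R) (k1 k2 x0 y0 M N : R) (g : R * R -> R).
Hypotheses (cphi : continuous phi) (cpsi : continuous psi).
Hypotheses (phi1 : forall x, `|phi x| <= 1) (psi1 : forall x, `|psi x| <= 1).
Hypothesis ig : integrable2 g.

Let F u v (p : R * R) := phi (k1 * u * (x0 - p.1)) * psi (k2 * v * (y0 - p.2)) * g p.

Lemma phase_integrals : iterable3 M N F /\
  \int[leb]_(v in `[- N, N]) \int[leb]_(u in `[- M, M]) \int[leb2 R]_p F u v p =
  \int[leb2 R]_p ((\int[leb]_(u in `[- M, M]) phi (k1 * u * (x0 - p.1))) *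
    (\int[leb]_(v in `[- N, N]) psi (k2 * v * (y0 - p.2))) * g p).
Proof.
have mphi : measurable_fun setT phi by exact: continuous_measurable_fun.
have mpsi : measurable_fun setT psi by exact: continuous_measurable_fun.
have mX : measurable_fun setT (fun z : measurableTypeR R * (T2 R) => phi (k1 * z.1 * (x0 - z.2.1))).
  apply: (measurableT_comp mphi); apply: measurable_funM.
    by apply: measurable_funM => //; exact: measurable_fst.
  by apply: measurable_funB => //; exact: (measurableT_comp measurable_fst measurable_snd).
have mY : measurable_fun setT (fun z : measurableTypeR R * (T2 R) => psi (k2 * z.1 * (y0 - z.2.2))).
  apply: (measurableT_comp mpsi); apply: measurable_funM.
    by apply: measurable_funM => //; exact: measurable_fst.
  by apply: measurable_funB => //; exact: (measurableT_comp measurable_snd measurable_snd).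
have bX (z : measurableTypeR R * (T2 R)) : `|phi (k1 * z.1 * (x0 - z.2.1))| <= 1 by exact: phi1.
have bY (z : measurableTypeR R * (T2 R)) : `|psi (k2 * z.1 * (y0 - z.2.2))| <= 1 by exact: psi1.
have igv v : integrable2 (fun p => psi (k2 * v * (y0 - p.2)) * g p).
  apply: (integrable_bmul measurableT _ (fun p _ => psi1 _) ig).
  by apply: (measurableT_comp mpsi); apply: measurable_funM => //; exact: measurable_funB.
pose A (p : R * R) := \int[leb]_(u in `[- M, M]) phi (k1 * u * (x0 - p.1)).
have igA : integrable2 (fun p => A p * g p).
  exact: (@integrable_param2 _ _ _ leb2s _ _ _ _ _ (integrable_cst1 M) mX bX ig).
have eF u v p : F u v p = phi (k1 * u * (x0 - p.1)) * (psi (k2 * v * (y0 - p.2)) * g p).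
  by rewrite /F mulrA.
have eU v : \int[leb]_(u in `[- M, M]) \int[leb2 R]_p F u v p =
    \int[leb2 R]_p (psi (k2 * v * (y0 - p.2)) * (A p * g p)).
  under eq_Rintegral do under eq_Rintegral do rewrite eF.
  rewrite (@Rintegral_param _ _ _ leb2s _ _ _ _ _ (integrable_cst1 M) mX bX (igv v))//.
  by apply: eq_Rintegral => p _; rewrite /A mulrCA.
split; last first.
  under eq_Rintegral do rewrite eU.
  rewrite (@Rintegral_param _ _ _ leb2s _ _ _ _ _ (integrable_cst1 N) mY bY igA)//.
  by apply: eq_Rintegral => p _; rewrite mulrCA mulrA.
split.
- move=> u v; rewrite (_ : EFin \o (F u v) = EFin \o (fun p =>
      phi (k1 * u * (x0 - p.1)) * (psi (k2 * v * (y0 - p.2)) * g p))); last first.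
    by apply/funext => p; rewrite /= eF.
  apply: (integrable_bmul measurableT _ (fun p _ => phi1 _) (igv v)).
  by apply: (measurableT_comp mphi); apply: measurable_funM => //; exact: measurable_funB.
- move=> v.
  apply: eq_integrable (@integrable_param _ _ _ leb2s _ _ _ _ _ (integrable_cst1 M) mX bX (igv v)) => // u _.
  congr EFin; apply: eq_Rintegral => p _.
  by rewrite eF.
- apply: eq_integrable (@integrable_param _ _ _ leb2s _ _ _ _ _ (integrable_cst1 N) mY bY igA) => // v _.
  by rewrite /= eU.
Qed.
End Fubini2.

(** Separates the phases from the quaternion: each term is a real product of a function
    of the first variable, one of the second, and one coordinate of a fixed
    quaternion. *)
Lemma qc_sandwich n (a b : R) (q : quat R) : qc n (qexp iq a * q * qexp jq b) =
  cos a * cos b * qc n q + cos a * sin b * qc n (q * jq) +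
  sin a * cos b * qc n (iq * q) + sin a * sin b * qc n (iq * q * jq).
Proof. by case: n => [|[|[|n]]] /=; ring. Qed.

Lemma integrable_mul_dirk2 (g : R * R -> R) (x0 y0 M N : R) : 0 <= M -> 0 <= N ->
  integrable2 g ->
  integrable2 (fun p => g p * dirk M (p.1 - x0) * dirk N (p.2 - y0)).
Proof.
move=> M0 N0 ig; apply: (integrable_bmulr measurableT _ (fun p _ => norm_dirk _ N0)).
  by apply: (measurable_fun_snd (c := fun t => dirk N (t - y0)));
    apply: measurableT_comp => //; [exact: measurable_dirk|exact: measurable_funB].
apply: (integrable_bmulr measurableT _ (fun p _ => norm_dirk _ M0) ig).
by apply: (measurable_fun_fst (c := fun s => dirk M (s - x0)));
  apply: measurableT_comp => //; [exact: measurable_dirk|exact: measurable_funB].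
Qed.

(** Only the cosines remain after the integrations over u and v. Their integrals give
    the Dirichlet kernels off the lines s = x0 and t = y0. *)
Lemma truncated_inversion (K : R * R -> quat R) (k1 k2 x0 y0 M N : R) n :
  0 < k1 -> 0 < k2 -> 0 < M -> 0 < N -> qintegrable (leb2 R) setT K ->
  qc n (qintegral leb `[- N, N] (fun v => qintegral leb `[- M, M] (fun u =>
    qintegral (leb2 R) setT (fun p =>
      qexp iq (k1 * u * (x0 - p.1)) * K p * qexp jq (k2 * v * (y0 - p.2)))))) =
  2 / k1 * (2 / k2) * \int[leb2 R]_p
    (qc n (K p) * dirk (k1 * M) (p.1 - x0) * dirk (k2 * N) (p.2 - y0)).
Proof.
move=> k10 k20 M0 N0 iK.
have qb (c : quat R) : qbounded (setT : set (T2 R)) (fun=> c) by exact: qbounded_cst.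
have i0 := iK n.
have i1 : integrable2 (fun p => qc n (K p * jq)).
  exact: (qintegrable_mulr measurableT (qb jq) iK).
have i2 : integrable2 (fun p => qc n (iq * K p)).
  exact: (qintegrable_mull measurableT (qb iq) iK).
have i3 : integrable2 (fun p => qc n (iq * K p * jq)).
  exact: (qintegrable_mulr measurableT (qb jq) (qintegrable_mull measurableT (qb iq) iK)).
have cos1 (x : R) : `|cos x| <= 1 by rewrite ler_norml cos_geN1 cos_le1.
have [p1 p2] := phase_integrals k1 k2 x0 y0 M N (@continuous_cos R) (@continuous_cos R) cos1 cos1 i0.
have [q1 q2] := phase_integrals k1 k2 x0 y0 M N (@continuous_cos R) (@continuous_sin R) cos1 (@norm_sin_le1 R) i1.
have [r1 r2] := phase_integrals k1 k2 x0 y0 M N (@continuous_sin R) (@continuous_cos R) (@norm_sin_le1 R) cos1 i2.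
have [s1 s2] := phase_integrals k1 k2 x0 y0 M N (@continuous_sin R) (@continuous_sin R) (@norm_sin_le1 R) (@norm_sin_le1 R) i3.
have [t1 t2] := iterable3D p1 q1.
have [t3 t4] := iterable3D t1 r1.
have [t5 t6] := iterable3D t3 s1.
rewrite qc_qintegral.
under eq_Rintegral => v _.
  rewrite qc_qintegral.
  under eq_Rintegral => u _.
    rewrite qc_qintegral; under eq_Rintegral do rewrite qc_sandwich.
    over.
  over.
rewrite t6 t4 t2 p2 q2 r2 s2.
have z (h : R * R -> R) : (forall p, h p = 0) -> \int[leb2 R]_p h p = 0.
  by move=> h0; rewrite /Rintegral integral0_eq// => p _; rewrite h0.
rewrite [X in _ + X + _ + _]z; last by move=> p; rewrite (integral_sin_sym _ _ N0) mulr0 mul0r.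
rewrite [X in _ + X + _]z; last by move=> p; rewrite (integral_sin_sym _ _ M0) !mul0r.
rewrite [X in _ + X]z; last by move=> p; rewrite (integral_sin_sym _ _ M0) !mul0r.
rewrite !addr0 -RintegralZl//; last first.
  by apply: integrable_mul_dirk2 => //; rewrite mulr_ge0// ltW.
apply: ae_Rintegral_congr.
have := ae_off_axes x0 y0.
apply: filterS => p [px py] _.
rewrite !integral_cos_sym// ?subr_eq0 1?eq_sym//.
have dN (L s : R) : dirk L (- s) = dirk L s by rewrite /dirk mulrN sinN invrN mulrNN.
rewrite -(opprB p.1) -(opprB p.2) !dN; ring.
Qed.

End TruncatedInversion.

Section KernelProduct.
Context {R : realType}.

(** The terms in u^2 and the constant phases cancel. *)
Lemma lct_kernel_inv (mu : quat R) (A : 'M[R]_2) (x u s : R) : mu = iq \/ mu = jq ->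
  \det A = 1 -> 0 < A 0 1 ->
  lct_kernel mu (invmx A) u x * lct_kernel mu A s u =
    (2 * pi * A 0 1)^-1 *: (qexp mu ((A 0 1)^-1 * u * (x - s)) *
      qexp mu (A 0 0 / (2 * A 0 1) * (s ^+ 2 - x ^+ 2))) /\
  lct_kernel mu A s u * lct_kernel mu (invmx A) u x =
    (2 * pi * A 0 1)^-1 *: (qexp mu (A 0 0 / (2 * A 0 1) * (s ^+ 2 - x ^+ 2)) *
      qexp mu ((A 0 1)^-1 * u * (x - s))).
Proof.
move=> muE dA b0; have [i00 i01 i11] := invmx2E dA.
rewrite !lct_kernelE// ?i01 ?oppr_eq0 ?gt_eqF// i00 i11.
rewrite normrN gtr0_norm// !scaleqAl !scaleqAr !scalerA -!qexpD// sgrN gtr0_sg//.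
have -> : (Num.sqrt (2 * pi * A 0 1))^-1 * (Num.sqrt (2 * pi * A 0 1))^-1 = (2 * pi * A 0 1)^-1.
  by rewrite -invfM -expr2 sqr_sqrtr//; apply: ltW; rewrite !mulr_gt0 ?pi_gt0.
have bN : A 0 1 != 0 by rewrite gt_eqF.
by split; congr (_ *: qexp mu _); field.
Qed.

Lemma measurable_qexp (mu : quat R) n (th : R -> R) : measurable_fun setT th ->
  measurable_fun setT (fun s => qc n (qexp mu (th s))).
Proof.
move=> mth.
rewrite (_ : (fun s => _) = (fun s => cos (th s) * qc n 1 + sin (th s) * qc n mu)); last first.
  by apply/funext => s; rewrite qcD !qcZ.
by apply: measurable_funD; apply: measurable_funM => //; apply: measurableT_comp => //;
  apply: continuous_measurable_fun; [exact: continuous_cos|exact: continuous_sin].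
Qed.

Lemma qexp_le1 (mu : quat R) n (a : R) : mu = iq \/ mu = jq -> `|qc n (qexp mu a)| <= 1.
Proof. by move=> muE; rewrite (le_trans (ler_qc_qnorm _ _))// qnorm_qexp. Qed.

Lemma qbounded_qexp d (T : measurableType d) (mu : quat R) (c : R) (th : R -> R) (h : T -> R) :
  mu = iq \/ mu = jq -> measurable_fun setT th -> measurable_fun setT h ->
  qbounded setT (fun x => c *: qexp mu (th (h x))).
Proof.
move=> muE mth mh n; split.
  rewrite (_ : (fun s => _) = (fun s => c * qc n (qexp mu (th (h s))))); last first.
    by apply/funext => s; rewrite qcZ.
  by apply: measurable_funM => //; exact: measurableT_comp (measurable_qexp mu n mth) mh.
by exists `|c| => x _; rewrite qcZ normrM ler_piMr// qexp_le1.
Qed.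

Lemma qbounded_lct_kernel (mu : quat R) (A : 'M[R]_2) (u : R) (h : T2 R -> R) :
  mu = iq \/ mu = jq -> A 0 1 != 0 -> measurable_fun setT h ->
  qbounded setT (fun p => lct_kernel mu A (h p) u).
Proof.
move=> muE b0 mh.
pose th (s : R) := A 0 0 / (2 * A 0 1) * s ^+ 2 - (A 0 1)^-1 * (s * u) +
      A 1 1 / (2 * A 0 1) * u ^+ 2 - Num.sg (A 0 1) * pi / 4.
rewrite (_ : (fun p => _) =
    (fun p => (Num.sqrt (2 * pi * `|A 0 1|))^-1 *: qexp mu (th (h p)))); last first.
  by apply/funext => p; rewrite lct_kernelE.
apply: (qbounded_qexp _ muE _ mh); rewrite /th.
apply: measurable_funB => //; apply: measurable_funD => //; apply: measurable_funB.
  by apply: measurable_funM => //; exact: measurable_funX.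
by apply: measurable_funM => //; exact: measurable_funM.
Qed.

(** The chirped function with its phases at (x0, y0) taken off, so that it has the same
    one-sided limits as f at this point. *)
Definition rephased (A1 A2 : 'M[R]_2) (x0 y0 : R) (f : R * R -> quat R) (p : R * R) : quat R :=
  qexp iq (A1 0 0 / (2 * A1 0 1) * (p.1 ^+ 2 - x0 ^+ 2)) * f p *
  qexp jq (A2 0 0 / (2 * A2 0 1) * (p.2 ^+ 2 - y0 ^+ 2)).

Lemma qintegrable_rephased A1 A2 x0 y0 (h : R * R -> quat R) :
  qintegrable (leb2 R) setT h -> qintegrable (leb2 R) setT (rephased A1 A2 x0 y0 h).
Proof.
move=> ih; have mth (a b : R) : measurable_fun setT (fun s : R => a * (s ^+ 2 - b)).
  by apply: measurable_funM => //; apply: measurable_funB => //; exact: measurable_funX.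
have ei : iq = iq :> quat R \/ iq = jq :> quat R by left.
have ej : jq = iq :> quat R \/ jq = jq :> quat R by right.
have := qbounded_qexp (T := (T2 R)) 1 ej (mth (A2 0 0 / (2 * A2 0 1)) (y0 ^+ 2)) measurable_snd.
have := qbounded_qexp (T := (T2 R)) 1 ei (mth (A1 0 0 / (2 * A1 0 1)) (x0 ^+ 2)) measurable_fst.
under eq_fun do rewrite scale1r; move=> b1.
under eq_fun do rewrite scale1r; move=> b2.
exact: qintegrable_mulr measurableT b2 (qintegrable_mull measurableT b1 ih).
Qed.

(** The constants: 1 / (2 pi b1) and 1 / (2 pi b2) from the kernels, 2 b1 and 2 b2 from the
    integrals of the cosines. *)
Lemma inv_qlct_partialE A1 A2 (f h : R * R -> quat R) x0 y0 M N n :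
  \det A1 = 1 -> \det A2 = 1 -> 0 < A1 0 1 -> 0 < A2 0 1 ->
  {ae leb2 R, forall p : T2 R, f p = h p} -> qintegrable (leb2 R) setT h ->
  0 < M -> 0 < N ->
  qc n (inv_qlct_partial A1 A2 f x0 y0 M N) = (pi^-1 * pi^-1) * \int[leb2 R]_p
    (qc n (rephased A1 A2 x0 y0 h p) * dirk ((A1 0 1)^-1 * M) (p.1 - x0) *
       dirk ((A2 0 1)^-1 * N) (p.2 - y0)).
Proof.
move=> d1 d2 b10 b20 fh ih M0 N0.
have ei : iq = iq :> quat R \/ iq = jq :> quat R by left.
have ej : jq = iq :> quat R \/ jq = jq :> quat R by right.
pose c : R := (2 * pi * A1 0 1)^-1 * (2 * pi * A2 0 1)^-1.
pose K p := c *: rephased A1 A2 x0 y0 h p.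
have iK : qintegrable (leb2 R) setT K.
  move=> m; have := integrableZR c measurableT (qintegrable_rephased A1 A2 x0 y0 ih m).
  by apply: eq_integrable => // p _; rewrite /= qcZ.
have k10 : 0 < (A1 0 1)^-1 by rewrite invr_gt0.
have k20 : 0 < (A2 0 1)^-1 by rewrite invr_gt0.
have inner u v : lct_kernel iq (invmx A1) u x0 * qlct A1 A2 f u v *
      lct_kernel jq (invmx A2) v y0 =
    qintegral (leb2 R) setT (fun p => qexp iq ((A1 0 1)^-1 * u * (x0 - p.1)) * K p *
      qexp jq ((A2 0 1)^-1 * v * (y0 - p.2))).
  have -> : qlct A1 A2 f u v = qlct A1 A2 h u v.
    apply: qc_ext => m; rewrite !qc_qintegral; apply: ae_Rintegral_congr.
    by apply: filterS fh => p -> _.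
  rewrite -qintegral_mul//; last first.
    have b1 := @qbounded_lct_kernel iq A1 u fst ei (lt0r_neq0 b10) measurable_fst.
    have b2 := @qbounded_lct_kernel jq A2 v snd ej (lt0r_neq0 b20) measurable_snd.
    exact: qintegrable_mulr measurableT b2 (qintegrable_mull measurableT b1 ih).
  congr qintegral; apply/funext => p; rewrite /K /rephased.
  have [e1 _] := lct_kernel_inv x0 u p.1 ei d1 b10.
  have [_ e2] := lct_kernel_inv y0 v p.2 ej d2 b20.
  have assoc (l k x k' r : quat R) : l * (k * x * k') * r = l * k * x * (k' * r) by rewrite !mulrA.
  rewrite assoc e1 e2; rewrite !(scaleqAl, scaleqAr) scalerA /c mulrC.
  have assoc' (k l x l' k' : quat R) : k * l * x * (l' * k') = k * (l * x * l') * k' by rewrite !mulrA.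
  by rewrite assoc'.
rewrite /inv_qlct_partial.
have -> : qintegral leb `[- N, N] (fun v => qintegral leb `[- M, M] (fun u =>
      lct_kernel iq (invmx A1) u x0 * qlct A1 A2 f u v * lct_kernel jq (invmx A2) v y0)) =
    qintegral leb `[- N, N] (fun v => qintegral leb `[- M, M] (fun u =>
     qintegral (leb2 R) setT (fun p => qexp iq ((A1 0 1)^-1 * u * (x0 - p.1)) * K p *
      qexp jq ((A2 0 1)^-1 * v * (y0 - p.2))))).
  by congr qintegral; apply/funext => v; congr qintegral; apply/funext => u.
rewrite truncated_inversion//.
have -> : \int[leb2 R]_p (qc n (K p) * dirk ((A1 0 1)^-1 * M) (p.1 - x0) *
       dirk ((A2 0 1)^-1 * N) (p.2 - y0)) = c * \int[leb2 R]_p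
    (qc n (rephased A1 A2 x0 y0 h p) * dirk ((A1 0 1)^-1 * M) (p.1 - x0) *
       dirk ((A2 0 1)^-1 * N) (p.2 - y0)).
  rewrite -RintegralZl//; last first.
    by apply: integrable_mul_dirk2; rewrite ?mulr_ge0 ?ltW//; exact: qintegrable_rephased.
  by apply: eq_Rintegral => p _; rewrite /K qcZ !mulrA.
rewrite [LHS]mulrA /c; congr (_ * _); rewrite !invrK !invfM.
have p0 := lt0r_neq0 (pi_gt0 R); have b1 := lt0r_neq0 b10; have b2 := lt0r_neq0 b20.
move: (@pi R) p0 => ppi p0; field.
by rewrite p0 b1 b2.
Qed.

End KernelProduct.

(** * Bounded variation and limits of quaternionic functions *)

Section QuaternionVariation.
Context {R : realType}.
Implicit Types (G : R -> R -> quat R) (e : R).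

Definition qbv2 e1 e2 G := forall n, exists V, bv2 e1 e2 (fun s t => qc n (G s t)) V.

Lemma qbv2D e1 e2 G G' : qbv2 e1 e2 G -> qbv2 e1 e2 G' ->
  qbv2 e1 e2 (fun s t => G s t + G' s t).
Proof.
move=> h h' n; have [V hV] := h n; have [W hW] := h' n; exists (V + W).
rewrite (_ : (fun s t => _) = (fun s t => qc n (G s t) + qc n (G' s t))).
  exact: bv2D.
by apply/funext => s; apply/funext => t; rewrite qcD.
Qed.

Let bv2Z e1 e2 (c : R) F V : 0 < e1 -> bv2 e1 e2 F V ->
  exists W, bv2 e1 e2 (fun s t => c * F s t) W.
Proof.
move=> e10 h; eexists; apply: (bv2_mul1 e10 h (c := fun=> c)).
apply: (lipschitz_bv_mult e10 (normr_ge0 c) (lexx 0)) => // x y _ _ _.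
by rewrite subrr normr0 mul0r.
Qed.

Let qc_jq n : exists (c : R) m, forall q : quat R, qc n (q * jq) = c * qc m q.
Proof.
case: n => [|[|[|n]]]; [exists (-1), 2%N|exists (-1), 3%N|exists 1, 0%N|exists 1, 1%N];
  by move=> q /=; ring.
Qed.

Let qc_iq n : exists (c : R) m, forall q : quat R, qc n (iq * q) = c * qc m q.
Proof.
case: n => [|[|[|n]]]; [exists (-1), 1%N|exists 1, 0%N|exists (-1), 3%N|exists 1, 2%N];
  by move=> q /=; ring.
Qed.

Lemma qbv2_mul_jq e1 e2 G : 0 < e1 -> qbv2 e1 e2 G -> qbv2 e1 e2 (fun s t => G s t * jq).
Proof.
move=> e10 h n; have [c [m e]] := qc_jq n; have [V hV] := h m.
have [W hW] := bv2Z c e10 hV; exists W.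
by under eq_fun do under eq_fun do rewrite e.
Qed.

Lemma qbv2_iq_mul e1 e2 G : 0 < e1 -> qbv2 e1 e2 G -> qbv2 e1 e2 (fun s t => iq * G s t).
Proof.
move=> e10 h n; have [c [m e]] := qc_iq n; have [V hV] := h m.
have [W hW] := bv2Z c e10 hV; exists W.
by under eq_fun do under eq_fun do rewrite e.
Qed.

Lemma cos_sin_lip (a b : R) : `|cos a - cos b| <= `|a - b| /\ `|sin a - sin b| <= `|a - b|.
Proof.
pose m := (a + b) / 2; pose d := (a - b) / 2.
have aE : a = m + d by rewrite /m /d; field.
have bE : b = m - d by rewrite /m /d; field.
have abE : a - b = 2 * d by rewrite /d; field.
have d2 (x : R) : `|x| <= 1 -> `|2 * (x * sin d)| <= `|a - b|.
  move=> x1; rewrite abE; move: d {abE aE bE} => d; rewrite !normrM ler_wpM2l// -[leRHS]mul1r ler_pM//.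
  exact: norm_sin_le.
split.
  have -> : cos a - cos b = 2 * (- sin m * sin d).
    by rewrite aE bE cosD cosB; ring.
  by apply: d2; rewrite normrN norm_sin_le1.
have -> : sin a - sin b = 2 * (cos m * sin d).
  by rewrite aE bE sinD sinB; ring.
by apply: d2; rewrite ler_norml cos_geN1 cos_le1.
Qed.

(** The phase of [rephased] along the half-line from x in the direction sg. *)
Definition phase (a x sg s : R) : R := a * ((x + sg * s) ^+ 2 - x ^+ 2).

Lemma phase_lip (a x sg e : R) : sg = 1 \/ sg = -1 -> 0 < e -> forall s s', 0 < s -> s < s' -> s' <= e ->
  `|phase a x sg s' - phase a x sg s| <= `|a| * (2 * `|x| + 2 * e) * (s' - s).
Proof.
move=> sgE e0 s s' s0 ss s'e.
have -> : phase a x sg s' - phase a x sg s = a * (2 * (sg * x) + (s' + s)) * (s' - s).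
  by rewrite /phase; case: sgE => ->; ring.
rewrite 2!normrM [`|s' - s|]gtr0_norm ?subr_gt0// ler_wpM2r ?subr_ge0 ?(ltW ss)//.
rewrite ler_wpM2l// (le_trans (ler_normD _ _))// lerD//.
  rewrite normrM [`|2|]ger0_norm// ler_wpM2l// normrM.
  by case: sgE => ->; rewrite ?normrN normr1 mul1r.
have aux (u v w : R) : 0 < u -> u < v -> v <= w -> v + u <= 2 * w by lra.
have s'0 := lt_trans s0 ss.
by rewrite gtr0_norm ?addr_gt0//; exact: aux.
Qed.

Lemma bv_mult_trig (a x sg e : R) : sg = 1 \/ sg = -1 -> 0 < e -> exists C,
  bv_mult e C (fun s => cos (phase a x sg s)) /\ bv_mult e C (fun s => sin (phase a x sg s)).
Proof.
move=> sgE e0; exists (1 + (`|a| * (2 * `|x| + 2 * e)) * e).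
have L0 : 0 <= `|a| * (2 * `|x| + 2 * e).
  by rewrite mulr_ge0// addr_ge0// mulr_ge0// ltW.
split; apply: lipschitz_bv_mult => //.
- by move=> s _ _; rewrite ler_norml cos_geN1 cos_le1.
- move=> s s' s0 ss s'e; apply: (le_trans _ (phase_lip a x sgE e0 s0 ss s'e)).
  by have [] := cos_sin_lip (phase a x sg s') (phase a x sg s).
- by move=> s _ _; exact: norm_sin_le1.
- move=> s s' s0 ss s'e; apply: (le_trans _ (phase_lip a x sgE e0 s0 ss s'e)).
  by have [] := cos_sin_lip (phase a x sg s') (phase a x sg s).
Qed.

Section Rephasing.
Variables (a b x y sg tg : R).
Hypotheses (sgE : sg = 1 \/ sg = -1) (tgE : tg = 1 \/ tg = -1).

Let rot G s t := qexp iq (phase a x sg s) * G s t * qexp jq (phase b y tg t).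

(** By [qc_sandwich], with Lipschitz functions of one variable as multipliers. *)
Lemma qbv2_rephase e1 e2 G : 0 < e1 -> 0 < e2 -> qbv2 e1 e2 G -> qbv2 e1 e2 (rot G).
Proof.
move=> e10 e20 h n.
have [C [cC sC]] := bv_mult_trig a x sgE e10.
have [D [cD sD]] := bv_mult_trig b y tgE e20.
have hj := qbv2_mul_jq e10 h; have hi := qbv2_iq_mul e10 h.
have hij := qbv2_mul_jq e10 hi.
have [V0 h0] := h n; have [V1 h1] := hj n; have [V2 h2] := hi n; have [V3 h3] := hij n.
have k0 := bv2_mul2 e20 (bv2_mul1 e10 h0 cC) cD.
have k1 := bv2_mul2 e20 (bv2_mul1 e10 h1 cC) sD.
have k2 := bv2_mul2 e20 (bv2_mul1 e10 h2 sC) cD.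
have k3 := bv2_mul2 e20 (bv2_mul1 e10 h3 sC) sD.
have k := bv2D (bv2D (bv2D k0 k1) k2) k3.
have [W kW] := ex_intro (bv2 e1 e2 _) _ k; exists W.
have -> // : (fun s t => qc n (rot G s t)) = (fun s t =>
    cos (phase b y tg t) * (cos (phase a x sg s) * qc n (G s t)) +
    sin (phase b y tg t) * (cos (phase a x sg s) * qc n (G s t * jq)) +
    cos (phase b y tg t) * (sin (phase a x sg s) * qc n (iq * G s t)) +
    sin (phase b y tg t) * (sin (phase a x sg s) * qc n (iq * G s t * jq))).
by apply/funext => s; apply/funext => t; rewrite /rot qc_sandwich; ring.
Qed.

End Rephasing.

End QuaternionVariation.

Section QuaternionLimits.
Context {R : realType}.
Implicit Types (G : R -> R -> quat R) (l : quat R).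

Lemma qcvg_coords (T : Type) (F : set_system T) {FF : Filter F} (g : T -> quat R) l :
  (forall n, qc n (g x) @[x --> F] --> qc n l) -> qcvg F g l.
Proof.
move=> h; rewrite /qcvg.
have c n : `|qc n (g x - l)| @[x --> F] --> (0 : R).
  have := cvg_norm (cvgB (h n) (@cvg_cst _ (qc n l) _ F _)).
  rewrite subrr normr0 => /(_ FF FF FF) hcv; apply: (cvg_trans _ hcv); apply: near_eq_cvg; apply: nearW => x.
  by rewrite /= qcB.
apply: (@squeeze_cvgr _ _ _ _ (cst 0) (fun x => 0 + `|qc 0 (g x - l)| + `|qc 1 (g x - l)| +
  `|qc 2 (g x - l)| + `|qc 3 (g x - l)|)).
- apply: nearW => x; rewrite sqrtr_ge0 (le_trans (ler_qnorm_qc _))//.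
  by rewrite !big_ord_recr big_ord0.
- exact: cvg_cst.
rewrite -[X in _ --> X](_ : 0 + 0 + 0 + 0 + 0 = 0); last by rewrite !addr0.
by do ![apply: cvgD]; by [exact: cvg_cst|exact: c].
Qed.

Definition qlim0 G l :=
  forall n, qc n (G p.1 p.2) @[p --> filter_prod 0^'+ 0^'+] --> qc n l.

Lemma qlim0D G G' l l' : qlim0 G l -> qlim0 G' l' -> qlim0 (fun s t => G s t + G' s t) (l + l').
Proof.
by move=> h h' n; rewrite qcD; under eq_fun do rewrite qcD; exact: cvgD (h n) (h' n).
Qed.

Lemma qbv2_lim e1 e2 G : 0 < e1 -> 0 < e2 -> qbv2 e1 e2 G -> exists l, qlim0 G l.
Proof.
move=> e10 e20 h.
have c n : cvg (qc n (G p.1 p.2) @[p --> filter_prod 0^'+ 0^'+]).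
  by have [V hV] := h n; exact: (bv2_cvg e10 e20 hV).
exists (Quat (lim (qc 0 (G p.1 p.2) @[p --> filter_prod 0^'+ 0^'+]))
  (lim (qc 1 (G p.1 p.2) @[p --> filter_prod 0^'+ 0^'+]))
  (lim (qc 2 (G p.1 p.2) @[p --> filter_prod 0^'+ 0^'+]))
  (lim (qc 3 (G p.1 p.2) @[p --> filter_prod 0^'+ 0^'+]))).
by case=> [|[|[|n]]] /=; [exact: (c 0%N)|exact: (c 1%N)|exact: (c 2%N)|exact: (c 3%N)].
Qed.

Lemma phase_cvg0 (a x sg : R) : phase a x sg s @[s --> 0^'+] --> (0 : R).
Proof.
apply: cvg_at_right_filter.
rewrite -[X in _ --> X](_ : phase a x sg 0 = 0); last by rewrite /phase mulr0 addr0 subrr mulr0.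
have cf : continuous (phase a x sg).
  move=> s; apply: cvgM; first exact: cvg_cst.
  apply: cvgB; last exact: cvg_cst.
  apply: (@cvg_comp _ _ _ (fun s => x + sg * s) (fun z => z ^+ 2)); last exact: exprn_continuous.
  apply: cvgD; first exact: cvg_cst.
  by apply: cvgM; [exact: cvg_cst|exact: cvg_id].
exact: cf.
Qed.

(** The phases tend to 0 at the point. *)
Lemma qlim0_rephase (a b x y sg tg : R) G l : qlim0 G l ->
  qlim0 (fun s t => qexp iq (phase a x sg s) * G s t * qexp jq (phase b y tg t)) l.
Proof.
move=> h n.
pose FP := filter_prod (0 : R)^'+ (0 : R)^'+.
have FF : Filter FP by exact: filter_prod_filter.
have c1 : phase a x sg p.1 @[p --> FP] --> (0 : R).
  by apply: cvg_comp (phase_cvg0 a x sg); exact: cvg_fst.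
have c2 : phase b y tg p.2 @[p --> FP] --> (0 : R).
  by apply: cvg_comp (phase_cvg0 b y tg); exact: cvg_snd.
have cc1 : cos (phase a x sg p.1) @[p --> FP] --> (1 : R).
  by rewrite -[X in _ --> X](@cos0 R); apply: (cvg_comp _ _ c1); exact: continuous_cos.
have cc2 : cos (phase b y tg p.2) @[p --> FP] --> (1 : R).
  by rewrite -[X in _ --> X](@cos0 R); apply: (cvg_comp _ _ c2); exact: continuous_cos.
have cs1 : sin (phase a x sg p.1) @[p --> FP] --> (0 : R).
  by rewrite -[X in _ --> X](@sin0 R); apply: (cvg_comp _ _ c1); exact: continuous_sin.
have cs2 : sin (phase b y tg p.2) @[p --> FP] --> (0 : R).
  by rewrite -[X in _ --> X](@sin0 R); apply: (cvg_comp _ _ c2); exact: continuous_sin.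
have lin (u v : quat R) : qc n (u * G p.1 p.2 * v) @[p --> FP] --> qc n (u * l * v).
  have [c0 [c1' [c2' [c3 e]]]] := qc_mul n u v.
  rewrite e; under eq_fun do rewrite e.
  by apply: cvgD; [apply: cvgD; [apply: cvgD|]|]; apply: cvgM; by [exact: cvg_cst|exact: h].
have cM (u v : R * R -> R) (s t : R) : u p @[p --> FP] --> s -> v p @[p --> FP] --> t ->
    u p * v p @[p --> FP] --> s * t by move=> *; exact: cvgM.
have cD (u v : R * R -> R) (s t : R) : u p @[p --> FP] --> s -> v p @[p --> FP] --> t ->
    u p + v p @[p --> FP] --> s + t by move=> *; exact: cvgD.
have := cD _ _ _ _ (cD _ _ _ _ (cD _ _ _ _ (cM _ _ _ _ (cM _ _ _ _ cc1 cc2) (h n))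
  (cM _ _ _ _ (cM _ _ _ _ cc1 cs2) (lin 1 jq))) (cM _ _ _ _ (cM _ _ _ _ cs1 cc2) (lin iq 1)))
  (cM _ _ _ _ (cM _ _ _ _ cs1 cs2) (lin iq jq)).
rewrite !(mul1r, mul0r, mulr0, addr0); move=> hcv; apply: (cvg_trans _ hcv); apply: near_eq_cvg.
by apply: nearW => p; rewrite /= qc_sandwich mul1r mulr1.
Qed.

Lemma qlim0_qcvg (f : R * R -> quat R) x y l : 
  (qlim0 (fun s t => f (x + 1 * s, y + 1 * t)) l -> qcvg (filter_prod x^'+ y^'+) f l) /\
  (qlim0 (fun s t => f (x + 1 * s, y + -1 * t)) l -> qcvg (filter_prod x^'+ y^'-) f l) /\
  (qlim0 (fun s t => f (x + -1 * s, y + 1 * t)) l -> qcvg (filter_prod x^'- y^'+) f l) /\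
  (qlim0 (fun s t => f (x + -1 * s, y + -1 * t)) l -> qcvg (filter_prod x^'- y^'-) f l).
Proof.
have cp (z : R) : 1 * (s - z) @[s --> z^'+] --> (0 : R)^'+.
  move=> A [eps /= eps0 hA]; exists eps => //= s zs sz.
  by rewrite mul1r; apply: hA => /=; rewrite ?subr_gt0// sub0r normrN distrC.
have cm (z : R) : -1 * (s - z) @[s --> z^'-] --> (0 : R)^'+.
  move=> A [eps /= eps0 hA]; exists eps => //= s zs sz.
  by rewrite mulN1r opprB; apply: hA => /=; rewrite ?subr_gt0// sub0r normrN.
have key (sg tg : R) (Fx Fy : set_system R) : Filter Fx -> Filter Fy ->
    sg * sg = 1 -> tg * tg = 1 ->
    sg * (s - x) @[s --> Fx] --> (0 : R)^'+ -> tg * (t - y) @[t --> Fy] --> (0 : R)^'+ ->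
    qlim0 (fun s t => f (x + sg * s, y + tg * t)) l -> qcvg (filter_prod Fx Fy) f l.
  move=> FFx FFy sg1 tg1 hx hy h; apply: qcvg_coords => n.
  have c : (sg * (p.1 - x), tg * (p.2 - y)) @[p --> filter_prod Fx Fy] -->
      filter_prod (0 : R)^'+ (0 : R)^'+.
    move=> A [[B C] [/= hB hC] BC].
    exists ([set s | B (sg * (s - x))], [set t | C (tg * (t - y))]).
      by split; [exact: (hx _ hB)|exact: (hy _ hC)].
    by move=> [s t] /= [Bs Ct]; apply: BC.
  have hcv := cvg_comp _ _ c (h n); apply: (cvg_trans _ hcv); apply: near_eq_cvg.
  apply: nearW => -[s t] /=; congr (qc n (f (_, _))).
    by rewrite mulrA sg1 mul1r addrC subrK.
  by rewrite mulrA tg1 mul1r addrC subrK.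
by do ![split]; apply: key; rewrite ?mul1r ?mulN1r ?opprK//; by [exact: cp|exact: cm].
Qed.

End QuaternionLimits.

(** * Integrability hypotheses *)

Section BorelVersion.
Context d (T : measurableType d) {R : realType}.
Variable m : {measure set T -> \bar R}.

Lemma measurable_qnorm (h : T -> quat R) : (forall n, measurable_fun setT (fun x => qc n (h x))) ->
  measurable_fun setT (fun x => qnorm (h x)).
Proof.
move=> mh; apply: (@measurableT_comp _ _ _ _ _ _ (@Num.sqrt R)).
  by apply: continuous_measurable_fun; exact: sqrt_continuous.
have sq n : measurable_fun setT (fun x => qc n (h x) ^+ 2) by exact: measurable_funX.
exact: measurable_funD (measurable_funD (measurable_funD (sq 0%N) (sq 1%N)) (sq 2%N)) (sq 3%N).
Qed.

Lemma qL1_borel (g : T -> quat R) : qL1 m g ->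
  exists2 h, qintegrable m setT h & {ae m, forall x, g x = h x}.
Proof.
move=> [[[h0 m0 e0] [h1 m1 e1] [h2 m2 e2] [h3 m3 e3]] fin].
pose h x := Quat (h0 x) (h1 x) (h2 x) (h3 x).
have gh : {ae m, forall x, g x = h x}.
  apply: filterS (filterI (filterI e0 e1) (filterI e2 e3)) => x [[/(_ I) a0 /(_ I) a1] [/(_ I) a2 /(_ I) a3]].
  by rewrite /h -a0 -a1 -a2 -a3; case: (g x).
exists h => // n.
have mh k : measurable_fun setT (fun x => qc k (h x)) by case: k => [|[|[|k]]].
have : m.-integrable setT (EFin \o (fun x => qnorm (h x))).
  apply/integrableP; split; first by apply/measurable_EFinP; exact: measurable_qnorm.
  rewrite (_ : (\int[m]_x _ = \int[m]_x (qnorm (g x))%:E)%E)//.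
  apply: ae_integral_congr; apply: filterS gh => x -> _ /=.
  by rewrite ger0_norm// sqrtr_ge0.
by apply: le_integrableR => // x _; exact: ler_qc_qnorm.
Qed.

End BorelVersion.

Section Localisation.
Context {R : realType}.
Variables (E E' : quat R).
Hypotheses (E1 : qnorm E = 1) (E'1 : qnorm E' = 1).

(** The condition LC is stated for G, which need not be Borel measurable; its integrals
    dominate those of the Borel function H by [ae_ge0_le_integral], and Tonelli's
    theorem applies to H. The unit factors E and E' do not change the modulus. *)
Lemma localisation_integrable n (G : R -> R -> quat R) (H : R * R -> R) (P : R -> R) (a e1 e2 : R) :
  integrable2 H -> integrable1 P ->
  {ae leb2 R, forall p : T2 R, H p = qc n (E * G p.1 p.2 * E')} ->
  {ae leb, forall t, P t = qc n (E * G a t * E')} ->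
  (\int[leb]_(t in `[e2, +oo[) \int[leb]_(s in `[0%R, e1])
     (qnorm (s^-1 *: (G s t - G a t)))%:E < +oo)%E ->
  integrable2 (fun p : T2 R =>
    \1_(`]0, e1]%classic) p.1 * \1_(`]e2, +oo[%classic) p.2 * ((H p - P p.2) / p.1)).
Proof.
move=> iH iP HG PG fin.
have mH : measurable_fun [set: T2 R] H by apply/measurable_EFinP; exact: measurable_int iH.
have mP : measurable_fun setT P by apply/measurable_EFinP; exact: measurable_int iP.
apply/(integrable21ltyP leb leb).
  apply/measurable_EFinP; apply: measurable_funM; first apply: measurable_funM.
  - by apply: (@measurable_fun_fst R (\1_(`]0, e1]%classic))); exact: measurable_indic.
  - by apply: (@measurable_fun_snd R (\1_(`]e2, +oo[%classic))); exact: measurable_indic.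
  apply: measurable_funM; first by apply: measurable_funB => //; exact: measurable_fun_snd.
  by apply: (measurable_fun_fst (c := fun s => s^-1)); exact: measurable_invR.
apply: le_lt_trans fin.
rewrite [leRHS]integral_mkcond.
have q0 s t : (0 <= (qnorm (s^-1 *: (G s t - G a t)))%:E)%E by rewrite lee_fin sqrtr_ge0.
apply: ae_ge0_le_integral => [t|t|].
- exact: integral_ge0.
- by rewrite /patch; case: ifP => // _; exact: integral_ge0.
have aeF := @ae_filter_ringOfSetsType _ _ R leb.
apply: (@filterS _ _ aeF _ _ _ (@filterI _ _ aeF _ _ PG (ae_sections2 HG))) => t [Pt Ht].
rewrite /patch mem_setE in_itv/= andbT; case: ifPn => [e2t|]; last first.
  rewrite -ltNge => te2; rewrite integral0_eq// => s _ /=.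
  have -> : \1_(`]e2, +oo[%classic) t = 0 :> R by rewrite indicE mem_setE in_itv/= andbT lt_gtF.
  by rewrite mulr0 mul0r normr0.
rewrite [leRHS]integral_mkcond; apply: ae_ge0_le_integral => [s|s|]; first by [].
- by rewrite /patch; case: ifP.
apply: (@filterS _ _ aeF _ _ _ Ht) => s Hs /=; rewrite Hs Pt.
rewrite /patch !indicE !mem_setE !in_itv/= andbT.
case: (boolP (0 < s <= e1)) => [/andP[s0 se]|_]; last first.
  by rewrite !mul0r normr0; case: ifP.
rewrite (ltW s0) se /= lee_fin !mul1r.
apply: (@le_trans _ _ (`|(qc n (E * G s t * E') - qc n (E * G a t * E')) / s|)).
  by rewrite [leLHS]normrM ler_piMl// ger0_norm; case: (e2 < t).
rewrite -qcB -mulrBl -mulrBr mulrC -qcZ (le_trans (ler_qc_qnorm _ _))//.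
by rewrite -scaleqAl -scaleqAr !qnormM E1 E'1 mul1r mulr1.
Qed.

Lemma localisation_integrable_swap n (G : R -> R -> quat R) (H : R * R -> R) (Q : R -> R) (b e1 e2 : R) :
  integrable2 H -> integrable1 Q ->
  {ae leb2 R, forall p : T2 R, H p = qc n (E * G p.1 p.2 * E')} ->
  {ae leb, forall s, Q s = qc n (E * G s b * E')} ->
  (\int[leb]_(s in `[e1, +oo[) \int[leb]_(t in `[0%R, e2])
     (qnorm (t^-1 *: (G s t - G s b)))%:E < +oo)%E ->
  integrable2 (fun p : T2 R =>
    \1_(`]e1, +oo[%classic) p.1 * \1_(`]0, e2]%classic) p.2 * ((H p - Q p.1) / p.2)).
Proof.
move=> iH iQ HG QG fin.
have HG' := preserving_ae measurable_swap2 leb2_swap2 HG.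
have := localisation_integrable (G := fun s t => G t s) (integrable_swap iH) iQ HG' QG fin.
move=> /integrable_swap; apply: eq_integrable => // p _ /=.
by rewrite [\1__ p.2 * _]mulrC -surjective_pairing.
Qed.

End Localisation.

(** * The inversion theorem *)

Section Inversion.
Context {R : realType}.
Variables (A1 A2 : 'M[R]_2) (x0 y0 e1 e2 : R).
Hypotheses (e10 : 0 < e1) (e20 : 0 < e2).
Let al := A1 0 0 / (2 * A1 0 1).
Let be := A2 0 0 / (2 * A2 0 1).
Implicit Types (f h : R * R -> quat R).

(** The symmetrisation [symm], with the signs as factors so that the four terms are
    instances of one expression. *)
Definition folded f (s t : R) : quat R :=
  f (x0 + -1 * s, y0 + -1 * t) + f (x0 + 1 * s, y0 + 1 * t) +
  f (x0 + -1 * s, y0 + 1 * t) + f (x0 + 1 * s, y0 + -1 * t).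

Lemma symmE f s t : symm x0 y0 f s t = folded f s t.
Proof. by rewrite /symm /folded !mulN1r !mul1r. Qed.

Lemma folded_rephased f s t : folded (rephased A1 A2 x0 y0 f) s t =
  qexp iq (al * - x0 ^+ 2) * symm x0 y0 (chirped A1 A2 f) s t * qexp jq (be * - y0 ^+ 2).
Proof.
have ei : iq = iq :> quat R \/ iq = jq :> quat R by left.
have ej : jq = iq :> quat R \/ jq = jq :> quat R by right.
have e p : rephased A1 A2 x0 y0 f p =
    qexp iq (al * - x0 ^+ 2) * chirped A1 A2 f p * qexp jq (be * - y0 ^+ 2).
  rewrite /rephased /chirped -/al -/be.
  rewrite [al * (_ - _)]mulrDr addrC qexpD// [be * (_ - _)]mulrDr qexpD//.
  have assoc (u v q w z : quat R) : u * v * q * (w * z) = u * (v * q * w) * z by rewrite !mulrA.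
  exact: assoc.
have lin (u v a b c d : quat R) : u * (a + b + c + d) * v =
    u * a * v + u * b * v + u * c * v + u * d * v by rewrite !mulrDr !mulrDl.
by rewrite symmE /folded !e lin.
Qed.

Lemma quadrant_qbv2 f (sg tg : R) : sg = 1 \/ sg = -1 -> tg = 1 \/ tg = -1 ->
  QBVF_on (cross x0 y0 e1 e2) f -> qbv2 e1 e2 (fun s t => f (x0 + sg * s, y0 + tg * t)).
Proof.
move=> sgE tgE hf.
have lt1 : x0 - e1 < x0 + e1 by rewrite ltrBlDr -addrA ltrDl addr_gt0.
have lt2 : y0 - e2 < y0 + e2 by rewrite ltrBlDr -addrA ltrDl addr_gt0.
have [b0 b1 b2 b3] : QBVF (x0 - e1) (x0 + e1) (y0 - e2) (y0 + e2) f.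
  apply: hf => // -[s t] [/= sI _]; left => /=.
  by move: sI; rewrite in_itv/= ler_distl.
case=> [|[|[|n]]] /=.
- exact: (BVF_bv2 e10 e20 sgE tgE b0).
- exact: (BVF_bv2 e10 e20 sgE tgE b1).
- exact: (BVF_bv2 e10 e20 sgE tgE b2).
- exact: (BVF_bv2 e10 e20 sgE tgE b3).
Qed.

Let one : (1 : R) = 1 \/ (1 : R) = -1. Proof. by left. Qed.
Let mone : (-1 : R) = 1 \/ (-1 : R) = -1. Proof. by right. Qed.

Lemma folded_qbv2 f : QBVF_on (cross x0 y0 e1 e2) f ->
  qbv2 e1 e2 (folded (rephased A1 A2 x0 y0 f)).
Proof.
move=> hf; have q (sg tg : R) (sgE : sg = 1 \/ sg = -1) (tgE : tg = 1 \/ tg = -1) :=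
  qbv2_rephase al be x0 y0 sgE tgE e10 e20 (quadrant_qbv2 sgE tgE hf).
exact: qbv2D (qbv2D (qbv2D (q _ _ mone mone) (q _ _ one one)) (q _ _ mone one)) (q _ _ one mone).
Qed.

Lemma folded_lim f lmm lpp lmp lpm :
  qlim0 (fun s t => f (x0 + -1 * s, y0 + -1 * t)) lmm ->
  qlim0 (fun s t => f (x0 + 1 * s, y0 + 1 * t)) lpp ->
  qlim0 (fun s t => f (x0 + -1 * s, y0 + 1 * t)) lmp ->
  qlim0 (fun s t => f (x0 + 1 * s, y0 + -1 * t)) lpm ->
  qlim0 (folded (rephased A1 A2 x0 y0 f)) (lmm + lpp + lmp + lpm).
Proof.
have q (sg tg : R) l : qlim0 (fun s t => f (x0 + sg * s, y0 + tg * t)) l ->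
    qlim0 (fun s t => rephased A1 A2 x0 y0 f (x0 + sg * s, y0 + tg * t)) l.
  exact: qlim0_rephase.
move=> /q h1 /q h2 /q h3 /q h4.
have := qlim0D (qlim0D (qlim0D h1 h2) h3) h4; exact.
Qed.

Lemma folded_integrable h n : qintegrable (leb2 R) setT h ->
  integrable2 (fun p : T2 R => qc n (folded h p.1 p.2)).
Proof.
move=> ih; have i (sg tg : R) (sgE : sg = 1 \/ sg = -1) (tgE : tg = 1 \/ tg = -1) :=
  preserving_integrable (@measurable_refl2 R x0 sg y0 tg)
   (fun A => @leb2_refl2 R x0 sg y0 tg A sgE tgE) (ih n).
have := integrableDR measurableT (integrableDR measurableT (integrableDR measurableT
  (i _ _ mone mone) (i _ _ one one)) (i _ _ mone one)) (i _ _ one mone).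
by apply: eq_integrable => // p _; rewrite /folded /comp !qcD.
Qed.

Lemma folded_ae f h : {ae leb2 R, forall p : T2 R, f p = h p} ->
  {ae leb2 R, forall p : T2 R, folded f p.1 p.2 = folded h p.1 p.2}.
Proof.
move=> fh; have i (sg tg : R) (sgE : sg = 1 \/ sg = -1) (tgE : tg = 1 \/ tg = -1) :=
  preserving_ae (@measurable_refl2 R x0 sg y0 tg)
   (fun A => @leb2_refl2 R x0 sg y0 tg A sgE tgE) fh.
apply: filterS (filterI (filterI (i _ _ mone mone) (i _ _ one one))
  (filterI (i _ _ mone one) (i _ _ one mone))) => p [[a b] [c d']].
rewrite /folded; move: a b c d'; rewrite /refl2 /refl => -> -> -> ->.
by [].
Qed.

(** [quadrant_lim2] for one coordinate. The functions P and Q are the sections of LC at a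
    and b, made Borel. *)
Lemma folded_lim2 f h n l : qL1 (leb2 R) f ->
  qintegrable (leb2 R) setT h -> {ae leb2 R, forall p : T2 R, f p = h p} ->
  QBVF_on (cross x0 y0 e1 e2) f -> LC x0 y0 e1 e2 (chirped A1 A2 f) ->
  qlim0 (folded (rephased A1 A2 x0 y0 f)) l ->
  let P : set (measurableTypeR R) := `]0, +oo[%classic in
  lim2 (fun M N => \int[leb2 R]_p (\1_P p.1 * \1_P p.2 *
    (qc n (folded (rephased A1 A2 x0 y0 h) p.1 p.2) * dirk M p.1 * dirk N p.2)))
    (pi / 2 * (pi / 2 * qc n l)).
Proof.
move=> fL1 ih fh hbv [a [b [ga gb lc1 lc2]]] hl P.
set gt := symm x0 y0 (chirped A1 A2 f) in ga gb lc1 lc2.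
pose E := qexp iq (al * - x0 ^+ 2); pose E' := qexp jq (be * - y0 ^+ 2).
have E1 : qnorm E = 1 by apply: qnorm_qexp; left.
have E'1 : qnorm E' = 1 by apply: qnorm_qexp; right.
have iH : integrable2 (fun p : T2 R => qc n (folded (rephased A1 A2 x0 y0 h) p.1 p.2)).
  by apply: folded_integrable; exact: qintegrable_rephased.
have fh' : {ae leb2 R, forall p : T2 R, rephased A1 A2 x0 y0 h p = rephased A1 A2 x0 y0 f p}.
  by apply: filterS fh => p e; rewrite /rephased e.
have HF := folded_ae fh'.
have HG : {ae leb2 R, forall p : T2 R, qc n (folded (rephased A1 A2 x0 y0 h) p.1 p.2) =
    qc n (E * gt p.1 p.2 * E')}.
  by apply: filterS HF => p ->; rewrite folded_rephased.
have sect (k : R -> quat R) : qL1 leb k -> exists2 P : R -> R,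
    integrable1 P & {ae leb, forall t, P t = qc n (E * k t * E')}.
  move=> /qL1_borel[k' ik' kk']; exists (fun t => qc n (E * k' t * E')).
    exact: (qintegrable_mulr measurableT (qbounded_cst _ E')
      (qintegrable_mull measurableT (qbounded_cst _ E) ik')).
  by apply: (@filterS _ _ (@ae_filter_ringOfSetsType _ _ R leb) _ _ _ kk') => t ->.
have [Pa iP PG] := sect _ ga.
have [Qb iQ QG] := sect _ gb.
have L1 := localisation_integrable E1 E'1 iH iP HG PG lc1.
have L2 := localisation_integrable_swap E1 E'1 iH iQ HG QG lc2.
have [V hV] := folded_qbv2 hbv n.
apply: (quadrant_lim2 e10 e20 iH iP iQ L1 L2 hV (hl n)).
by apply: filterS HF => p ->.
Qed.

End Inversion.

Theorem theorem3p4 (R : realType) (A1 A2 : 'M[R]_2) (f : R * R -> quat R)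
    (x0 y0 e1 e2 : R) :
  \det A1 = 1 -> \det A2 = 1 -> 0 < A1 0 1 -> 0 < A2 0 1 ->
  qL1 (leb2 R) f ->
  0 < e1 -> 0 < e2 ->
  QBVF_on (cross x0 y0 e1 e2) f ->
  LC x0 y0 e1 e2 (chirped A1 A2 f) ->
  exists fpp fpm fmp fmm : quat R,
    [/\ qcvg (filter_prod x0^'+ y0^'+) f fpp,
        qcvg (filter_prod x0^'+ y0^'-) f fpm,
        qcvg (filter_prod x0^'- y0^'+) f fmp,
        qcvg (filter_prod x0^'- y0^'-) f fmm &
        qcvg (filter_prod +oo +oo)
          (fun MN : R * R => inv_qlct_partial A1 A2 f x0 y0 MN.1 MN.2)
          (4^-1 *: (fpp + fpm + fmp + fmm))].
Proof.
move=> d1 d2 b10 b20 fL1 e10 e20 hbv hLC.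
have one : (1 : R) = 1 \/ (1 : R) = -1 by left.
have mone : (-1 : R) = 1 \/ (-1 : R) = -1 by right.
have lim (sg tg : R) (sgE : sg = 1 \/ sg = -1) (tgE : tg = 1 \/ tg = -1) :=
  qbv2_lim e10 e20 (quadrant_qbv2 e10 e20 sgE tgE hbv).
have [lpp hpp] := lim _ _ one one; have [lpm hpm] := lim _ _ one mone.
have [lmp hmp] := lim _ _ mone one; have [lmm hmm] := lim _ _ mone mone.
exists lpp, lpm, lmp, lmm.
have [c1 _] := qlim0_qcvg f x0 y0 lpp; have [_ [c2 _]] := qlim0_qcvg f x0 y0 lpm.
have [_ [_ [c3 _]]] := qlim0_qcvg f x0 y0 lmp; have [_ [_ [_ c4]]] := qlim0_qcvg f x0 y0 lmm.
split; [exact: c1|exact: c2|exact: c3|exact: c4|].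
have [h ih fh] := qL1_borel fL1.
have hl : qlim0 (folded x0 y0 (rephased A1 A2 x0 y0 f)) (lmm + lpp + lmp + lpm).
  exact: folded_lim.
apply: qcvg_coords => n; apply/cvgrPdist_le => eps eps0.
have pi0 : 0 < pi :> R by exact: pi_gt0.
have eps'0 : 0 < eps * (pi * pi) by rewrite !mulr_gt0.
have [X hX] := folded_lim2 e10 e20 n fL1 ih fh hbv hLC hl eps'0.
have k10 : 0 < (A1 0 1)^-1 by rewrite invr_gt0.
have k20 : 0 < (A2 0 1)^-1 by rewrite invr_gt0.
have big (b : R) : 0 < b -> \forall M \near +oo, 0 < M /\ X < b^-1 * M.
  move=> b0; exists (Num.max 0 (X * b)); split=> [|M]; first exact: num_real.
  by rewrite gt_max => /andP[M0 XM]; split; rewrite // mulrC ltr_pdivlMr.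
exists ([set M | 0 < M /\ X < (A1 0 1)^-1 * M], [set N | 0 < N /\ X < (A2 0 1)^-1 * N]).
  by split; exact: big.
move=> [M N] [/= [M0 XM] [N0 XN]].
rewrite (inv_qlct_partialE x0 y0 n d1 d2 b10 b20 fh ih M0 N0).
have iK := qintegrable_rephased A1 A2 x0 y0 ih n.
have kM : 0 <= (A1 0 1)^-1 * M by rewrite mulr_ge0// ltW.
have kN : 0 <= (A2 0 1)^-1 * N by rewrite mulr_ge0// ltW.
rewrite (fold_plane x0 y0 (integrable_mul_dirk2 _ _ kM kN iK)).
have := hX _ _ XM XN.
set I1 := \int[_]_p _; set I2 := \int[_]_p _ => hI.
have -> : I2 = I1.
  apply: eq_Rintegral => p _; congr (_ * _); rewrite /folded !qcD.
  have dN (L s : R) : dirk L (-1 * s) = dirk L s by rewrite mulN1r /dirk mulrN sinN invrN mulrNN.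
  have sub (x z : R) : x + z - x = z by rewrite addrC addKr.
  rewrite !sub !dN !mul1r; ring.
have -> : qc n (4^-1 *: (lpp + lpm + lmp + lmm)) - pi^-1 * pi^-1 * I1 =
    (pi * pi)^-1 * - (I1 - pi / 2 * (pi / 2 * qc n (lmm + lpp + lmp + lpm))).
  rewrite qcZ !qcD; move: (@pi R) (lt0r_neq0 pi0) => q q0; field; exact: q0.
rewrite normrM normrN gtr0_norm ?invr_gt0 ?mulr_gt0//.
by rewrite ler_pdivrMl ?mulr_gt0// [leRHS]mulrC.
Qed.
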